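(* Use the definitions in the context. (a) Fix positive integers $n,m,B$ and levels $\alpha,\delta\in(0,1)$, and put $p:=1-\alpha$. Let $X_n\in\mathbb{R}^{n\times d}$, $y_n\in\mathbb{R}^n$ be deterministic, $\lambda_n>0$, and let the sketch rows $s_{n,1},\dots,s_{n,m}$ be i.i.d. with $\mathbb{E}(s_{n,1}s_{n,1}^\top)=I_n$. Then $$\mathbb{P}^*\big\{\widehat\epsilon^{\,\mathrm{MC}}_{n,m,B}(\alpha,\delta)\ge q^*_{n,m}(1-\alpha)\big\}\ge1-\delta$$ almost surely with respect to the law of the sketch. (b) Fix $\alpha,\delta\in(0,1)$. Let $d$ be fixed and $m_n\to\infty$ as $n\to\infty$, and assume: (i) as $n\to\infty$, $\lambda_n\to\lambda_\infty\ge 0$, $H_n\to H$, $g_n\to g$ (finite limits), and there is $c_0>0$ with $\lambda_{\min}(H_n+\lambda_n I_d)\ge c_0$ for all sufficiently large $n$; (ii) for every $n$, $s_{n,1},\dots,s_{n,m_n}$ are i.i.d. with $\mathbb{E}(s_{n,1}s_{n,1}^\top)=I_n$; $$\sup_n \mathbb{E}\Big[\|z_{n,1}z_{n,1}^\top-H_n\|_{\mathrm F}^4+\|z_{n,1}u_{n,1}-g_n\|_2^4\Big]<\infty;$$ and there is a finite matrix $\Omega\in\mathbb{R}^{d\times d}$ such that $\Omega_n:=\mathbb{E}(\psi_{n,1}\psi_{n,1}^\top)\to\Omega$; (iii) $\operatorname{rank}(\Omega)\ge1$. Then, for any sequence of positive integers $B_n$ for which the adjusted order statistic is finite (i.e.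 $k_{B_n}(1-\alpha,\delta)<\infty$), $$\liminf_{n\to\infty}\mathbb{P}\big\{\|\widehat\beta_{n,m_n}-\beta_n\|_2\le\widehat\epsilon^{\,\mathrm{MC}}_{n,m_n,B_n}(\alpha,\delta)\big\}\ge1-\alpha-\delta,$$ where $\mathbb{P}$ is the joint probability over the sketch and the bootstrap draws.
   Context: Define $H_n:=\frac1n X_n^\top X_n$, $g_n:=\frac1n X_n^\top y_n$, $A_n:=(H_n+\lambda_n I_d)^{-1}$, $\beta_n:=A_ng_n$ (the minimizer over $\beta\in\mathbb{R}^d$ of $\frac1n\|X_n\beta-y_n\|_2^2+\lambda_n\|\beta\|_2^2$), where $X_n\in\mathbb{R}^{n\times d}$ and $y_n\in\mathbb{R}^n$ are deterministic, $\lambda_n>0$. For random sketch rows $s_{n,1},\dots,s_{n,m}\in\mathbb{R}^n$ define $z_{n,i}:=n^{-1/2}X_n^\top s_{n,i}\in\mathbb{R}^d$, $u_{n,i}:=n^{-1/2}y_n^\top s_{n,i}\in\mathbb{R}$, $\widehat H_{n,m}:=\frac1m\sum_{i=1}^m z_{n,i}z_{n,i}^\top$, $\widehat g_{n,m}:=\frac1m\sum_{i=1}^m z_{n,i}u_{n,i}$, and the sketched estimator $\widehat\beta_{n,m}:=(\widehat H_{n,m}+\lambda_nI_d)^{-1}\widehat g_{n,m}$. The influence vectors are $\psi_{n,i}:=A_n\{z_{n,i}(u_{n,i}-z_{n,i}^\top\beta_n)-\lambda_n\beta_n\}$, which have mean zero when the rows are isotropic. Bootstrap: conditionally on the sketch,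 draw $B$ independent weight vectors $w_b=(w_{b,1},\dots,w_{b,m})\sim\mathrm{Multinomial}(m;\frac1m,\dots,\frac1m)$, $b=1,\dots,B$, and set $\widehat H^*_{n,m,b}:=\frac1m\sum_i w_{b,i}z_{n,i}z_{n,i}^\top$, $\widehat g^*_{n,m,b}:=\frac1m\sum_i w_{b,i}z_{n,i}u_{n,i}$, $\widehat\beta^*_{n,m,b}:=(\widehat H^*_{n,m,b}+\lambda_nI_d)^{-1}\widehat g^*_{n,m,b}$, $e^*_{n,m,b}:=\|\widehat\beta^*_{n,m,b}-\widehat\beta_{n,m}\|_2$. Let $e^*_{n,m,(1)}\le\cdots\le e^*_{n,m,(B)}$ be the ordered errors. $\mathbb{P}^*$ denotes conditional probability given $\sigma(s_{n,1},\dots,s_{n,m})$. Exact conditional bootstrap quantile: $q^*_{n,m}(p):=\inf\{t\ge0:\mathbb{P}^*(e^*_{n,m,1}\le t)\ge p\}$. Rank: $k_B(p,\delta):=\min\{k\in\{1,\dots,B\}:\mathbb{P}\{\mathrm{Bin}(B,p)\le k-1\}\ge1-\delta\}$, with $k_B(p,\delta):=\infty$ if this set is empty, where $\mathrm{Bin}(B,p)$ is a binomial random variable. Adjusted error bound: with $p=1-\alpha$, $\widehat\epsilon^{\,\mathrm{MC}}_{n,m,B}(\alpha,\delta):=e^*_{n,m,(k_B(p,\delta))}$ if $k_B(p,\delta)<\infty$, and $:=+\infty$ otherwise. $\|\cdot\|_{\mathrm F}$ is the Frobenius norm and $\lambda_{\min}$ the smallest eigenvalue. *)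

(* Defs.v *)
From HB Require Import structures.
From mathcomp Require Import all_boot all_order all_algebra.
From mathcomp Require Import all_classical all_reals all_analysis.

Set Implicit Arguments.
Unset Strict Implicit.
Unset Printing Implicit Defensive.

Import Order.TTheory GRing.Theory Num.Theory.
Import numFieldNormedType.Exports.

Local Open Scope classical_set_scope.
Local Open Scope ring_scope.

(* The library norm on matrices is the sup norm; this one is the Euclidean
   norm on column vectors and the Frobenius norm on matrices. *)
Definition frobenius (R : realType) (p q : nat) (M : 'M[R]_(p, q)) : R :=
  Num.sqrt (\sum_i \sum_j M i j ^+ 2).

(* For symmetric [M] of positive size, this infimum is a minimum. *)
Definition lambda_min (R : realType) (d : nat) (M : 'M[R]_d) : R :=
  inf [set a | eigenvalue M a].

Definition gram (R : realType) (n d : nat) (X : 'M[R]_(n, d)) : 'M[R]_d :=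
  n%:R^-1 *: (X^T *m X).

Definition cross (R : realType) (n d : nat) (X : 'M[R]_(n, d))
    (y : 'cV[R]_n) : 'cV[R]_d :=
  n%:R^-1 *: (X^T *m y).

Definition resolvent (R : realType) (d : nat) (H : 'M[R]_d) (lam : R) :
    'M[R]_d :=
  invmx (H + lam%:M).

Definition ridge (R : realType) (n d : nat) (X : 'M[R]_(n, d))
    (y : 'cV[R]_n) (lam : R) : 'cV[R]_d :=
  resolvent (gram X) lam *m cross X y.

Definition zvec (R : realType) (n d : nat) (X : 'M[R]_(n, d))
    (s : 'cV[R]_n) : 'cV[R]_d :=
  (Num.sqrt n%:R)^-1 *: (X^T *m s).

Definition uval (R : realType) (n : nat) (y s : 'cV[R]_n) : R :=
  (Num.sqrt n%:R)^-1 * (y^T *m s) 0 0.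

Definition influence (R : realType) (n d : nat) (X : 'M[R]_(n, d))
    (y : 'cV[R]_n) (lam : R) (s : 'cV[R]_n) : 'cV[R]_d :=
  let z := zvec X s in
  let beta := ridge X y lam in
  resolvent (gram X) lam *m
    ((uval y s - (z^T *m beta) 0 0) *: z - lam *: beta).

(* In what follows [S i] is the realized value of the i-th sketch row. *)
Definition sketched_ridge (R : realType) (n d m : nat) (X : 'M[R]_(n, d))
    (y : 'cV[R]_n) (lam : R) (S : 'I_m -> 'cV[R]_n) : 'cV[R]_d :=
  let Hhat := m%:R^-1 *: \sum_i zvec X (S i) *m (zvec X (S i))^T in
  let ghat := m%:R^-1 *: \sum_i uval y (S i) *: zvec X (S i) in
  resolvent Hhat lam *m ghat.

Definition boot_ridge (R : realType) (n d m : nat) (X : 'M[R]_(n, d))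
    (y : 'cV[R]_n) (lam : R) (S : 'I_m -> 'cV[R]_n)
    (v : {ffun 'I_m -> nat}) : 'cV[R]_d :=
  let Hstar :=
    m%:R^-1 *: \sum_i (v i)%:R *: (zvec X (S i) *m (zvec X (S i))^T) in
  let gstar :=
    m%:R^-1 *: \sum_i (v i)%:R *: (uval y (S i) *: zvec X (S i)) in
  resolvent Hstar lam *m gstar.

Definition boot_error (R : realType) (n d m : nat) (X : 'M[R]_(n, d))
    (y : 'cV[R]_n) (lam : R) (S : 'I_m -> 'cV[R]_n)
    (v : {ffun 'I_m -> nat}) : R :=
  frobenius (boot_ridge X y lam S v - sketched_ridge X y lam S).

(* [None] stands for an infinite rank. *)
Definition mc_rank (R : realType) (B : nat) (p delta : R) : option nat :=
  ohead [seq k <- iota 1 B |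
    ((1 - delta)%:E <= binomial_prob B p [set j | (j <= k.-1)%N])%E].

Definition order_stat (R : realType) (B : nat) (e : 'I_B -> R) (k : nat) : R :=
  nth 0 (sort <=%R [seq e b | b <- enum 'I_B]) k.-1.

Definition mc_bound (R : realType) (B : nat) (alpha delta : R)
    (e : 'I_B -> R) : \bar R :=
  if mc_rank B (1 - alpha) delta is Some k then (order_stat e k)%:E
  else +oo%E.

Definition borel (R : realType) (n : nat) : set (set 'cV[R]_n) :=
  <<s @open 'cV[R]_n >>.

Definition iid_rows (R : realType) (disp : measure_display)
    (T : measurableType disp) (P : probability T R) (n m : nat)
    (s : 'I_m -> T -> 'cV[R]_n) : Prop :=
  [/\ forall i (A : set 'cV[R]_n), borel A -> measurable (s i @^-1` A),
      forall A : 'I_m -> set 'cV[R]_n, (forall i, borel (A i)) ->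
        P (\bigcap_i (s i @^-1` A i)) = (\prod_i P (s i @^-1` A i))%E
    & forall i j (A : set 'cV[R]_n), borel A ->
        P (s i @^-1` A) = P (s j @^-1` A)].

Definition has_mx_mean (R : realType) (disp : measure_display)
    (T : measurableType disp) (P : probability T R) (p q : nat)
    (M : T -> 'M[R]_(p, q)) (A : 'M[R]_(p, q)) : Prop :=
  forall i j, P.-integrable setT (fun t => (M t i j)%:E) /\
    'E_P[fun t => M t i j]%E = (A i j)%:E.

Definition isotropic (R : realType) (disp : measure_display)
    (T : measurableType disp) (P : probability T R) (n : nat)
    (s : T -> 'cV[R]_n) : Prop :=
  has_mx_mean P (fun t => s t *m (s t)^T) 1%:M.

Definition sketch_sigma (R : realType) (T : Type) (n m : nat)
    (s : 'I_m -> T -> 'cV[R]_n) : set (set T) :=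
  <<s [set s i.1 @^-1` i.2 | i in [set i | borel i.2]] >>.

(* [Y] is a version of the conditional probability P(E | G). *)
Definition cond_prob (R : realType) (disp : measure_display)
    (T : measurableType disp) (P : probability T R) (G : set (set T))
    (E : set T) (Y : T -> R) : Prop :=
  [/\ forall U : set R, measurable U -> G (Y @^-1` U),
      P.-integrable setT (EFin \o Y)
    & forall A, G A -> (\int[P]_(t in A) (Y t)%:E)%E = P (E `&` A)].

(* The mass function of Multinomial(m; 1/m, ..., 1/m). *)
Definition multinomial_pmf (R : realType) (m : nat)
    (v : {ffun 'I_m -> nat}) : R :=
  if (\sum_i v i == m)%N
  then m`!%:R / (\prod_i (v i)`!)%:R * m%:R^-1 ^+ m else 0.

(* Given the sketch, the weight vectors are independent multinomials. *)
Definition boot_weights (R : realType) (disp : measure_display)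
    (T : measurableType disp) (P : probability T R) (n m B : nat)
    (s : 'I_m -> T -> 'cV[R]_n) (w : 'I_B -> T -> {ffun 'I_m -> nat}) : Prop :=
  (forall b v, measurable [set t | w b t = v]) /\
  forall v : 'I_B -> {ffun 'I_m -> nat},
    cond_prob P (sketch_sigma s) [set t | forall b, w b t = v b]
      (fun=> \prod_b multinomial_pmf R (v b)).

(* [kappa] is a regular conditional distribution of [e] given [G], so that
   x |-> kappa t ]-oo, x] is a distribution function at every sample point t;
   a separate version of P(e <= x | G) for each x would not ensure this. *)
Definition cond_law (R : realType) (disp : measure_display)
    (T : measurableType disp) (P : probability T R) (G : set (set T))
    (e : T -> R) (kappa : T -> probability R R) : Prop :=
  forall U : set R, measurable U ->
    cond_prob P G (e @^-1` U) (fun t => fine (kappa t U)).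

Definition quantile (R : realType) (mu : probability R R) (p : R) : R :=
  inf [set t : R | 0 <= t /\ (p%:E <= mu [set x : R | (x <= t)%R])%E].

(* Main.v *)
Require Import Defs.
From HB Require Import structures.
From mathcomp Require Import all_boot all_order all_algebra.
From mathcomp Require Import all_classical all_reals all_analysis.
From mathcomp Require Import measurable_realfun.
From mathcomp Require Import zify ring lra.

Set Implicit Arguments.
Unset Strict Implicit.
Unset Printing Implicit Defensive.

Import Order.TTheory GRing.Theory Num.Theory.
Import numFieldNormedType.Exports.

Local Open Scope classical_set_scope.
Local Open Scope ring_scope.

(* (a) Given the sketch, the bootstrap errors are independent with a common law
   on finitely many values, so the number of them below the conditional quantile
   q is binomial with success probability P*(e* < q) <= 1 - alpha. Binomial
   lower tails decrease in the success probability, hence the k-th smallest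
   error is below q with conditional probability at most delta.

   (b) Let W be the sum of the influence vectors divided by sqrt m. No central
   limit theorem is used: |W|^2 and its bootstrap version are compared directly.
   The multinomial bootstrap sum is a sum of m independent uniform draws from
   the centred influence vectors of the sketch, so its covariance is close to
   that of W for most sketches, and Lindeberg's replacement argument bounds the
   difference of the expectations of a smoothed indicator of a ball. The same
   argument, with part of each summand replaced by a step of a simple random
   walk along a direction of positive variance, shows that |W|^2 gives little
   mass to thin annuli. Now fix a deterministic radius r slightly below the
   (1 - alpha)-quantile of |W|. For most sketches the bootstrap mass of the ball
   of radius r is below 1 - alpha, so as in (a) the adjusted bound is at least
   r / sqrt m with conditional probability at least 1 - delta, while the error
   of the sketched estimator exceeds r / sqrt m with probability close to
   alpha. *)

(** * Order statistics and multinomial weights *)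

(** The adjusted bound and the estimation error are computed from the same sketch, so neither can be
    treated as fixed when the other varies. A deterministic radius r separates them: coverage fails
    only if the bound is below r or the error is above r, and these two failures cost about delta
    and alpha.

    Bounding the bootstrap mass strictly below r, instead of locating the random bootstrap quantile,
    needs one implication only: a small bootstrap error forces a small linearized sum.

    The limit Omega may be singular, so no density is available for W. One direction of positive
    variance is enough, because on a line the squared norm is a quadratic polynomial, which meets an
    annulus in at most two short intervals.

    The test functions are built from cubes of positive parts. Their second-order expansion and its
    cubic remainder are polynomial algebra, and averaging over translations preserves both, so no
    derivatives appear.

    Every estimate holds at finite m with constants that depend only on the dimension, the levels
    and the moment bounds. The probability space may therefore change with n. *)

Definition binomial_tail (R : realType) (B j : nat) (p : R) : R :=
  \sum_(k < j) binomial_pmf B p k.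

(** Conditioning on the first of [B.+1] trials, which is Pascal's rule term by term. It gives
    monotonicity in [p] without differentiation. *)
Lemma binomial_tailS (R : realType) (B j : nat) (p : R) :
  binomial_tail B.+1 j.+1 p =
  p * binomial_tail B j p + (1 - p) * binomial_tail B j.+1 p.
Proof.
rewrite /binomial_tail !mulr_sumr big_ord_recl /=.
rewrite [in RHS]big_ord_recl /= addrCA -big_split /=; congr +%R.
  by rewrite /binomial_pmf !bin0 !subn0 !expr0 !mul1r !mulr1n exprS.
apply: eq_bigr => i _; rewrite /bump /= add1n /binomial_pmf binS subSS.
have [iB|Bi] := ltnP i B; last first.
  rewrite (@bin_small B i.+1) // add0n mulr0n mulr0 addr0.
  by rewrite -mulrnAr exprS -mulrA mulrnAr.
rewrite mulrnDr addrC -!mulrnAr -(subnSK iB) !exprS !mulrnAr /unstable.onem.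
by move: (p ^+ i) (_ ^+ (B - i.+1)) => x y; congr (_ *+ _ + _ *+ _); ring.
Qed.

Lemma binomial_tail0 (R : realType) (B : nat) (p : R) : binomial_tail B 0 p = 0.
Proof. by rewrite /binomial_tail big_ord0. Qed.

(** Induction on [B]: the recursion is a convex combination of the tails [j] and [j.+1], of which
    the first is smaller. Raising [p] moves weight to the smaller one, and both decrease by
    induction. *)
Lemma binomial_tail_anti (R : realType) (B j : nat) (p q : R) :
  0 <= p -> p <= q -> q <= 1 -> binomial_tail B j q <= binomial_tail B j p.
Proof.
move=> p0 pq q1; elim: B j => [|B IH] [|j]; rewrite ?binomial_tail0//.
  have E x : binomial_tail 0 j.+1 x = 1 :> R.
    rewrite /binomial_tail big_ord_recl big1 => [|i _].
      by rewrite addr0 /binomial_pmf !expr0 mulr1.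
    by rewrite /binomial_pmf bin_small.
  by rewrite !E.
rewrite !binomial_tailS.
have h1 := IH j; have h2 := IH j.+1.
have h3 : binomial_tail B j p <= binomial_tail B j.+1 p.
  rewrite /binomial_tail big_ord_recr/= lerDl binomial_pmf_ge0// p0 /=.
  exact: le_trans q1.
nra.
Qed.

Lemma binomial_prob_le (R : realType) (B k : nat) (p : R) :
  0 <= p <= 1 -> (0 < k)%N ->
  binomial_prob B p [set j | (j <= k.-1)%N] = (binomial_tail B k p)%:E.
Proof.
move=> p01 k0; rewrite /binomial_prob p01.
have -> : [set j | (j <= k.-1)%N] = `I_k.
  by case: k k0 => // k _; apply/seteqP; split=> j /=; rewrite ltnS.
rewrite esum_fset//=; last first.
  by move=> i _; rewrite lee_fin binomial_pmf_ge0.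
by rewrite -fsbig_ord//= /binomial_tail -sumEFin.
Qed.

Lemma mc_rankP (R : realType) (B k : nat) (p delta : R) :
  0 <= p <= 1 -> mc_rank B p delta = Some k ->
  [/\ (0 < k)%N, (k <= B)%N & 1 - delta <= binomial_tail B k p].
Proof.
move=> p01; rewrite /mc_rank; set l := [seq _ <- _ | _].
case E : l => [//|x l'] [<-].
have : x \in l by rewrite E mem_head.
rewrite mem_filter mem_iota => /andP[h /andP[x0 xB]].
split=> //.
by rewrite -lee_fin -binomial_prob_le.
Qed.

Lemma sorted_nth_lt (R : realDomainType) (s : seq R) (k : nat) (x0 r : R) :
  sorted <=%R s -> (k < size s)%N ->
  (nth x0 s k < r) = (k < count (< r) s)%N.
Proof.
have H (x : R) (t : seq R) : path <=%R x t -> r <= x -> count (< r) t = 0%N.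
  move=> /le_path_min/allP xt rx; apply/eqP; rewrite -leqn0 leqNgt -has_count.
  by apply/hasPn => y /xt xy; rewrite -leNgt (le_trans rx).
elim: s k => [//|x s IH] [|k] /= ps ks.
  by case: ltP => // rx; rewrite (H x).
rewrite IH//; last by apply: path_sorted ps.
by case: ltP => // rx; rewrite (H x).
Qed.

(** Sorting permutes the values and so preserves the number of those below [r]. This trades the
    order statistic for a count, which has a binomial law. *)
Lemma order_stat_lt (R : realType) (B k : nat) (e : 'I_B -> R) (r : R) :
  (0 < k)%N -> (k <= B)%N ->
  (order_stat e k < r) = (k <= #|[set b | (e b < r)%R]%SET|)%N.
Proof.
move=> k0 kB; rewrite /order_stat.
rewrite sorted_nth_lt; last 2 first.
- exact: sort_le_sorted.
- by rewrite size_sort size_map size_enum_ord prednK.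
rewrite prednK //.
rewrite (permP (permEl (perm_sort _ _))) count_map cardE size_filter.
by rewrite enumT; congr (_ <= _)%N; apply: eq_count => b /=; rewrite inE.
Qed.

(** The draws are grouped by the set [J] of indices that land in [L], on which the product
    factorizes, and then by the cardinality of [J], which yields the binomial coefficients. *)
Lemma sum_prod_card_lt (R : realType) (V : finType) (B k : nat)
    (pi : V -> R) (L : {pred V}) :
  \sum_v pi v = 1 ->
  \sum_(f : {ffun 'I_B -> V})
     (\prod_b pi (f b)) * (#|[set b | f b \in L]%SET| < k)%N%:R =
  binomial_tail B k (\sum_(v in L) pi v).
Proof.
move=> pi1; set p := \sum_(v in L) pi v.
have pC : \sum_(v | v \notin L) pi v = 1 - p.
  by rewrite -pi1 [in RHS](bigID (mem L)) /= -/p addrAC subrr add0r.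
have fibre (J : {set 'I_B}) :
    \sum_(f : {ffun 'I_B -> V} | [set b | f b \in L]%SET == J)
      \prod_b pi (f b) = p ^+ #|J| * (1 - p) ^+ (B - #|J|).
  transitivity (\prod_(b < B) \sum_v
      (if (v \in L) == (b \in J) then pi v else 0)).
    rewrite bigA_distr_bigA /= big_mkcond; apply: eq_bigr => f _.
    case: ifPn => [/eqP <-|/eqP fJ].
      by apply: eq_bigr => b _; rewrite inE eqxx.
    have /existsP[b bJ] : [exists b, (f b \in L) != (b \in J)].
      apply: contra_notT fJ => /existsPn h; apply/setP => b.
      by rewrite inE; apply/eqP/negPn/h.
    by rewrite (bigD1 b)//= (negbTE bJ) mul0r.
  have -> : (B - #|J|)%N = #|(~: J)%SET|.
    by rewrite -[X in (X - _)%N]card_ord -(cardsC J) addKn.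
  rewrite (bigID (mem J)) /= -!prodr_const; congr *%R.
    apply: eq_bigr => b ->; rewrite -big_mkcond /=.
    by apply: eq_bigl => v; rewrite eqb_id.
  apply: eq_big => [b|b bJ]; first by rewrite inE.
  rewrite (negbTE bJ) -big_mkcond -pC /=.
  by apply: eq_bigl => v; rewrite eqbF_neg.
rewrite (partition_big (fun f : {ffun 'I_B -> V} => [set b | f b \in L]%SET)
  xpredT) //=.
transitivity (\sum_(J : {set 'I_B} | (#|J| < k)%N)
    p ^+ #|J| * (1 - p) ^+ (B - #|J|)).
  rewrite [RHS]big_mkcond; apply: eq_bigr => J _.
  case: ifPn => Jk.
    by rewrite -fibre; apply: eq_bigr => f /eqP ->; rewrite Jk mulr1.
  by rewrite big1 // => f /eqP ->; rewrite (negbTE Jk) mulr0.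
rewrite (partition_big (fun J : {set 'I_B} => inord #|J| : 'I_B.+1) 
  (fun j : 'I_B.+1 => (j < k)%N)) /=; last first.
  move=> J Jk; rewrite inordK // ltnS.
  by rewrite (leq_trans (max_card _)) // card_ord.
transitivity (\sum_(j < B.+1 | (j < k)%N) binomial_pmf B p j).
  apply: eq_bigr => j jk; rewrite /binomial_pmf.
  have -> : 'C(B, j) = #|[set J : {set 'I_B} | #|J| == j]%SET|.
    by rewrite card_draws card_ord.
  rewrite -sumr_const.
  have HJ (J : {set 'I_B}) : (inord #|J| == j) = (#|J| == j).
    by rewrite -val_eqE /= inordK // ltnS -[leqRHS]card_ord max_card.
  apply: eq_big => [J|J /andP[_]]; rewrite HJ ?inE.
    by case: eqP => [->|]; rewrite ?jk ?andbF.
  by move=> /eqP ->.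
rewrite /binomial_tail -(big_mkord (fun j => (j < k)%N) (binomial_pmf B p)).
rewrite -(big_mkord xpredT (binomial_pmf B p)).
(* [k] may exceed [B.+1]; the surplus terms of the tail have a zero binomial coefficient. *)
have [kB|Bk] := leqP k B.+1; first by rewrite [RHS](big_nat_widen 0 _ B.+1).
rewrite [RHS](big_cat_nat (n := B.+1)) ?(ltnW Bk) //=.
rewrite [X in _ + X]big_nat_cond [X in _ + X]big1 ?addr0; last first.
  by move=> j /andP[/andP[Bj _] _]; rewrite /binomial_pmf bin_small.
rewrite big_nat_cond [RHS]big_nat_cond; apply: eq_bigl => j.
by case: (ltnP j B.+1) => //= jB; rewrite (ltn_trans jB Bk).
Qed.
(** The hypothesis limits the mass strictly below [r], so an atom at [r] counts in favour of
    coverage. This is what suits the discrete bootstrap law. *)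
Lemma order_stat_coverage (R : realType) (V : finType) (B k : nat)
    (p delta r : R) (pi : V -> R) (e : V -> R) :
  0 <= p <= 1 -> mc_rank B p delta = Some k ->
  (forall v, 0 <= pi v) -> \sum_v pi v = 1 ->
  \sum_(v | (e v < r)%R) pi v <= p ->
  1 - delta <= \sum_(f : {ffun 'I_B -> V})
     (\prod_b pi (f b)) * (r <= order_stat (e \o f) k)%R%:R.
Proof.
move=> /andP[p0 p1] /(mc_rankP (introT andP (conj p0 p1)))[k0 kB dk] pi0 pi1 le_p.
apply: (le_trans dk).
have -> : \sum_(f : {ffun 'I_B -> V})
     (\prod_b pi (f b)) * (r <= order_stat (e \o f) k)%R%:R
  = binomial_tail B k (\sum_(v | (e v < r)%R) pi v).
  rewrite (eq_bigl (fun v => v \in [pred v | (e v < r)%R])) //.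
  rewrite -sum_prod_card_lt //; apply: eq_bigr => f _; congr (_ * _%:R).
  rewrite leNgt order_stat_lt // -ltnNge; congr (_ < _)%N.
apply: binomial_tail_anti => //.
by apply: sumr_ge0 => v _.
Qed.

(** The transition operator of a walk whose steps are uniform on the family [y]. Its iterates stand
    for expectations over independent draws, so no probability space has to be enlarged. *)
Definition avg_shift (R : numFieldType) (V : zmodType) (K : finType)
    (y : K -> V) (f : V -> R) (x : V) : R :=
  #|K|%:R^-1 * \sum_k f (x + y k).

(** The multinomial theorem for shifts: [N] draws are recorded by their counts [v]. The counts are
    capped at [M] to live in a finite type, and [N <= M] makes the cap harmless. *)
Lemma iter_avg_shift (R : numFieldType) (V : zmodType) (m M N : nat)
    (y : 'I_m -> V) (f : V -> R) (x : V) : (N <= M)%N ->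
  iter N (avg_shift y) f x =
  \sum_(v : {ffun 'I_m -> 'I_M.+1} | (\sum_i v i == N)%N)
    N`!%:R / (\prod_i (v i)`!)%:R * m%:R^-1 ^+ N * f (x + \sum_i y i *+ v i).
Proof.
elim: N x => [|N IH] x NM.
  rewrite /= (big_pred1 [ffun=> ord0]) => [|v].
    rewrite !big1 => [|i _|i _]; rewrite ?ffunE //=.
    by rewrite addr0 fact0 divr1 expr0 !mul1r.
  rewrite sum_nat_eq0; apply/forallP/eqP => [h|-> i]; last by rewrite ffunE.
  by apply/ffunP => i; apply/val_inj; rewrite ffunE; have /eqP := h i.
rewrite iterS (_ : avg_shift y _ x = m%:R^-1 * \sum_k iter N (avg_shift y) f (x + y k));
  last by rewrite /avg_shift card_ord.
pose inc k (v : {ffun 'I_m -> 'I_M.+1}) : {ffun 'I_m -> 'I_M.+1} :=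
  [ffun i => inord (v i + (i == k))].
pose dec k (v : {ffun 'I_m -> 'I_M.+1}) : {ffun 'I_m -> 'I_M.+1} :=
  [ffun i => inord (v i - (i == k))].
(* Weighting by [v k] singles out one draw equal to [k]. Removing it is a bijection onto the counts
   of total [N], and the factor [v k] cancels against the factorial. *)
have step k : \sum_(v : {ffun 'I_m -> 'I_M.+1} | (\sum_i v i == N.+1)%N)
     (v k)%:R * (N`!%:R / (\prod_i (v i)`!)%:R * m%:R^-1 ^+ N *
      f (x + \sum_i y i *+ v i)) =
   iter N (avg_shift y) f (x + y k).
  rewrite IH ?(ltnW NM) //.
  rewrite (bigID (fun v : {ffun 'I_m -> 'I_M.+1} => (0 < v k)%N)) /=.
  rewrite [X in _ + X]big1 ?addr0; last first.
    by move=> v /andP[_]; rewrite lt0n negbK => /eqP ->; rewrite mul0r.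
  rewrite (reindex_onto (inc k) (dec k)) /=; last first.
    move=> v /andP[_ vk]; apply/ffunP => i; apply/val_inj; rewrite !ffunE /=.
    have vi := ltn_ord (v i); have vk' := ltn_ord (v k).
    by case: eqP => [->|_]; rewrite ?subn0 ?addn0 !inordK //; lia.
  have incE (v : {ffun 'I_m -> 'I_M.+1}) i : (v k < M)%N -> inc k v i = (v i + (i == k))%N :> nat.
    move=> vM; rewrite ffunE inordK //; have := ltn_ord (v i).
    by case: eqP => [->|]; lia.
  have sum_inc (v : {ffun 'I_m -> 'I_M.+1}) : (v k < M)%N -> (\sum_i inc k v i = (\sum_i v i).+1)%N.
    move=> vM; under eq_bigr do rewrite incE //.
    rewrite big_split /= -[RHS]addn1; congr addn.
    by rewrite (bigD1 k) //= eqxx big1 // => i /negbTE ->.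
  have le_sum (v : {ffun 'I_m -> 'I_M.+1}) : (v k <= \sum_i v i)%N.
    by rewrite (bigD1 k) //= leq_addr.
  have Mlt (v : {ffun 'I_m -> 'I_M.+1}) : (0 < inc k v k)%N -> (v k < M)%N.
    move=> vk; have := ltn_ord (v k); rewrite ltnS leq_eqVlt => /orP[/eqP E|//].
    by move: vk; rewrite ffunE eqxx E addn1 /inord val_insubd ltnn.
  apply: eq_big => [v|v /andP[/andP[/eqP s1 vk] _]].
    apply/idP/idP => [/andP[/andP[/eqP s1 vk] _]|/eqP sv].
      by move: s1; rewrite (sum_inc _ (Mlt _ vk)) => -[->].
    have vM : (v k < M)%N by rewrite (leq_ltn_trans (le_sum v)) // sv.
    rewrite sum_inc // sv eqxx incE // eqxx addn1 /=.
    apply/eqP/ffunP => i; apply/val_inj; rewrite ffunE incE //= addnK.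
    by rewrite inord_val.
  have vM := Mlt _ vk.
  have -> : (\prod_i (inc k v i)`! = (v k).+1 * \prod_i (v i)`!)%N.
    rewrite (bigD1 k) //= [in RHS](bigD1 k) //= incE // eqxx addn1 factS mulnA.
    by congr muln; apply: eq_bigr => i /negbTE ik; rewrite incE // ik addn0.
  have -> : x + \sum_i y i *+ inc k v i = x + y k + \sum_i y i *+ v i.
    rewrite -addrA; congr +%R.
    under eq_bigr do rewrite incE // mulrnDr.
    rewrite big_split /= addrC; congr +%R.
    by rewrite (bigD1 k) //= eqxx big1 ?addr0 // => i /negbTE ->.
  rewrite incE // eqxx addn1 natrM invfM !mulrA; congr (_ * _ * _ * _).
  by rewrite mulrAC divff ?mul1r // pnatr_eq0.
transitivity (m%:R^-1 * \sum_k \sum_(v : {ffun 'I_m -> 'I_M.+1} | (\sum_i v i == N.+1)%N)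
     (v k)%:R * (N`!%:R / (\prod_i (v i)`!)%:R * m%:R^-1 ^+ N *
      f (x + \sum_i y i *+ v i))).
  by congr (_ * _); apply: eq_bigr => k _; rewrite step.
(* The [v k] add up to [N.+1], which completes the factorial of [N.+1]. *)
rewrite exchange_big mulr_sumr; apply: eq_bigr => v /eqP sv.
rewrite -mulr_suml -natr_sum sv factS natrM exprS.
rewrite !mulrA; congr (_ * _).
move: (m%:R^-1 ^+ N : R) (m%:R^-1 : R) (N.+1%:R : R) => a b c; ring.
Qed.

(** Every vector of positive multinomial mass has entries at most [m], so sums over the finite type
    of capped vectors carry the whole law. *)
Definition weight (m : nat) (v : {ffun 'I_m -> 'I_m.+1}) : {ffun 'I_m -> nat} :=
  [ffun i => v i : nat].

(** A multinomial vector counts how often each index occurs among [m] uniform draws. The right side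
    exposes the draws one at a time, the form that the replacement argument needs. *)
Lemma multinomial_sum (R : realType) (V : zmodType) (m : nat)
    (y : 'I_m -> V) (f : V -> R) :
  \sum_v multinomial_pmf R (weight v) * f (\sum_i y i *+ weight v i) =
  iter m (avg_shift y) f 0.
Proof.
rewrite (@iter_avg_shift _ _ _ m) // [RHS]big_mkcond; apply: eq_bigr => v _.
have E i : weight v i = v i by rewrite ffunE.
rewrite /multinomial_pmf (eq_bigr _ (fun i _ => E i)).
case: ifP => _; last by rewrite mul0r.
rewrite add0r; congr (_ / _%:R * _ * f _).
  by apply: eq_bigr => i _; rewrite E.
by apply: eq_bigr => i _; rewrite E.
Qed.

Lemma multinomial_ge0 (R : realType) (m : nat) (v : {ffun 'I_m -> nat}) :
  0 <= multinomial_pmf R v.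
Proof.
by rewrite /multinomial_pmf; case: ifP.
Qed.

Lemma avg_shift_cst (R : numFieldType) (V : zmodType) (K : finType)
    (y : K -> V) (c : R) : (0 < #|K|)%N -> avg_shift y (fun=> c) = fun=> c.
Proof.
move=> K0; apply/funext => x; rewrite /avg_shift sumr_const.
by rewrite -(mulr_natl c) mulrA mulVf ?mul1r // pnatr_eq0 -lt0n.
Qed.

Lemma iter_avg_shift_cst (R : numFieldType) (V : zmodType) (K : finType)
    (y : K -> V) (c : R) (N : nat) :
  (0 < #|K|)%N -> iter N (avg_shift y) (fun=> c) = fun=> c.
Proof. by move=> K0; elim: N => // N IH; rewrite iterS IH avg_shift_cst. Qed.

Lemma multinomial_sum1 (R : realType) (m : nat) : (0 < m)%N ->
  \sum_v multinomial_pmf R (@weight m v) = 1.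
Proof.
move=> m0; have := @multinomial_sum R R m (fun=> 0) (fun=> 1).
under eq_bigr do rewrite mulr1; move=> ->.
by rewrite iter_avg_shift_cst // card_ord.
Qed.

(** * Expectations and independence of rows *)

(** Integrability of real functions and expectations as real numbers keep the estimates inside an
    ordered field. A value of [mean] is meaningful together with [L1]. *)
Definition L1 (R : realType) (disp : measure_display)
    (T : measurableType disp) (P : probability T R) (f : T -> R) : Prop :=
  P.-integrable setT (EFin \o f).

Definition mean (R : realType) (disp : measure_display)
    (T : measurableType disp) (P : probability T R) (f : T -> R) : R :=
  Rintegral P setT f.

Lemma L1_measurable (R : realType) (disp : measure_display)
    (T : measurableType disp) (P : probability T R) (f : T -> R) :
  L1 P f -> measurable_fun setT f.
Proof. by move=> /measurable_int/measurable_EFinP. Qed.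

Lemma L1D (R : realType) (disp : measure_display)
    (T : measurableType disp) (P : probability T R) (f g : T -> R) :
  L1 P f -> L1 P g -> L1 P (fun t => f t + g t).
Proof. by move=> sf sg; apply: eq_integrable (integrableD _ sf sg). Qed.

Lemma L1B (R : realType) (disp : measure_display)
    (T : measurableType disp) (P : probability T R) (f g : T -> R) :
  L1 P f -> L1 P g -> L1 P (fun t => f t - g t).
Proof. by move=> sf sg; apply: eq_integrable (integrableB _ sf sg). Qed.

Lemma L1Z (R : realType) (disp : measure_display)
    (T : measurableType disp) (P : probability T R) (c : R) (f : T -> R) :
  L1 P f -> L1 P (fun t => c * f t).
Proof. by move=> sf; apply: eq_integrable (integrableZl _ c sf). Qed.

Lemma L1_cst (R : realType) (disp : measure_display)
    (T : measurableType disp) (P : probability T R) (c : R) :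
  L1 P (fun=> c).
Proof. exact: finite_measure_integrable_cst. Qed.

Lemma L1_le (R : realType) (disp : measure_display)
    (T : measurableType disp) (P : probability T R) (f g : T -> R) :
  measurable_fun setT f -> L1 P g -> (forall t, `|f t| <= g t) ->
  L1 P f.
Proof.
move=> mf sg fg; apply: (le_integrable _ _ _ sg) => //.
  exact/measurable_EFinP.
by move=> t _ /=; rewrite lee_fin (le_trans (fg t)) // ler_norm.
Qed.

Lemma L1_bounded (R : realType) (disp : measure_display)
    (T : measurableType disp) (P : probability T R) (c : R) (f : T -> R) :
  measurable_fun setT f -> (forall t, `|f t| <= c) -> L1 P f.
Proof. by move=> mf fc; apply: L1_le mf (L1_cst P c) fc. Qed.

Lemma L1_norm (R : realType) (disp : measure_display)
    (T : measurableType disp) (P : probability T R) (f : T -> R) :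
  L1 P f -> L1 P (fun t => `|f t|).
Proof. by move=> sf; apply: eq_integrable (integrable_abse sf). Qed.

Lemma L1_sum (R : realType) (disp : measure_display)
    (T : measurableType disp) (P : probability T R) (I : Type) (r : seq I)
    (Q : pred I) (f : I -> T -> R) :
  (forall i, Q i -> L1 P (f i)) ->
  L1 P (fun t => \sum_(i <- r | Q i) f i t).
Proof.
move=> sf; elim: r => [|i r IH].
  apply: eq_integrable (L1_cst P 0) => // t _.
  by rewrite /= big_nil.
case Qi : (Q i).
  apply: eq_integrable (L1D (sf i Qi) IH) => // t _.
  by rewrite /= big_cons Qi.
by apply: eq_integrable IH => // t _; rewrite /= big_cons Qi.
Qed.

Lemma meanE (R : realType) (disp : measure_display)
    (T : measurableType disp) (P : probability T R) (f : T -> R) :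
  L1 P f -> (\int[P]_t (f t)%:E)%E = (mean P f)%:E.
Proof. by move=> sf; rewrite /mean /Rintegral fineK // integrable_fin_num. Qed.

Lemma meanD (R : realType) (disp : measure_display)
    (T : measurableType disp) (P : probability T R) (f g : T -> R) :
  L1 P f -> L1 P g ->
  mean P (fun t => f t + g t) = mean P f + mean P g.
Proof. by move=> sf sg; rewrite /mean RintegralD. Qed.

Lemma meanB (R : realType) (disp : measure_display)
    (T : measurableType disp) (P : probability T R) (f g : T -> R) :
  L1 P f -> L1 P g ->
  mean P (fun t => f t - g t) = mean P f - mean P g.
Proof. by move=> sf sg; rewrite /mean RintegralB. Qed.

Lemma meanZ (R : realType) (disp : measure_display)
    (T : measurableType disp) (P : probability T R) (c : R) (f : T -> R) :
  L1 P f -> mean P (fun t => c * f t) = c * mean P f.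
Proof. by move=> sf; rewrite /mean RintegralZl. Qed.

Lemma mean_cst (R : realType) (disp : measure_display)
    (T : measurableType disp) (P : probability T R) (c : R) :
  mean P (fun=> c) = c.
Proof. by rewrite /mean Rintegral_cst //= probability_setT /= mulr1. Qed.

Lemma mean_sum (R : realType) (disp : measure_display)
    (T : measurableType disp) (P : probability T R) (I : Type) (r : seq I)
    (Q : pred I) (f : I -> T -> R) :
  (forall i, Q i -> L1 P (f i)) ->
  mean P (fun t => \sum_(i <- r | Q i) f i t) =
  \sum_(i <- r | Q i) mean P (f i).
Proof.
move=> sf; elim: r => [|i r IH].
  rewrite big_nil -[RHS](mean_cst P 0); congr mean; apply/funext => t.
  by rewrite big_nil.
case Qi : (Q i).
  rewrite big_cons Qi -IH -meanD; [|exact: sf|exact: L1_sum].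
  by congr mean; apply/funext => t; rewrite big_cons Qi.
by rewrite big_cons Qi -IH; congr mean; apply/funext => t; rewrite big_cons Qi.
Qed.

Lemma mean_le (R : realType) (disp : measure_display)
    (T : measurableType disp) (P : probability T R) (f g : T -> R) :
  L1 P f -> L1 P g -> (forall t, f t <= g t) ->
  mean P f <= mean P g.
Proof. by move=> sf sg fg; apply: le_Rintegral. Qed.

Lemma mean_ge0 (R : realType) (disp : measure_display)
    (T : measurableType disp) (P : probability T R) (f : T -> R) :
  (forall t, 0 <= f t) -> 0 <= mean P f.
Proof. by move=> f0; apply: Rintegral_ge0. Qed.

Lemma mean_norm (R : realType) (disp : measure_display)
    (T : measurableType disp) (P : probability T R) (f : T -> R) :
  L1 P f -> `|mean P f| <= mean P (fun t => `|f t|).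
Proof. by move=> sf; apply: le_normr_Rintegral. Qed.

Lemma mean_indic (R : realType) (disp : measure_display)
    (T : measurableType disp) (P : probability T R) (A : set T) :
  measurable A -> mean P \1_A = fine (P A).
Proof. by move=> mA; rewrite /mean /Rintegral integral_indic // setIT. Qed.

(** The joint law agrees with the product of the marginal laws on rectangles, hence everywhere, and
    Fubini's theorem applies to the product function. *)
Lemma indep_mean (R : realType) (disp : measure_display)
    (T : measurableType disp) (P : probability T R) (X Y : T -> R) :
  L1 P X -> L1 P Y ->
  (forall A B : set R, measurable A -> measurable B ->
     P (X @^-1` A `&` Y @^-1` B) = (P (X @^-1` A) * P (Y @^-1` B))%E) ->
  L1 P (fun t => X t * Y t) /\
  mean P (fun t => X t * Y t) = mean P X * mean P Y.
Proof.
move=> sX sY XY.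
have mX := L1_measurable sX; have mY := L1_measurable sY.
pose X' : {mfun T >-> R} := mfun_Sub (mem_set mX).
pose Y' : {mfun T >-> R} := mfun_Sub (mem_set mY).
have mh : measurable_fun setT (fun t => (X t, Y t)).
  exact: measurable_fun_pair.
pose h : {mfun T >-> (R * R)%type} := mfun_Sub (mem_set mh).
pose f (z : R * R) : R := z.1 * z.2.
have mf : measurable_fun setT f.
  by apply: measurable_funM; [exact: measurable_fst|exact: measurable_snd].
have prodE (A : set (R * R)) : measurable A ->
    (distribution P X' \x distribution P Y')%E A = distribution P h A.
  move=> mA; apply: product_measure_unique => // B C mB mC; exact: XY.
have iX : (\int[distribution P X']_x `|x%:E| = (mean P (fun t => `|X t|))%:E)%E.
  rewrite ge0_integral_distribution //=; last exact: measurableT_comp.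
  exact: (meanE (L1_norm sX)).
have iY : (\int[distribution P Y']_x `|x%:E| = (mean P (fun t => `|Y t|))%:E)%E.
  rewrite ge0_integral_distribution //=; last exact: measurableT_comp.
  exact: (meanE (L1_norm sY)).
(* Tonelli: the iterated integral of the absolute value is the product of the two absolute means. *)
have if_ : (distribution P X' \x distribution P Y')%E.-integrable setT (EFin \o f).
  apply/integrable12ltyP; first exact/measurable_EFinP.
  under eq_integral => x _.
    under eq_integral => y _ do rewrite /= /f /= normrM EFinM.
    rewrite ge0_integralZl //; last 1 first.
      exact: measurableT_comp.
    rewrite iY.
    over.
  rewrite ge0_integralZr //; last first.
  - by rewrite lee_fin mean_ge0.
  - exact: measurableT_comp.
  by rewrite iX -EFinM ltry.
have prod_int (g : R * R -> \bar R) :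
    (\int[distribution P h]_z g z =
     \int[(distribution P X' \x distribution P Y')%E]_z g z)%E.
  by apply: eq_measure_integral => A mA _; apply/esym/prodE.
have sXY : L1 P (fun t => X t * Y t).
  apply/integrableP; split; first exact/measurable_EFinP/measurable_funM.
  move/integrableP: if_ => -[_]; rewrite -prod_int ge0_integral_distribution //.
  by apply: measurableT_comp => //; exact/measurable_EFinP.
split=> //; apply: EFin_inj; rewrite -(meanE sXY).
transitivity (\int[distribution P h]_z (f z)%:E)%E.
  by rewrite integral_distribution //; exact/measurable_EFinP.
rewrite prod_int -integral12_prod_meas1 //.
have iXE : (\int[distribution P X']_x x%:E = (mean P X)%:E)%E.
  by rewrite integral_distribution //; exact: (meanE sX).
have iYE : (\int[distribution P Y']_x x%:E = (mean P Y)%:E)%E.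
  by rewrite integral_distribution //; exact: (meanE sY).
have idY : (distribution P Y').-integrable setT (EFin \o id).
  by apply/integrableP; split; [exact/measurable_EFinP|rewrite iY ltry].
have idX : (distribution P X').-integrable setT (EFin \o id).
  by apply/integrableP; split; [exact/measurable_EFinP|rewrite iX ltry].
under eq_integral => x _.
  rewrite /fubini_F.
  under eq_integral => y _ do rewrite /= /f /= EFinM.
  rewrite (integralZl _ idY) // iYE.
  over.
by rewrite integralZr // iXE -EFinM.
Qed.

(** A generating family, not yet a sigma-algebra. [J] is the complement of a row in independence
    arguments, and the full set when the whole sketch is meant. *)
Definition rows_sigma (R : realType) (T : Type) (n m : nat)
    (s : 'I_m -> T -> 'cV[R]_n) (J : set 'I_m) : set (set T) :=
  [set s i.1 @^-1` i.2 | i in [set i | J i.1 /\ borel i.2]].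

Lemma sketch_sigmaE (R : realType) (T : Type) (n m : nat)
    (s : 'I_m -> T -> 'cV[R]_n) :
  sketch_sigma s = <<s rows_sigma s setT >>.
Proof.
rewrite /sketch_sigma /rows_sigma; congr (<<s _ >>); apply/seteqP.
by split=> A [i /= hi <-]; exists i => //=; case: hi.
Qed.

Lemma rows_sigma_measurable (R : realType) (disp : measure_display)
    (T : measurableType disp) (P : probability T R) (n m : nat)
    (s : 'I_m -> T -> 'cV[R]_n) (J : set 'I_m) :
  iid_rows P s -> <<s rows_sigma s J >> `<=` measurable.
Proof.
move=> [ms _ _]; apply: smallest_sub; first exact: sigma_algebra_measurable.
by move=> _ [i [_ mi] <-]; exact: ms.
Qed.

(** Independence is given on rectangles only. As functions of [E], both sides are finite measures
    that agree on a family of cylinders closed under intersection, hence on the sigma-algebra that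
    it generates. *)
Lemma rows_indep (R : realType) (disp : measure_display)
    (T : measurableType disp) (P : probability T R) (n m : nat)
    (s : 'I_m -> T -> 'cV[R]_n) (i : 'I_m) (E : set T) (A : set 'cV[R]_n) :
  iid_rows P s -> <<s rows_sigma s [set~ i] >> E -> borel A ->
  P (E `&` s i @^-1` A) = (P E * P (s i @^-1` A))%E.
Proof.
move=> iid sE bA; have [ms indep _] := iid.
have mF : measurable (s i @^-1` A) by exact: ms.
(* Cylinders that leave row [i] free, so that the constraint [A] can be inserted in that place. *)
pose C := [set \bigcap_j (s j @^-1` F j) | F in
  [set F : 'I_m -> set 'cV[R]_n | (forall j, borel (F j)) /\ F i = setT]].
have bT : borel [set: 'cV[R]_n] by apply: sub_sigma_algebra; exact: openT.
have bI (B D : set 'cV[R]_n) : borel B -> borel D -> borel (B `&` D).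
  move=> bB bD.
  exact: (@measurableI _ (g_sigma_algebraType (@open 'cV[R]_n)) B D).
have mC : C `<=` measurable.
  move=> _ [F [bF _] <-]; apply: fin_bigcap_measurable => // j _.
  exact: ms.
have sub : <<s rows_sigma s [set~ i] >> `<=` <<s C >>.
  apply: smallest_sub; first exact: smallest_sigma_algebra.
  move=> _ [[j B] [/= ji bB] <-]; apply: sub_sigma_algebra.
  exists (fun k => if k == j then B else setT).
    split; first by move=> k; case: ifP.
    by case: eqP => // ij; case: ji.
  apply/seteqP; split=> t /=; first by move/(_ j I); rewrite /= eqxx.
  by move=> Bt k _ /=; case: eqP => // ->.
pose p := fine (P (s i @^-1` A)).
have p0 : 0 <= p by rewrite fine_ge0.
have pE : P (s i @^-1` A) = p%:E by rewrite fineK // fin_num_measure.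
suff: mrestr P mF E = mscale (NngNum p0) P E.
  by rewrite /mrestr /mscale /= pE muleC.
apply: (@g_sigma_algebra_measure_unique _ R T C mC (fun=> setT) _ _
  (mrestr P mF) (mscale (NngNum p0) P) _ _ _ E (sub _ sE)).
- move=> _; exists (fun=> setT); first by split.
  by apply/seteqP; split.
- by apply/seteqP; split=> // t _; exists 0%N.
- move=> _ _ [F [bF Fi] <-] [G [bG Gi] <-].
  exists (fun j => F j `&` G j).
    by split; [move=> j; exact: bI|rewrite Fi Gi setIT].
  by rewrite -bigcapI; apply: eq_bigcapr => j _; rewrite preimage_setI.
- move=> _ [F [bF Fi] <-].
  change (P (\bigcap_j (s j @^-1` F j) `&` s i @^-1` A) =
    (p%:E * P (\bigcap_j (s j @^-1` F j)))%E).
  have -> : \bigcap_j (s j @^-1` F j) `&` s i @^-1` A =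
      \bigcap_j (s j @^-1` (if j == i then A else F j)).
    apply/seteqP; split=> t /=.
      by move=> [h At] j _ /=; case: eqP => [->//|_]; exact: h.
    move=> h; split; last by have := h i I; rewrite /= eqxx.
    by move=> j _; have := h j I => /=; case: eqP => // -> _; rewrite Fi.
  rewrite indep; last by move=> j; case: ifP.
  rewrite (bigD1 i) //= eqxx pE; congr (_ * _)%E.
  rewrite indep // [RHS](bigD1 i) //= Fi preimage_setT probability_setT mul1e.
  by apply: eq_bigr => j /negbTE ->.
- move=> _; change (P (setT `&` s i @^-1` A) < +oo)%E.
  by rewrite setTI pE ltry.
Qed.

Lemma row_indep_mean (R : realType) (disp : measure_display)
    (T : measurableType disp) (P : probability T R) (n m : nat)
    (s : 'I_m -> T -> 'cV[R]_n) (i : 'I_m) (X : T -> R) (phi : 'cV[R]_n -> R) :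
  iid_rows P s ->
  measurable_fun (setT : set (g_sigma_algebraType (rows_sigma s [set~ i]))) X ->
  measurable_fun (setT : set (g_sigma_algebraType (@open 'cV[R]_n))) phi ->
  L1 P X -> L1 P (phi \o s i) ->
  L1 P (fun t => X t * phi (s i t)) /\
  mean P (fun t => X t * phi (s i t)) = mean P X * mean P (phi \o s i).
Proof.
move=> iid mX mphi sX sphi; apply: indep_mean => // A B mA mB.
apply: (rows_indep (A := phi @^-1` B) iid).
  by have := mX measurableT A mA; rewrite setTI.
by have := mphi measurableT B mB; rewrite setTI.
Qed.

Lemma row_mean_eq (R : realType) (disp : measure_display)
    (T : measurableType disp) (P : probability T R) (n m : nat)
    (s : 'I_m -> T -> 'cV[R]_n) (i j : 'I_m) (phi : 'cV[R]_n -> R) :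
  iid_rows P s ->
  measurable_fun (setT : set (g_sigma_algebraType (@open 'cV[R]_n))) phi ->
  L1 P (phi \o s i) ->
  L1 P (phi \o s j) /\ mean P (phi \o s j) = mean P (phi \o s i).
Proof.
move=> iid mphi si; have [ms _ same] := iid.
have mk k : measurable_fun setT (phi \o s k).
  move=> _ B mB; rewrite setTI; apply: (ms k (phi @^-1` B)).
  by have := mphi measurableT B mB; rewrite setTI.
pose Y k : {mfun T >-> R} := mfun_Sub (mem_set (mk k)).
have eqd (A : set R) : measurable A -> distribution P (Y j) A = distribution P (Y i) A.
  by move=> mA; apply: (same j i (phi @^-1` A)); have := mphi measurableT A mA; rewrite setTI.
have eqi (g : R -> \bar R) :
    (\int[distribution P (Y j)]_x g x = \int[distribution P (Y i)]_x g x)%E.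
  by apply: eq_measure_integral => A mA _; exact: eqd.
have sj : L1 P (phi \o s j).
  apply/integrableP; split; first exact/measurable_EFinP.
  have E k : (\int[P]_x `|(EFin \o (phi \o s k)) x| =
      \int[distribution P (Y k)]_x `|x%:E|)%E.
    by rewrite ge0_integral_distribution //; exact: measurableT_comp.
  by rewrite E eqi -E; move/integrableP: si => [].
split=> //; apply: EFin_inj; rewrite -(meanE si) -(meanE sj).
transitivity (\int[distribution P (Y j)]_x x%:E)%E.
  by rewrite integral_distribution //; exact/measurable_EFinP.
by rewrite eqi integral_distribution //; exact/measurable_EFinP.
Qed.

Lemma measurable_row_entry (R : realType) (n : nat) (a : 'I_n) :
  measurable_fun (setT : set (g_sigma_algebraType (@open 'cV[R]_n)))
    (fun x : 'cV[R]_n => x a 0).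
Proof.
apply: (measurability _ (RGenOpens.measurableE R)) => //.
move=> _ [_ [a1 [b1 ->]] <-].
rewrite setTI; apply: sub_sigma_algebra.
apply: open_comp => /=; last exact: interval_open.
by move=> x _; exact: coord_continuous.
Qed.

Lemma measurable_row_comp (R : realType) (disp : measure_display)
    (T : measurableType disp) (n m : nat)
    (s : 'I_m -> T -> 'cV[R]_n) (J : set 'I_m) (i : 'I_m) (phi : 'cV[R]_n -> R) :
  J i ->
  measurable_fun (setT : set (g_sigma_algebraType (@open 'cV[R]_n))) phi ->
  measurable_fun (setT : set (g_sigma_algebraType (rows_sigma s J)))
    (phi \o s i).
Proof.
move=> Ji mphi _ B mB; rewrite setTI comp_preimage; apply: sub_sigma_algebra.
exists (i, phi @^-1` B) => //; split=> //=.
by have := mphi measurableT B mB; rewrite setTI.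
Qed.

Lemma measurable_rows_sigma (R : realType) (disp disp' : measure_display)
    (T : measurableType disp) (T' : measurableType disp') (P : probability T R)
    (n m : nat) (s : 'I_m -> T -> 'cV[R]_n) (J : set 'I_m) (f : T -> T') :
  iid_rows P s ->
  measurable_fun (setT : set (g_sigma_algebraType (rows_sigma s J))) f ->
  measurable_fun setT f.
Proof.
move=> iid mf _ B mB; rewrite setTI; apply: (rows_sigma_measurable (J := J) iid).
by have := mf measurableT B mB; rewrite setTI.
Qed.

(** * Lindeberg replacement *)

(** Lagrange's identity: twice the gap is the sum of the squared minors over all ordered pairs of
    indices. *)
Lemma cauchy_schwarz (R : realDomainType) (I : finType) (x y : I -> R) :
  (\sum_i x i * y i) ^+ 2 <= (\sum_i x i ^+ 2) * (\sum_i y i ^+ 2).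
Proof.
have h : 0 <= \sum_i \sum_j (x i * y j - x j * y i) ^+ 2.
  by apply: sumr_ge0 => i _; apply: sumr_ge0 => j _; exact: sqr_ge0.
rewrite -subr_ge0 -(pmulrn_lge0 _ (isT : (0 < 2)%N)); apply: (le_trans h).
rewrite le_eqVlt; apply/orP; left; apply/eqP.
have E (F G : I -> R) : (\sum_i F i) * (\sum_i G i) = \sum_i \sum_j F i * G j.
  by rewrite mulr_suml; apply: eq_bigr => i _; rewrite mulr_sumr.
have -> : \sum_i \sum_j (x i * y j - x j * y i) ^+ 2 =
    \sum_i \sum_j x i ^+ 2 * y j ^+ 2 + \sum_i \sum_j x j ^+ 2 * y i ^+ 2
    - (\sum_i \sum_j (x i * y i) * (x j * y j)) *+ 2.
  rewrite -sumrMnl -big_split -sumrB; apply: eq_bigr => i _.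
  rewrite -sumrMnl -big_split -sumrB; apply: eq_bigr => j _ /=; ring.
rewrite [X in _ + X - _]exchange_big expr2 !E /=; ring.
Qed.

Lemma frobenius_ge0 (R : realType) (p q : nat) (M : 'M[R]_(p, q)) :
  0 <= frobenius M.
Proof. exact: sqrtr_ge0. Qed.

Lemma frobenius_sq (R : realType) (p q : nat) (M : 'M[R]_(p, q)) :
  frobenius M ^+ 2 = \sum_i \sum_j M i j ^+ 2.
Proof.
rewrite sqr_sqrtr //; apply: sumr_ge0 => i _; apply: sumr_ge0 => j _.
exact: sqr_ge0.
Qed.

Lemma frobenius_sq_pair (R : realType) (p q : nat) (M : 'M[R]_(p, q)) :
  frobenius M ^+ 2 = \sum_(ij : 'I_p * 'I_q) M ij.1 ij.2 ^+ 2.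
Proof. by rewrite frobenius_sq pair_big. Qed.

Lemma frobenius_col (R : realType) (d : nat) (x : 'cV[R]_d) :
  frobenius x ^+ 2 = \sum_i x i 0 ^+ 2.
Proof. by rewrite frobenius_sq; apply: eq_bigr => i _; rewrite big_ord1. Qed.

Lemma frobeniusZ (R : realType) (p q : nat) (c : R) (M : 'M[R]_(p, q)) :
  frobenius (c *: M) = `|c| * frobenius M.
Proof.
apply/eqP; rewrite -(eqrXn2 (isT : (0 < 2)%N)) ?mulr_ge0 ?frobenius_ge0 //.
rewrite exprMn !frobenius_sq real_normK ?num_real // mulr_sumr; apply/eqP.
apply: eq_bigr => i _; rewrite mulr_sumr; apply: eq_bigr => j _.
by rewrite mxE exprMn.
Qed.

Lemma frobeniusN (R : realType) (p q : nat) (M : 'M[R]_(p, q)) :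
  frobenius (- M) = frobenius M.
Proof. by rewrite -scaleN1r frobeniusZ normrN1 mul1r. Qed.

Lemma frobenius0 (R : realType) (p q : nat) :
  frobenius (0 : 'M[R]_(p, q)) = 0.
Proof. by rewrite -(scale0r 0) frobeniusZ normr0 mul0r. Qed.

Lemma frobeniusD (R : realType) (p q : nat) (M N : 'M[R]_(p, q)) :
  frobenius (M + N) <= frobenius M + frobenius N.
Proof.
have a0 := frobenius_ge0 M; have b0 := frobenius_ge0 N.
rewrite -(ler_pXn2r (isT : (0 < 2)%N)) ?nnegrE ?addr_ge0 ?frobenius_ge0 //.
rewrite sqrrD !frobenius_sq_pair.
pose x ij := M ij.1 ij.2 : R; pose y ij := N ij.1 ij.2 : R.
have cs : \sum_(ij : 'I_p * 'I_q) x ij * y ij <= frobenius M * frobenius N.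
  have h := cauchy_schwarz x y.
  have : `|\sum_ij x ij * y ij| <= frobenius M * frobenius N.
    rewrite -(ler_pXn2r (isT : (0 < 2)%N)) ?nnegrE ?mulr_ge0 //.
    by rewrite exprMn !frobenius_sq_pair real_normK ?num_real.
  by apply: le_trans; exact: ler_norm.
have -> : \sum_(ij : 'I_p * 'I_q) (M + N) ij.1 ij.2 ^+ 2 =
    \sum_ij x ij ^+ 2 + (\sum_ij x ij * y ij) *+ 2 + \sum_ij y ij ^+ 2.
  rewrite -sumrMnl -!big_split /=; apply: eq_bigr => ij _.
  by rewrite mxE sqrrD.
by rewrite !lerD // lerMn2r.
Qed.

Lemma frobeniusB (R : realType) (p q : nat) (M N : 'M[R]_(p, q)) :
  frobenius (M - N) <= frobenius M + frobenius N.
Proof. by rewrite -[in leRHS](frobeniusN N) frobeniusD. Qed.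

Lemma frobeniusM (R : realType) (p q r : nat) (M : 'M[R]_(p, q))
    (N : 'M[R]_(q, r)) :
  frobenius (M *m N) <= frobenius M * frobenius N.
Proof.
rewrite -(ler_pXn2r (isT : (0 < 2)%N)) ?nnegrE ?mulr_ge0 ?frobenius_ge0 //.
rewrite exprMn !frobenius_sq mulr_suml; apply: ler_sum => i _.
rewrite [X in _ * X]exchange_big mulr_sumr; apply: ler_sum => j _.
by rewrite mxE; apply: cauchy_schwarz.
Qed.

Lemma le_frobenius (R : realType) (p q : nat) (M : 'M[R]_(p, q)) i j :
  `|M i j| <= frobenius M.
Proof.
rewrite -(ler_pXn2r (isT : (0 < 2)%N)) ?nnegrE ?frobenius_ge0 //.
rewrite real_normK ?num_real // frobenius_sq_pair (bigD1 (i, j)) //= lerDl.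
by apply: sumr_ge0 => k _; exact: sqr_ge0.
Qed.

Lemma frobenius_tr (R : realType) (p q : nat) (M : 'M[R]_(p, q)) :
  frobenius M^T = frobenius M.
Proof.
rewrite /frobenius exchange_big; congr Num.sqrt; apply: eq_bigr => i _.
by apply: eq_bigr => j _; rewrite mxE.
Qed.

(** * Test functions with a third-order expansion *)

Definition pospart (R : realDomainType) (u : R) : R := Num.max u 0.

(** The function max(u, 0)^3 has second derivative 6 max(u, 0), which is 6-Lipschitz; Taylor's
    remainder is thus at most |b|^3. The proof checks the four sign patterns directly. *)
Lemma pospart_cube (R : realFieldType) (u b : R) :
  `|pospart (u + b) ^+ 3 - (pospart u ^+ 3 + 3 * pospart u ^+ 2 * b
     + 3 * pospart u * b ^+ 2)| <= `|b| ^+ 3.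
Proof.
rewrite /pospart; case: (leP u 0) => u0; case: (leP (u + b) 0) => ub0.
- by rewrite !expr0n /= !(mulr0, mul0r, addr0, subrr, normr0) exprn_ge0.
- rewrite !expr0n /= !(mulr0, mul0r, addr0, subr0).
  have b0 : 0 < b by lra.
  by rewrite normrX ler_pXn2r ?nnegrE ?normr_ge0 // !gtr0_norm //; lra.
- have b0 : b < 0 by lra.
  have -> : 0 ^+ 3 - (u ^+ 3 + 3 * u ^+ 2 * b + 3 * u * b ^+ 2) =
      (- (u + b)) ^+ 3 - (- b) ^+ 3 by ring.
  have w0 : 0 <= (- (u + b)) ^+ 3 by rewrite exprn_ge0 //; lra.
  have wb : (- (u + b)) ^+ 3 <= (- b) ^+ 3 by rewrite ler_pXn2r ?nnegrE //; lra.
  by rewrite (ltr0_norm b0) ler_norml; apply/andP; split; lra.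
- have -> : (u + b) ^+ 3 - (u ^+ 3 + 3 * u ^+ 2 * b + 3 * u * b ^+ 2) = b ^+ 3.
    by ring.
  by rewrite normrX.
Qed.

Definition dot (R : realType) (d : nat) (x y : 'cV[R]_d) : R :=
  \sum_a x a 0 * y a 0.

Lemma dot_le (R : realType) (d : nat) (x y : 'cV[R]_d) :
  `|dot x y| <= frobenius x * frobenius y.
Proof.
rewrite -(ler_pXn2r (isT : (0 < 2)%N)) ?nnegrE ?mulr_ge0 ?frobenius_ge0 //.
by rewrite exprMn !frobenius_col real_normK ?num_real // cauchy_schwarz.
Qed.

Lemma frobenius_colD (R : realType) (d : nat) (x h : 'cV[R]_d) :
  frobenius (x + h) ^+ 2 = frobenius x ^+ 2 + (2 * dot x h + frobenius h ^+ 2).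
Proof.
rewrite !frobenius_col /dot mulr_sumr -!big_split; apply: eq_bigr => a _ /=.
by rewrite mxE; ring.
Qed.

(* Measurability of [F] along every measurable family of vectors, which avoids
   fixing a sigma-algebra on ['cV_d]. *)
Definition coord_measurable (R : realType) (d : nat) (F : 'cV[R]_d -> R) : Prop :=
  forall (disp : measure_display) (T : measurableType disp) (U : T -> 'cV[R]_d),
    (forall a, measurable_fun setT (fun t => U t a 0)) ->
    measurable_fun setT (F \o U).

(** [l] plays the gradient and [q] half the Hessian. Only bounds and a cubic remainder are asked
    for, conditions that survive averaging over translations. *)
Definition third_order (R : realType) (d : nat) (C : R) (g : 'cV[R]_d -> R)
    (l : 'I_d -> 'cV[R]_d -> R) (q : 'I_d -> 'I_d -> 'cV[R]_d -> R) : Prop :=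
  [/\ forall x, `|g x| <= C, forall a x, `|l a x| <= C,
      forall a b x, `|q a b x| <= C &
      forall x h, `|g (x + h) - (g x + \sum_a l a x * h a 0
         + \sum_a \sum_b q a b x * (h a 0 * h b 0))| <= C * frobenius h ^+ 3].

Definition smooth (R : realType) (d : nat) (C : R) (g : 'cV[R]_d -> R) : Prop :=
  exists l q, third_order C g l q /\
    [/\ coord_measurable g, forall a, coord_measurable (l a) &
        forall a b, coord_measurable (q a b)].

(** The cubic power is the least integer power of the positive part with a Lipschitz second
    derivative, as a cubic remainder requires. Its third differences in [a] also give soft
    indicators of balls. *)
Definition radial_bump (R : realType) (d : nat) (a : R) (x : 'cV[R]_d) : R :=
  pospart (a - frobenius x ^+ 2) ^+ 3.

Lemma measurable_frobenius_sq (R : realType) (d : nat) :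
  coord_measurable (fun x : 'cV[R]_d => frobenius x ^+ 2).
Proof.
move=> disp T U mU.
rewrite (_ : _ \o _ = fun t => \sum_a U t a 0 ^+ 2); last first.
  by apply/funext => t /=; rewrite frobenius_col.
by apply: measurable_sum => a; exact: measurable_funX.
Qed.

Lemma measurable_pospart (R : realType) (d : nat) (a : R) :
  coord_measurable (fun x : 'cV[R]_d => pospart (a - frobenius x ^+ 2)).
Proof.
move=> disp T U mU; apply: measurable_maxr => //.
by apply: measurable_funB => //; exact: measurable_frobenius_sq.
Qed.

Lemma pospart_ge0 (R : realDomainType) (u : R) : 0 <= pospart u.
Proof. by rewrite /pospart le_max lexx orbT. Qed.

Lemma pospart_le (R : realDomainType) (u c : R) : 0 <= c -> u <= c -> pospart u <= c.
Proof. by move=> c0 uc; rewrite /pospart ge_max uc c0. Qed.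

Lemma le_pow (R : realDomainType) (n : nat) (x y : R) :
  0 <= x -> x <= y -> x ^+ n <= y ^+ n.
Proof. by move=> x0 xy; rewrite lerXn2r // nnegrE // (le_trans x0). Qed.

(** The chain rule applied to u = a - |x|^2 gives the displayed coefficients. The remainder is
    largest for small steps near the ball, where the proof collects 125 + 24 + 3; the constant 200
    leaves room. *)
Lemma radial_bump_third_order (R : realType) (d : nat) (M a : R) :
  1 <= M -> a <= M ->
  let p (x : 'cV[R]_d) := pospart (a - frobenius x ^+ 2) in
  third_order (200 * M ^+ 3) (@radial_bump R d a)
    (fun i x => - 6 * p x ^+ 2 * x i 0)
    (fun i j x => - 3 * p x ^+ 2 * (i == j)%:R + 12 * p x * (x i 0 * x j 0)).
Proof.
move=> M1 aM p.
have p0 x : 0 <= p x by exact: pospart_ge0.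
have pM x : p x <= M.
  by apply: pospart_le; [lra|have := sqr_ge0 (frobenius x); lra].
(* Outside the ball of radius [M] every coefficient vanishes, because |x|^2 < a <= M <= M^2 wherever
   [p] is positive. *)
have px x : (p x == 0) || (frobenius x <= M).
  rewrite /p /pospart; case: (leP (a - frobenius x ^+ 2) 0) => [_|h]; first by rewrite eqxx.
  apply/orP; right.
  have f0 := frobenius_ge0 x; rewrite leNgt; apply/negP => Mx; nra.
have M2 : M <= M ^+ 2 by rewrite expr2; nra.
have M3 : M ^+ 2 <= M ^+ 3 by rewrite [leRHS]exprS; nra.
have p2 x : 0 <= p x ^+ 2 <= M ^+ 2.
  by rewrite sqr_ge0 le_pow.
have p3 x : 0 <= p x ^+ 3 <= M ^+ 3.
  by rewrite exprn_ge0 // le_pow.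
split=> [x|i x|i j x|x h].
- by rewrite /radial_bump -/(p x) ger0_norm; have := p3 x; lra.
- have -> : `|- 6 * p x ^+ 2 * x i 0| = 6 * (p x ^+ 2 * `|x i 0|).
    rewrite -mulrA normrM normrN (ger0_norm (ler0n _ 6)) normrM.
    by rewrite (ger0_norm (sqr_ge0 _)).
  have /andP[h0 h1] := p2 x.
  case/orP: (px x) => [/eqP ->|xM].
    by rewrite expr0n mul0r mulr0; lra.
  have xi : `|x i 0| <= M by apply: le_trans (le_frobenius x i 0) xM.
  have : p x ^+ 2 * `|x i 0| <= M ^+ 3.
    by rewrite [leRHS]exprSr ler_pM.
  lra.
- case/orP: (px x) => [/eqP ->|xM].
    by rewrite expr0n !(mulr0, mul0r) addr0 normr0; lra.
  have xi k : `|x k 0| <= M by apply: le_trans (le_frobenius x k 0) xM.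
  have /andP[h0 h1] := p2 x.
  have xij : `|p x * (x i 0 * x j 0)| <= M ^+ 3.
    rewrite !normrM (ger0_norm (p0 x)) exprS ler_pM // ?mulr_ge0 //.
    by rewrite expr2 ler_pM.
  have ij : 0 <= p x ^+ 2 * (i == j)%:R <= M ^+ 2.
    by case: (i == j); rewrite ?mulr1 ?mulr0 ?h0 ?h1 //; lra.
  rewrite ler_norml in xij; move/andP: xij => [xij1 xij2]; move/andP: ij => [ij1 ij2].
  have -> : - 3 * p x ^+ 2 * (i == j)%:R + 12 * p x * (x i 0 * x j 0) =
     12 * (p x * (x i 0 * x j 0)) - 3 * (p x ^+ 2 * (i == j)%:R) by ring.
  by rewrite ler_norml; apply/andP; split; lra.
pose X := frobenius x; pose H := frobenius h; pose c := dot x h.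
pose b := - (2 * c + H ^+ 2); pose G := radial_bump a (x + h).
have X0 : 0 <= X by exact: frobenius_ge0.
have H0 : 0 <= H by exact: frobenius_ge0.
have GE : G = pospart (a - X ^+ 2 + b) ^+ 3.
  by rewrite /G /radial_bump frobenius_colD /b /X /H /c; congr (pospart _ ^+ 3); ring.
have -> : \sum_i - 6 * p x ^+ 2 * x i 0 * h i 0 = - 6 * p x ^+ 2 * c.
  by rewrite mulr_sumr; apply: eq_bigr => i _; ring.
have -> : \sum_i \sum_j (- 3 * p x ^+ 2 * (i == j)%:R +
     12 * p x * (x i 0 * x j 0)) * (h i 0 * h j 0) =
     - 3 * p x ^+ 2 * H ^+ 2 + 12 * p x * c ^+ 2.
  have cE : c ^+ 2 = \sum_i \sum_j (x i 0 * h i 0) * (x j 0 * h j 0).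
    by rewrite expr2 /c /dot mulr_suml; apply: eq_bigr => i _; rewrite mulr_sumr.
  rewrite /H frobenius_col cE !mulr_sumr -big_split.
  apply: eq_bigr => i _ /=; rewrite mulr_sumr.
  have -> : - 3 * p x ^+ 2 * h i 0 ^+ 2 =
      \sum_j - 3 * p x ^+ 2 * (i == j)%:R * (h i 0 * h j 0).
    rewrite (bigD1 i) //= eqxx mulr1 big1 ?addr0 ?expr2 //.
    by move=> j /negbTE ji; rewrite eq_sym ji mulr0 mul0r.
  by rewrite -big_split; apply: eq_bigr => j _ /=; ring.
rewrite -/G -/H; have cXH : `|c| <= X * H by exact: dot_le.
have [c1 c2] : - (X * H) <= c /\ c <= X * H.
  by move: cXH; rewrite ler_norml => /andP.
have bump_x : radial_bump a x = p x ^+ 3 by [].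
rewrite bump_x.
have px0 := p0 x; have pxM := pM x.
have /andP[p20 p2M] := p2 x; have /andP[p30 p3M] := p3 x.
have G0 : 0 <= G <= M ^+ 3.
  by rewrite /G /radial_bump exprn_ge0 ?pospart_ge0 // le_pow ?pospart_ge0 //; exact: pM.
have M30 : 0 <= M ^+ 3 by rewrite exprn_ge0 //; lra.
(* For a step longer than 1 there is no cancellation to exploit: each term is separately at most a
   multiple of [M ^+ 3 * H ^+ 3]. *)
have [H1|H1] := leP H 1; last first.
  have H2 : 1 <= H ^+ 2 by rewrite expr2; nra.
  have H3 : H ^+ 2 <= H ^+ 3 by rewrite [leRHS]exprS; nra.
  have MH : M ^+ 3 <= M ^+ 3 * H ^+ 3 by rewrite ler_peMr //; lra.
  move/andP: G0 => [G0 G1]; case/orP: (px x) => [/eqP ->|xM].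
    rewrite !expr0n /= !(mulr0, mul0r, addr0, subr0) ger0_norm //; lra.
  have XM : X <= M by [].
  have k1 : `|p x ^+ 2 * c| <= M ^+ 3 * H ^+ 3.
    have -> : M ^+ 3 * H ^+ 3 = M ^+ 2 * (M * H ^+ 3) by ring.
    rewrite normrM (ger0_norm p20) ler_pM // (le_trans cXH) // ler_pM //.
    by apply: le_trans H3; rewrite expr2; nra.
  have k2 : p x ^+ 2 * H ^+ 2 <= M ^+ 3 * H ^+ 3.
    by rewrite ler_pM ?sqr_ge0 //; lra.
  have k3 : p x * c ^+ 2 <= M ^+ 3 * H ^+ 3.
    have -> : M ^+ 3 * H ^+ 3 = M * (M ^+ 2 * H ^+ 3) by ring.
    rewrite -(real_normK (num_real c)) ler_pM ?sqr_ge0 //.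
    apply: (@le_trans _ _ ((X * H) ^+ 2)); first by rewrite le_pow.
    by rewrite exprMn ler_pM ?sqr_ge0 // le_pow.
  have k4 : 0 <= p x * c ^+ 2 by rewrite mulr_ge0 ?sqr_ge0.
  have k5 : 0 <= p x ^+ 2 * H ^+ 2 by rewrite mulr_ge0 ?sqr_ge0.
  move: k1; rewrite ler_norml => /andP[k1 k1'].
  by rewrite ler_norml; apply/andP; split; lra.
have H3 : H ^+ 3 <= H ^+ 2 by rewrite exprS -[leRHS]mul1r ler_wpM2r ?sqr_ge0.
have H30 : 0 <= H ^+ 3 by rewrite exprn_ge0.
(* If |x| > M + 1 and the step has length at most 1, then both [x] and [x + h] lie outside the
   support. *)
have [XM|XM] := leP X (M + 1).
  have bM : `|b| <= 5 * M * H.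
    rewrite normrN ler_norml; apply/andP; split; rewrite expr2; nra.
  have b3 : `|b| ^+ 3 <= 125 * M ^+ 3 * H ^+ 3.
    apply: (le_trans (le_pow 3 (normr_ge0 b) bM)).
    by rewrite le_eqVlt; apply/orP; left; apply/eqP; ring.
  have k1 : `|p x * (c * H ^+ 2)| <= 2 * M ^+ 3 * H ^+ 3.
    rewrite normrM (normrM c) (ger0_norm px0) (ger0_norm (sqr_ge0 _)).
    have cM : `|c| <= 2 * M * H by apply: (le_trans cXH); nra.
    apply: (@le_trans _ _ (M * (2 * M * H * H ^+ 2))).
      by rewrite ler_pM ?mulr_ge0 ?sqr_ge0 // ler_wpM2r ?sqr_ge0.
    have -> : M * (2 * M * H * H ^+ 2) = 2 * M ^+ 2 * H ^+ 3 by ring.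
    by rewrite ler_wpM2r // ler_wpM2l.
  have k2 : 0 <= p x * H ^+ 4 <= M ^+ 3 * H ^+ 3.
    rewrite mulr_ge0 ?exprn_ge0 //= ler_pM ?exprn_ge0 //; first lra.
    by rewrite exprS -[leRHS]mul1r ler_wpM2r.
  (* The increment [b] of a - |x|^2 is itself quadratic in [h]. The one-variable remainder is
     isolated, and the terms of order three and four in [h] inside [b ^+ 2] are bounded apart. *)
  have -> : G - (p x ^+ 3 + -6 * p x ^+ 2 * c +
      (-3 * p x ^+ 2 * H ^+ 2 + 12 * p x * c ^+ 2)) =
    (G - (p x ^+ 3 + 3 * p x ^+ 2 * b + 3 * p x * b ^+ 2)) +
    (12 * (p x * (c * H ^+ 2)) + 3 * (p x * H ^+ 4)) by rewrite /b; ring.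
  have := pospart_cube (a - X ^+ 2) b; rewrite -GE -/(p x).
  move: k1 k2; rewrite !ler_norml => /andP[k1 k1'] /andP[k2 k2'] /andP[k3 k3'].
  by apply/andP; split; lra.
have -> : p x = 0.
  case/orP: (px x) => [/eqP//|xM]; move: xM XM; rewrite /X; lra.
have -> : G = 0.
  rewrite /G /radial_bump /pospart.
  have xhM : M < frobenius (x + h).
    have := frobeniusB (x + h) h; rewrite addrK -/X -/H; lra.
  have : M ^+ 2 <= frobenius (x + h) ^+ 2 by rewrite le_pow //; lra.
  by case: (leP (a - frobenius (x + h) ^+ 2) 0); rewrite ?expr0n //; lra.
rewrite !expr0n /= !(mulr0, mul0r, addr0, subr0) normr0 mulr_ge0 //; lra.
Qed.

Lemma smooth_radial_bump (R : realType) (d : nat) (M a : R) :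
  1 <= M -> a <= M -> smooth (200 * M ^+ 3) (@radial_bump R d a).
Proof.
move=> M1 aM; have := radial_bump_third_order d M1 aM => /= h.
eexists; eexists; split; first exact: h.
split=> [|i|i j] disp T U mU.
- by apply: measurable_funX; exact: measurable_pospart.
- apply: measurable_funM; last exact: mU.
  apply: measurable_funM => //; apply: measurable_funX.
  exact: measurable_pospart.
- apply: measurable_funD.
    apply: measurable_funM => //; apply: measurable_funM => //.
    by apply: measurable_funX; exact: measurable_pospart.
  apply: measurable_funM; last by apply: measurable_funM; exact: mU.
  by apply: measurable_funM => //; exact: measurable_pospart.
Qed.

Lemma avg_le (R : numFieldType) (K : finType) (F : K -> R) (c : R) :
  (0 < #|K|)%N -> (forall k, F k <= c) -> #|K|%:R^-1 * \sum_k F k <= c.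
Proof.
move=> K0 Fc; rewrite mulrC ler_pdivrMr ?ltr0n // mulr_natr -sumr_const.
exact: ler_sum.
Qed.

Lemma avg_norm_le (R : realFieldType) (K : finType) (F : K -> R) (c : R) :
  (0 < #|K|)%N -> (forall k, `|F k| <= c) -> `|#|K|%:R^-1 * \sum_k F k| <= c.
Proof.
move=> K0 Fc; rewrite normrM ger0_norm ?invr_ge0 //.
apply: le_trans (avg_le K0 Fc); rewrite ler_wpM2l ?invr_ge0 //.
exact: ler_norm_sum.
Qed.

Lemma measurable_avg_shift (R : realType) (d : nat) (K : finType)
    (y : K -> 'cV[R]_d) (g : 'cV[R]_d -> R) :
  coord_measurable g -> coord_measurable (avg_shift y g).
Proof.
move=> mg disp T U mU; apply: measurable_funM => //.
apply: measurable_sum => k; apply: (mg _ _ (fun t => U t + y k)) => a.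
rewrite (_ : (fun t => _) = fun t => U t a 0 + y k a 0).
  exact: measurable_funD.
by apply/funext => t; rewrite mxE.
Qed.

(** The constant [C] does not grow, so each partially replaced functional of the hybrid argument
    obeys the same estimate as the original one. *)
Lemma smooth_avg_shift (R : realType) (d : nat) (K : finType) (C : R)
    (y : K -> 'cV[R]_d) (g : 'cV[R]_d -> R) :
  (0 < #|K|)%N -> smooth C g -> smooth C (avg_shift y g).
Proof.
move=> K0 [l [q [[gC lC qC tay] [mg ml mq]]]].
exists (fun a => avg_shift y (l a)), (fun a b => avg_shift y (q a b)).
split; last by split=> *; exact: measurable_avg_shift.
split=> [x|a x|a b x|x h]; try exact: avg_norm_le.
have -> : avg_shift y g (x + h) - (avg_shift y g x +
      \sum_a avg_shift y (l a) x * h a 0 +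
      \sum_a \sum_b avg_shift y (q a b) x * (h a 0 * h b 0)) =
    #|K|%:R^-1 * \sum_k (g (x + y k + h) - (g (x + y k) +
      \sum_a l a (x + y k) * h a 0 +
      \sum_a \sum_b q a b (x + y k) * (h a 0 * h b 0))).
  rewrite sumrB !big_split mulrBr !mulrDr /=.
  congr (_ - (_ + _ + _)).
  - by congr (_ * _); apply: eq_bigr => k _; rewrite addrAC.
  - rewrite exchange_big mulr_sumr; apply: eq_bigr => a _.
    by rewrite -mulrA mulr_suml.
  - rewrite [in RHS]exchange_big mulr_sumr; apply: eq_bigr => a _.
    rewrite [in RHS]exchange_big mulr_sumr; apply: eq_bigr => b _ /=.
    by rewrite -mulrA mulr_suml.
by apply: avg_norm_le => // k; exact: tay.
Qed.

Lemma smooth_iter_avg_shift (R : realType) (d : nat) (K : finType) (C : R)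
    (y : K -> 'cV[R]_d) (g : 'cV[R]_d -> R) (N : nat) :
  (0 < #|K|)%N -> smooth C g -> smooth C (iter N (avg_shift y) g).
Proof. by move=> K0 sg; elim: N => //= N; exact: smooth_avg_shift. Qed.

Definition row_moments (R : realType) (disp : measure_display)
    (T : measurableType disp) (P : probability T R) (n d : nat)
    (r : T -> 'cV[R]_n) (psi : 'cV[R]_n -> 'cV[R]_d) : Prop :=
  [/\ forall a, measurable_fun (setT : set (g_sigma_algebraType (@open 'cV[R]_n)))
        (fun x => psi x a 0),
      forall a, L1 P (fun t => psi (r t) a 0),
      forall a b, L1 P (fun t => psi (r t) a 0 * psi (r t) b 0) &
      L1 P (fun t => frobenius (psi (r t)) ^+ 3)].

(** [U] depends on the rows other than [i], so the expectation of each Taylor term splits into a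
    coefficient at [U] times a moment of row [i]. *)
Lemma mean_taylor (R : realType) (disp : measure_display)
    (T : measurableType disp) (P : probability T R) (n m d : nat)
    (s : 'I_m -> T -> 'cV[R]_n) (i : 'I_m) (C : R) (g : 'cV[R]_d -> R) l q
    (U : T -> 'cV[R]_d) (psi : 'cV[R]_n -> 'cV[R]_d) :
  iid_rows P s -> third_order C g l q ->
  coord_measurable g -> (forall a, coord_measurable (l a)) ->
  (forall a b, coord_measurable (q a b)) ->
  (forall a, measurable_fun
     (setT : set (g_sigma_algebraType (rows_sigma s [set~ i])))
     (fun t => U t a 0)) ->
  row_moments P (s i) psi ->
  L1 P (fun t => g (U t + psi (s i t))) /\
  `|mean P (fun t => g (U t + psi (s i t))) -
     (mean P (g \o U) +
      \sum_a mean P (l a \o U) * mean P (fun t => psi (s i t) a 0) +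
      \sum_a \sum_b mean P (q a b \o U) *
         mean P (fun t => psi (s i t) a 0 * psi (s i t) b 0))|
   <= C * mean P (fun t => frobenius (psi (s i t)) ^+ 3).
Proof.
move=> iid [gC lC qC tay] mg ml mq mU [mpsi L1p L2p L3p].
have up (f : T -> R) := @measurable_rows_sigma R _ _ T R P n m s [set~ i] f iid.
have mUt a : measurable_fun setT (fun t => U t a 0) by exact: up.
have mpt a : measurable_fun setT (fun t => psi (s i t) a 0).
  exact: L1_measurable (L1p a).
have Lg : L1 P (g \o U) by apply: L1_bounded (fun t => gC (U t)); exact: mg.
have Ll a : L1 P (l a \o U) by apply: L1_bounded (fun t => lC a (U t)); exact: ml.
have Lq a b : L1 P (q a b \o U).
  by apply: L1_bounded (fun t => qC a b (U t)); exact: mq.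
have LG : L1 P (fun t => g (U t + psi (s i t))).
  apply: L1_bounded (fun t => gC (U t + psi (s i t))).
  apply: (mg _ _ (fun t => U t + psi (s i t))) => a.
  rewrite (_ : (fun t => _) = fun t => U t a 0 + psi (s i t) a 0).
    exact: measurable_funD.
  by apply/funext => t; rewrite mxE.
have I1 a := row_indep_mean iid (ml a _ (g_sigma_algebraType (rows_sigma s [set~ i])) U mU)
  (mpsi a) (Ll a) (L1p a).
have I2 a b := row_indep_mean iid (mq a b _ (g_sigma_algebraType (rows_sigma s [set~ i])) U mU)
  (measurable_funM (mpsi a) (mpsi b)) (Lq a b) (L2p a b).
split=> //.
have L1s : L1 P (fun t => \sum_a l a (U t) * psi (s i t) a 0).
  by apply: L1_sum => a _; have [] := I1 a.
have L2s : L1 P (fun t => \sum_a \sum_b q a b (U t) *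
    (psi (s i t) a 0 * psi (s i t) b 0)).
  by apply: L1_sum => a _; apply: L1_sum => b _; have [] := I2 a b.
have E : mean P (g \o U) +
      \sum_a mean P (l a \o U) * mean P (fun t => psi (s i t) a 0) +
      \sum_a \sum_b mean P (q a b \o U) *
         mean P (fun t => psi (s i t) a 0 * psi (s i t) b 0) =
   mean P (fun t => g (U t) + \sum_a l a (U t) * psi (s i t) a 0 +
      \sum_a \sum_b q a b (U t) * (psi (s i t) a 0 * psi (s i t) b 0)).
  rewrite meanD //; last exact: L1D.
  rewrite meanD // !mean_sum //; last first.
  - by move=> a _; have [] := I1 a.
  - by move=> a _; apply: L1_sum => b _; have [] := I2 a b.
  congr (_ + _ + _).
    by apply: eq_bigr => a _; have [_ ->] := I1 a.
  apply: eq_bigr => a _; rewrite mean_sum; last by move=> b _; have [] := I2 a b.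
  by apply: eq_bigr => b _; have [_ ->] := I2 a b.
have Ls := L1D (L1D Lg L1s) L2s.
rewrite E -meanB // -meanZ //.
apply: (le_trans (mean_norm (L1B LG Ls))).
by apply: mean_le => [||t]; [exact/L1_norm/L1B|exact: L1Z|exact: tay].
Qed.

Lemma measurable_frobenius (R : realType) (d : nat) :
  coord_measurable (@frobenius R d 1).
Proof.
move=> disp T U mU.
have msq : measurable_fun [set: R] (@Num.sqrt R).
  by apply: continuous_measurable_fun; exact: sqrt_continuous.
rewrite (_ : _ \o U = Num.sqrt \o (fun t => frobenius (U t) ^+ 2)).
  by apply: measurableT_comp => //; exact: measurable_frobenius_sq.
by apply/funext => t /=; rewrite sqrtr_sqr ger0_norm // frobenius_ge0.
Qed.

Lemma measurable_row (R : realType) (disp : measure_display)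
    (T : measurableType disp) (P : probability T R) (n m : nat)
    (s : 'I_m -> T -> 'cV[R]_n) (i : 'I_m) (phi : 'cV[R]_n -> R) :
  iid_rows P s ->
  measurable_fun (setT : set (g_sigma_algebraType (@open 'cV[R]_n))) phi ->
  measurable_fun setT (fun t => phi (s i t)).
Proof.
move=> [ms _ _] mphi _ B mB; rewrite setTI; apply: (ms i (phi @^-1` B)).
by have := mphi measurableT B mB; rewrite setTI.
Qed.

Lemma row_momentsP (R : realType) (disp : measure_display)
    (T : measurableType disp) (P : probability T R) (n m d : nat)
    (s : 'I_m -> T -> 'cV[R]_n) (i : 'I_m) (psi : 'cV[R]_n -> 'cV[R]_d) :
  iid_rows P s ->
  (forall a, measurable_fun
     (setT : set (g_sigma_algebraType (@open 'cV[R]_n))) (fun x => psi x a 0)) ->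
  L1 P (fun t => frobenius (psi (s i t)) ^+ 3) ->
  row_moments P (s i) psi.
Proof.
move=> iid mpsi L3.
have mp a : measurable_fun setT (fun t => psi (s i t) a 0).
  exact: (measurable_row i iid (mpsi a)).
have L3' : L1 P (fun t => 1 + frobenius (psi (s i t)) ^+ 3).
  by apply: L1D => //; exact: L1_cst.
have bnd (x : R) : 0 <= x -> x <= 1 + x ^+ 3 /\ x ^+ 2 <= 1 + x ^+ 3.
  move=> x0; have [x1|x1] := leP x 1.
    have x2 : x ^+ 2 <= 1 by rewrite -(expr1n _ 2) le_pow.
    have x3 : 0 <= x ^+ 3 by rewrite exprn_ge0.
    by split; lra.
  have x2 : x <= x ^+ 2 by rewrite expr2; nra.
  have x3 : x ^+ 2 <= x ^+ 3 by rewrite exprS [leRHS]exprS; nra.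
  by split; lra.
split=> // [a|a b].
  apply: L1_le (mp a) L3' _ => t.
  have [h _] := bnd _ (frobenius_ge0 (psi (s i t))).
  exact: le_trans (le_frobenius _ _ _) h.
apply: L1_le (measurable_funM (mp a) (mp b)) L3' _ => t.
have [_ h] := bnd _ (frobenius_ge0 (psi (s i t))).
by apply: le_trans h; rewrite normrM expr2 ler_pM ?le_frobenius.
Qed.

Lemma cubeD_le (R : realFieldType) (x y : R) : 0 <= x -> 0 <= y ->
  (x + y) ^+ 3 <= 4 * (x ^+ 3 + y ^+ 3).
Proof.
move=> x0 y0; rewrite -subr_ge0.
have -> : 4 * (x ^+ 3 + y ^+ 3) - (x + y) ^+ 3 = 3 * ((x + y) * (x - y) ^+ 2).
  by ring.
by rewrite mulr_ge0 // mulr_ge0 ?sqr_ge0 // addr_ge0.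
Qed.

Lemma row_moments_shift (R : realType) (disp : measure_display)
    (T : measurableType disp) (P : probability T R) (n m d : nat)
    (s : 'I_m -> T -> 'cV[R]_n) (i : 'I_m) (psi : 'cV[R]_n -> 'cV[R]_d)
    (y : 'cV[R]_d) :
  iid_rows P s -> row_moments P (s i) psi ->
  row_moments P (s i) (fun x => psi x + y).
Proof.
move=> iid [mpsi L1p L2p L3p].
have mp a : measurable_fun setT (fun t => psi (s i t) a 0).
  exact: L1_measurable (L1p a).
apply: row_momentsP => // [a|].
  rewrite (_ : (fun x => _) = fun x => psi x a 0 + y a 0).
    exact: measurable_funD.
  by apply/funext => x; rewrite mxE.
apply: (@L1_le _ _ _ _ _
  (fun t => 4 * (frobenius (psi (s i t)) ^+ 3 + frobenius y ^+ 3))).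
- apply: measurable_funX; apply: (measurable_frobenius (U := fun t => _ + y)) => a.
  rewrite (_ : (fun x => _) = fun t => psi (s i t) a 0 + y a 0).
    exact: measurable_funD.
  by apply/funext => t; rewrite mxE.
- by apply: L1Z; apply: L1D => //; exact: L1_cst.
move=> t; rewrite ger0_norm ?exprn_ge0 ?frobenius_ge0 //.
apply: le_trans (cubeD_le (frobenius_ge0 _) (frobenius_ge0 _)).
by rewrite le_pow ?frobenius_ge0 // frobeniusD.
Qed.

(** One step of the replacement: the summand [X] gives way to [Z] plus a uniform draw from [y], the
    draw being realized by [avg_shift]. The first moments vanish on both sides, [D] measures the
    mismatch of the second moments, and the third moments bound the remainders. *)
Lemma swap_one (R : realType) (disp : measure_display)
    (T : measurableType disp) (P : probability T R) (n m d : nat)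
    (s : 'I_m -> T -> 'cV[R]_n) (i : 'I_m) (K : finType) (C D rho : R)
    (rho' : K -> R) (g : 'cV[R]_d -> R) (U : T -> 'cV[R]_d)
    (X Z : 'cV[R]_n -> 'cV[R]_d) (y : K -> 'cV[R]_d) :
  iid_rows P s -> (0 < #|K|)%N -> smooth C g ->
  (forall a, measurable_fun
     (setT : set (g_sigma_algebraType (rows_sigma s [set~ i])))
     (fun t => U t a 0)) ->
  row_moments P (s i) X -> row_moments P (s i) Z ->
  (forall a, mean P (fun t => X (s i t) a 0) = 0) ->
  (forall a, mean P (fun t => Z (s i t) a 0) = 0) ->
  \sum_k y k = 0 ->
  \sum_a \sum_b `|mean P (fun t => X (s i t) a 0 * X (s i t) b 0) -
     (mean P (fun t => Z (s i t) a 0 * Z (s i t) b 0) +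
      #|K|%:R^-1 * \sum_k y k a 0 * y k b 0)| <= D ->
  mean P (fun t => frobenius (X (s i t)) ^+ 3) <= rho ->
  (forall k, mean P (fun t => frobenius (Z (s i t) + y k) ^+ 3) <= rho' k) ->
  `|mean P (fun t => g (U t + X (s i t))) -
    mean P (fun t => avg_shift y g (U t + Z (s i t)))| <=
  C * (D + rho + #|K|%:R^-1 * \sum_k rho' k).
Proof.
move=> iid K0 [l [q [tay [mg ml mq]]]] mU RX RZ X0 Z0 y0 hD hr hr'.
have [gC lC qC _] := tay.
have [LgX EX] := mean_taylor iid tay mg ml mq mU RX.
have RZk k := row_moments_shift (y k) iid RZ.
have HZ k := mean_taylor iid tay mg ml mq mU (RZk k).
have [mX L1X L2X L3X] := RX; have [mZ L1Z' L2Z L3Z] := RZ.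
have Kne : #|K|%:R != 0 :> R by rewrite pnatr_eq0 -lt0n.
have C0 : 0 <= C by exact: le_trans (gC 0).
have avgc (c : R) : #|K|%:R^-1 * \sum_(k : K) c = c.
  by rewrite sumr_const -[c *+ _]mulr_natl mulKf.
have ya a : \sum_k y k a 0 = 0.
  by have /matrixP/(_ a 0) := y0; rewrite summxE mxE.
set v := \sum_a \sum_b mean P (q a b \o U) *
  (mean P (fun t => Z (s i t) a 0 * Z (s i t) b 0) +
      #|K|%:R^-1 * \sum_k y k a 0 * y k b 0).
(* The expansion is applied to each shifted vector [Z + y k] and averaged over [k]. Linear terms and
   mixed terms cancel because [Z] and [y] are centred. *)
have EZ : `|mean P (fun t => avg_shift y g (U t + Z (s i t))) -
    (mean P (g \o U) + v)| <= C * (#|K|%:R^-1 * \sum_k rho' k).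
  have -> : mean P (fun t => avg_shift y g (U t + Z (s i t))) =
      #|K|%:R^-1 * \sum_k mean P (fun t => g (U t + (Z (s i t) + y k))).
    rewrite -mean_sum; last by move=> k _; have [] := HZ k.
    rewrite -meanZ; last by apply: L1_sum => k _; have [] := HZ k.
    congr mean; apply/funext => t; congr (_ * _); apply: eq_bigr => k _.
    by rewrite addrA.
  have -> : mean P (g \o U) + v = #|K|%:R^-1 * \sum_k (mean P (g \o U) +
     \sum_a mean P (l a \o U) * mean P (fun t => (Z (s i t) + y k) a 0) +
     \sum_a \sum_b mean P (q a b \o U) *
       mean P (fun t => (Z (s i t) + y k) a 0 * (Z (s i t) + y k) b 0)).
    have ZyE k a : mean P (fun t => (Z (s i t) + y k) a 0) = y k a 0.
      rewrite (_ : (fun t => _) = fun t => Z (s i t) a 0 + y k a 0); last first.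
        by apply/funext => t; rewrite mxE.
      by rewrite meanD ?Z0 ?mean_cst ?add0r //; exact: L1_cst.
    have ZyyE k a b :
        mean P (fun t => (Z (s i t) + y k) a 0 * (Z (s i t) + y k) b 0) =
        mean P (fun t => Z (s i t) a 0 * Z (s i t) b 0) + y k a 0 * y k b 0.
      rewrite (_ : (fun t => _) = fun t => Z (s i t) a 0 * Z (s i t) b 0 +
          (y k b 0 * Z (s i t) a 0 + (y k a 0 * Z (s i t) b 0 +
           y k a 0 * y k b 0))); last by apply/funext => t; rewrite !mxE; ring.
      have Lc c : L1 P (fun=> c) := L1_cst P c.
      have La c a' : L1 P (fun t => c * Z (s i t) a' 0) by exact: L1Z.
      have Lac c a' c' : L1 P (fun t => c * Z (s i t) a' 0 + c').
        exact: L1D.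
      rewrite meanD //; last exact: L1D.
      rewrite meanD // meanD // !meanZ // !Z0 mean_cst.
      by rewrite !mulr0 !add0r.
    rewrite big_split big_split /= 2!mulrDr avgc -addrA; congr (_ + _).
    rewrite [X in _ = X + _](_ : _ = 0); last first.
      rewrite exchange_big big1 ?mulr0 // => a _.
      under eq_bigr do rewrite ZyE.
      by rewrite -mulr_sumr ya mulr0.
    rewrite add0r exchange_big mulr_sumr; apply: eq_bigr => a _.
    rewrite exchange_big mulr_sumr; apply: eq_bigr => b _ /=.
    rewrite -mulr_sumr mulrCA; congr (_ * _).
    by rewrite (eq_bigr _ (fun k _ => ZyyE k a b)) big_split /= mulrDr avgc.
  rewrite -mulrBr -sumrB [leRHS]mulrCA normrM ger0_norm ?invr_ge0 //.
  rewrite ler_wpM2l ?invr_ge0 // [leRHS]mulr_sumr; apply: (le_trans (ler_norm_sum _ _ _)).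
  apply: ler_sum => k _; have [_ h] := HZ k; apply: (le_trans h).
  by rewrite ler_wpM2l.
have EX' : `|mean P (fun t => g (U t + X (s i t))) - (mean P (g \o U) + v)| <=
    C * D + C * rho.
  set w := \sum_a \sum_b mean P (q a b \o U) *
    mean P (fun t => X (s i t) a 0 * X (s i t) b 0).
  have h1 : `|mean P (fun t => g (U t + X (s i t))) - (mean P (g \o U) + w)| <= C * rho.
    apply: le_trans (ler_wpM2l C0 hr); apply: le_trans EX.
    rewrite [X in _ <= `|_ - (_ + X + _)|]big1 ?addr0 // => a _.
    by rewrite X0 mulr0.
  have h2 : `|w - v| <= C * D.
    apply: le_trans (ler_wpM2l C0 hD).
    rewrite /w /v -sumrB mulr_sumr; apply: le_trans (ler_norm_sum _ _ _) _.
    apply: ler_sum => a _; rewrite -sumrB mulr_sumr.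
    apply: le_trans (ler_norm_sum _ _ _) _; apply: ler_sum => b _.
    rewrite -mulrBr normrM ler_wpM2r //.
    have Lq : L1 P (q a b \o U).
      apply: L1_bounded (fun t => qC a b (U t)); apply: mq => c.
      exact: (@measurable_rows_sigma R _ _ T R P n m s [set~ i]).
    apply: (le_trans (mean_norm Lq)); rewrite -[leRHS](mean_cst P).
    by apply: mean_le => [||t]; [exact: L1_norm|exact: L1_cst|exact: qC].
  move: h1 h2; rewrite !ler_norml => /andP[h1 h1'] /andP[h2 h2'].
  by apply/andP; split; lra.
move: EX' EZ; rewrite !ler_norml => /andP[h1 h1'] /andP[h2 h2'].
by apply/andP; split; lra.
Qed.

(** The general target [Z] plus [y] serves twice: [Z = 0] with [y] the centred sample gives the
    bootstrap comparison, and a two-point [y] with a nonzero residual [Z] gives the annulus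
    bound. *)
Lemma lindeberg (R : realType) (disp : measure_display)
    (T : measurableType disp) (P : probability T R) (n m d : nat)
    (s : 'I_m -> T -> 'cV[R]_n) (K : finType) (C D rho : R)
    (rho' : K -> R) (f : 'cV[R]_d -> R)
    (X Z : 'cV[R]_n -> 'cV[R]_d) (y : K -> 'cV[R]_d) :
  iid_rows P s -> (0 < #|K|)%N -> smooth C f ->
  (forall i, row_moments P (s i) X) -> (forall i, row_moments P (s i) Z) ->
  (forall i a, mean P (fun t => X (s i t) a 0) = 0) ->
  (forall i a, mean P (fun t => Z (s i t) a 0) = 0) ->
  \sum_k y k = 0 ->
  (forall i, \sum_a \sum_b `|mean P (fun t => X (s i t) a 0 * X (s i t) b 0) -
     (mean P (fun t => Z (s i t) a 0 * Z (s i t) b 0) +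
      #|K|%:R^-1 * \sum_k y k a 0 * y k b 0)| <= D) ->
  (forall i, mean P (fun t => frobenius (X (s i t)) ^+ 3) <= rho) ->
  (forall i k, mean P (fun t => frobenius (Z (s i t) + y k) ^+ 3) <= rho' k) ->
  `|mean P (fun t => f (\sum_i X (s i t))) -
    mean P (fun t => iter m (avg_shift y) f (\sum_i Z (s i t)))| <=
  m%:R * (C * (D + rho + #|K|%:R^-1 * \sum_k rho' k)).
Proof.
move=> iid K0 sf RX RZ X0 Z0 y0 hD hr hr'.
set E := C * _.
(* Hybrid [k]: the first [k] summands are [X], the others are [Z], and the remaining [m - k] draws
   from [y] are carried by the iterate applied to [f]. *)
pose hyb k t := \sum_(j < m) if (j < k)%N then X (s j t) else Z (s j t).
pose H k := mean P (fun t => iter (m - k) (avg_shift y) f (hyb k t)).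
have step k : (k < m)%N -> `|H k.+1 - H k| <= E.
  move=> km; pose i := Ordinal km.
  pose U t := \sum_(j | j != i) if (j < k)%N then X (s j t) else Z (s j t).
  have -> : H k.+1 = mean P (fun t => iter (m - k.+1) (avg_shift y) f (U t + X (s i t))).
    congr mean; apply/funext => t; congr (iter _ _ _ _).
    rewrite /hyb (bigD1 i) //= ltnSn addrC; congr (_ + _).
    by apply: eq_bigr => j ji; rewrite ltnS leq_eqVlt -[_ == k]/(j == i) (negbTE ji).
  have -> : H k = mean P (fun t =>
      avg_shift y (iter (m - k.+1) (avg_shift y) f) (U t + Z (s i t))).
    congr mean; apply/funext => t; rewrite subnS -iterS prednK ?subn_gt0 //.
    by congr (iter _ _ _ _); rewrite /hyb (bigD1 i) //= ltnn addrC.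
  apply: (swap_one iid K0 (smooth_iter_avg_shift _ _ K0 sf)) => // a.
  rewrite (_ : (fun t => _) =
    fun t => \sum_(j < m) if j == i then 0 else
      if (j < k)%N then X (s j t) a 0 else Z (s j t) a 0); last first.
    apply/funext => t; rewrite /U summxE big_mkcond; apply: eq_bigr => j _.
    by case: (j == i) => //=; case: ifP.
  apply: measurable_sum => j; have [//|/eqP ji] := eqVneq j i.
  case: (j < k)%N.
    by have [mX _ _ _] := RX i; exact: (@measurable_row_comp R disp T n m s
      [set~ i] j (fun x => X x a 0) ji (mX a)).
  by have [mZ _ _ _] := RZ i; exact: (@measurable_row_comp R disp T n m s
      [set~ i] j (fun x => Z x a 0) ji (mZ a)).
have tele k : (k <= m)%N -> `|H k - H 0%N| <= k%:R * E.
  elim: k => [_|k IH km]; first by rewrite subrr normr0 mul0r.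
  have h1 := step k km; have h2 := IH (ltnW km).
  rewrite -(subrK (H k) (H k.+1)) -addrA -natr1 mulrDl mul1r addrC.
  exact: le_trans (ler_normD _ _) (lerD h2 h1).
have := tele m (leqnn m); rewrite /H subnn subn0 /hyb /=.
congr (`|_ - _| <= _); congr mean; apply/funext => t.
  by congr f; apply: eq_bigr => j _; rewrite ltn_ord.
Qed.

(** * Small balls for the simple random walk *)

(** After [N] signs of which [j] are negative, the walk has moved by [N - 2 * j] steps along [w]. *)
Lemma iter_avg_shift_pm (R : numFieldType) (V : lmodType R) (N : nat)
    (w : V) (f : V -> R) (x : V) :
  iter N (avg_shift (fun b : bool => (-1) ^+ b *: w)%R) f x =
  \sum_(j < N.+1) 'C(N, j)%:R / 2 ^+ N * f (x + (N%:R - 2 * j%:R) *: w).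
Proof.
elim: N x => [|N IH] x.
  by rewrite /= big_ord1 bin0 expr0 divr1 mul1r mulr0 subr0 scale0r addr0.
rewrite iterS {1}/avg_shift card_bool big_bool /= !IH expr0 expr1 scale1r scaleN1r.
have half (c z : R) : 2^-1 * (c / 2 ^+ N * z) = c / 2 ^+ N.+1 * z.
  by rewrite exprS invfM; ring.
pose F j := f (x + (N.+1%:R - 2 * j%:R) *: w).
have E0 j : f (x + w + (N%:R - 2 * j%:R) *: w) = F j.
  rewrite /F; congr f; rewrite -addrA; congr (_ + _).
  by rewrite -[X in X + _ = _]scale1r -scalerDl; congr (_ *: _); rewrite -natr1; ring.
have E1 j : f (x - w + (N%:R - 2 * j%:R) *: w) = F j.+1.
  rewrite /F; congr f; rewrite -addrA; congr (_ + _).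
  rewrite -[X in - X + _ = _]scale1r -scaleNr -scalerDl; congr (_ *: _).
  by rewrite -!natr1; ring.
transitivity (2^-1 * (\sum_(j < N.+1) 'C(N, j)%:R / 2 ^+ N * F j.+1 +
    \sum_(j < N.+1) 'C(N, j)%:R / 2 ^+ N * F j)).
  congr (_ * (_ + _)); apply: eq_bigr => j _; congr (_ * _).
    exact: E1.
  exact: E0.
transitivity (\sum_(j < N.+2) 'C(N.+1, j)%:R / 2 ^+ N.+1 * F j); last by [].
rewrite addrC [RHS]big_ord_recl /=.
rewrite [X in _ * (X + _)]big_ord_recl /= !bin0.
under [X in _ = _ + X]eq_bigr do rewrite /bump /= add1n binS natrD !mulrDl.
rewrite big_split /= addrA !mulrDr; congr (_ + _ + _).
- by rewrite half.
- rewrite [X in _ = X]big_ord_recr /= (bin_small (ltnSn N)) !mul0r addr0.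
  by rewrite mulr_sumr; apply: eq_bigr => j _; rewrite half.
- by rewrite mulr_sumr; apply: eq_bigr => j _; rewrite half.
Qed.

Lemma bin_le_central (k j : nat) : ('C(k.*2, j) <= 'C(k.*2, k))%N.
Proof.
have up i : (i < k)%N -> ('C(k.*2, i) <= 'C(k.*2, i.+1))%N.
  move=> ik; rewrite -(leq_pmul2l (ltn0Sn i)) mul_bin_left leq_mul2r.
  by apply/orP; right; lia.
have low i : (i <= k)%N -> ('C(k.*2, i) <= 'C(k.*2, k))%N.
  move=> ik; rewrite -(subKn ik); elim: (k - i)%N (leq_subr i k) => [|e IH] ek.
    by rewrite subn0.
  apply: leq_trans (IH (ltnW ek)).
  have -> : (k - e = (k - e.+1).+1)%N by lia.
  by apply: up; lia.
have [jk|kj] := leqP j k; first exact: low.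
have [jk2|] := leqP j k.*2; last by move=> h; rewrite bin_small.
by rewrite -bin_sub //; apply: low; lia.
Qed.

(** Induction from (k+1) C(2k+2, k+1) = 2 (2k+1) C(2k, k); the step reduces to (2k+1)(2k+3) <= 4
    (k+1)^2. This replaces Stirling's formula. *)
Lemma bin_central_bound (k : nat) : ('C(k.*2, k) ^ 2 * k.*2.+1 <= 4 ^ k.*2)%N.
Proof.
elim: k => [//|k IH].
have h : (k.+1 * 'C(k.+1.*2, k.+1) = 2 * k.*2.+1 * 'C(k.*2, k))%N.
  have f1 := @bin_fact k.+1.*2 k.+1; have f2 := @bin_fact k.*2 k.
  have e1 : (k.+1.*2 - k.+1 = k.+1)%N by lia.
  have e2 : (k.*2 - k = k)%N by lia.
  rewrite e1 doubleS !factS in f1; rewrite e2 in f2.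
  have {}f1 := f1 ltac:(lia); have {}f2 := f2 ltac:(lia).
  have k0 : (0 < k`! * k`! * k.+1)%N by rewrite !muln_gt0 !fact_gt0.
  apply/eqP; rewrite -(eqn_pmul2l k0) doubleS; apply/eqP.
  move: f1 f2; move: 'C(_, _) 'C(_, _) (k`!) (k.*2`!) => c1 c2 f g f1 f2.
  have : (k.*2.+2 = 2 * k.+1)%N by lia.
  nia.
rewrite -(@leq_pmul2l (k.+1 ^ 2)) ?expn_gt0 //.
have -> : (k.+1 ^ 2 * ('C(k.+1.*2, k.+1) ^ 2 * k.+1.*2.+1) =
    (k.+1 * 'C(k.+1.*2, k.+1)) ^ 2 * k.+1.*2.+1)%N by rewrite expnMn mulnA.
rewrite h doubleS !expnS; move: IH; rewrite -!mulnn.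
move: 'C(_, _) (4 ^ _)%N => c g IH.
have -> : (k.*2 = 2 * k)%N by lia.
move: IH; rewrite -mul2n => IH; nia.
Qed.

(** For odd [N = 2k+1], Pascal's rule doubles the central coefficient at most. The factor 2k+1,
    rather than 2k, in the even bound is what this case consumes. *)
Lemma bin_sq_bound (N j : nat) : ('C(N, j) ^ 2 * N <= 4 ^ N)%N.
Proof.
have even k i : ('C(k.*2, i) ^ 2 * k.*2.+1 <= 4 ^ k.*2)%N.
  apply: leq_trans (bin_central_bound k).
  by rewrite leq_mul2r leq_sqr bin_le_central orbT.
rewrite -(odd_double_half N); case: (odd N) => /=; last first.
  rewrite add0n; apply: leq_trans (even _ j); rewrite leq_mul2l leqnSn.
  exact: orbT.
rewrite add1n; set k := N./2.
have h : ('C(k.*2.+1, j) <= 2 * 'C(k.*2, k))%N.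
  case: j => [|j]; first by rewrite bin0; have := bin_le_central k 0; rewrite bin0; lia.
  by have := bin_le_central k j.+1; have := bin_le_central k j; rewrite binS; lia.
have e := even k k.
apply: leq_trans (_ : ((2 * 'C(k.*2, k)) ^ 2 * k.*2.+1 <= _)%N).
  by rewrite leq_mul2r leq_sqr h orbT.
by rewrite expnMn -mulnA [X in (_ <= X)%N]expnS leq_mul2l e.
Qed.

Lemma bin_pmf_bound (R : rcfType) (N j : nat) : (0 < N)%N ->
  'C(N, j)%:R / 2 ^+ N <= (Num.sqrt N%:R)^-1 :> R.
Proof.
move=> N0; have sN : 0 < Num.sqrt N%:R :> R by rewrite sqrtr_gt0 ltr0n.
rewrite -[leRHS]mul1r ler_pdivlMr // mulrAC ler_pdivrMr ?exprn_gt0 //.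
rewrite -(ler_pXn2r (isT : (0 < 2)%N)) ?nnegrE ?mulr_ge0 ?exprn_ge0 ?(ltW sN) //.
rewrite mul1r exprMn sqr_sqrtr // exprAC -[2 ^+ 2]natrX -!natrX -natrM ler_nat.
exact: bin_sq_bound.
Qed.

Lemma card_close (R : realDomainType) (n : nat) (S : {set 'I_n}) (tau : R) :
  0 <= tau -> (forall j k, j \in S -> k \in S -> k%:R <= j%:R + tau :> R) ->
  #|S|%:R <= tau + 1.
Proof.
move=> tau0 close; have [->|[j0 j0S]] := set_0Vmem S.
  by rewrite cards0 addr_ge0.
have [a aS amin] := arg_minnP (fun j : 'I_n => j : nat) j0S.
have [b bS bmax] := arg_maxnP (fun j : 'I_n => j : nat) j0S.
have h : (#|S| <= b - a + 1)%N.
  rewrite cardE -(size_map val) -(size_iota a (b - a + 1)).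
  apply: uniq_leq_size; first by rewrite map_inj_uniq ?enum_uniq //; exact: val_inj.
  move=> x /mapP[j]; rewrite mem_enum => jS ->; rewrite mem_iota.
  have := amin j jS; have := bmax j jS; rewrite /=; lia.
apply: (@le_trans _ _ (b - a + 1)%:R); first by rewrite ler_nat.
by rewrite natrD natrB ?amin // lerD2r lerBlDl close.
Qed.

(** On the line through [x] along [w] the squared norm is a parabola. On each of its two branches
    the annulus confines the index [j] to a window of length [tau], hence to at most [tau + 1]
    values, and each value has mass at most 1 over the square root of [N]. *)
Lemma walk_small_ball (R : realType) (d N : nat) (w x : 'cV[R]_d)
    (f : 'cV[R]_d -> R) (L l tau : R) :
  (0 < N)%N -> 0 < frobenius w -> 0 <= tau ->
  l <= 4 * frobenius w ^+ 2 * tau ^+ 2 ->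
  (forall z, 0 <= f z <= 1) ->
  (forall z, f z != 0 -> L < frobenius z ^+ 2 < L + l) ->
  iter N (avg_shift (fun b : bool => (-1) ^+ b *: w)%R) f x
    <= 2 * (tau + 1) / Num.sqrt N%:R.
Proof.
move=> N0 w0 tau0 ltau f01 fsupp.
rewrite iter_avg_shift_pm.
pose u (j : 'I_N.+1) : R := N%:R - 2 * j%:R.
pose s j := u j + dot x w / frobenius w ^+ 2.
pose S := [set j | f (x + u j *: w) != 0]%SET.
pose S1 := [set j in S | (0 <= s j)%R]%SET.
pose S2 := [set j in S | (s j <= 0)%R]%SET.
have w20 : 0 < frobenius w ^+ 2 by rewrite exprn_gt0.
(* Completing the square: [s j] is the signed position relative to the vertex of the parabola, and
   successive values differ by 2. *)
have qE j : frobenius (x + u j *: w) ^+ 2 = frobenius w ^+ 2 * s j ^+ 2 +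
    (frobenius x ^+ 2 - dot x w ^+ 2 / frobenius w ^+ 2).
  rewrite frobenius_colD frobeniusZ exprMn real_normK ?num_real //.
  have -> : dot x (u j *: w) = u j * dot x w.
    by rewrite /dot mulr_sumr; apply: eq_bigr => a _; rewrite mxE; ring.
  by rewrite /s; field; rewrite gt_eqF.
have sub j k : s j - s k = 2 * (k%:R - j%:R) by rewrite /s /u; ring.
have near j k : j \in S -> k \in S -> 0 <= s j * s k -> k%:R <= j%:R + tau :> R.
  rewrite !inE => /fsupp/andP[j1 j2] /fsupp/andP[k1 k2] sjk.
  have := sub j k; rewrite !qE in j1 j2 k1 k2 => sub_jk.
  rewrite leNgt; apply/negP => jk.
  have st : 2 * tau < s j - s k by rewrite sub_jk; lra.
  (* For two positions on the same side of the vertex the difference is at most the sum in absolute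
     value, so its square is at most the difference of the squares. *)
  have h1 : 4 * tau ^+ 2 < `|s j ^+ 2 - s k ^+ 2|.
    apply: (@lt_le_trans _ _ ((s j - s k) ^+ 2)); first by nra.
    have -> : s j ^+ 2 - s k ^+ 2 = (s j - s k) * (s j + s k) by ring.
    have p : 0 <= s j - s k by lra.
    rewrite normrM (ger0_norm p) expr2 ler_wpM2l //.
    rewrite -(ler_pXn2r (isT : (0 < 2)%N)) ?nnegrE //.
    rewrite real_normK ?num_real // !expr2; lra.
  have h2 : frobenius w ^+ 2 * `|s j ^+ 2 - s k ^+ 2| < l.
    rewrite -[X in X * _](ger0_norm (ltW w20)) -normrM ltr_norml.
    by apply/andP; split; lra.
  have : frobenius w ^+ 2 * (4 * tau ^+ 2) < l.
    by apply: le_lt_trans h2; rewrite ler_wpM2l ?ltW.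
  lra.
have c1 : #|S1|%:R <= tau + 1.
  apply: card_close => // j k; rewrite !inE => /andP[jS sj] /andP[kS sk].
  by apply: near; rewrite ?inE // mulr_ge0.
have c2 : #|S2|%:R <= tau + 1.
  apply: card_close => // j k; rewrite !inE => /andP[jS sj] /andP[kS sk].
  by apply: near; rewrite ?inE // mulr_le0.
have c : #|S|%:R <= 2 * (tau + 1).
  apply: (@le_trans _ _ (#|S1| + #|S2|)%:R); last by rewrite natrD; lra.
  rewrite ler_nat; apply: leq_trans (leq_card_setU S1 S2).
  apply: subset_leq_card; apply/fintype.subsetP => j jS; rewrite !inE.
  by rewrite inE in jS; rewrite jS /= le_total.
apply: (@le_trans _ _ (\sum_(j in S) (Num.sqrt N%:R)^-1)); last first.
  by rewrite sumr_const -[_ *+ #|S|]mulr_natl ler_wpM2r // invr_ge0 sqrtr_ge0.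
rewrite [leRHS]big_mkcond; apply: ler_sum => j _; rewrite inE -/(u j).
have [->|fj] := eqVneq (f (x + u j *: w)) 0; first by rewrite mulr0.
have /andP[f0 f1] := f01 (x + u j *: w).
apply: le_trans (bin_pmf_bound R j N0); rewrite ler_piMr //.
Qed.

(** * Perturbation of the ridge map *)

Lemma psd_shift_unit (R : realType) (d : nat) (H : 'M[R]_d) (lam : R) :
  0 < lam -> (forall v : 'rV[R]_d, 0 <= (v *m H *m v^T) 0 0) ->
  H + lam%:M \in unitmx.
Proof.
move=> lam0 psd; rewrite -row_free_unit; apply: inj_row_free => v vH.
have h : (v *m H *m v^T) 0 0 + lam * \sum_j v 0 j ^+ 2 = 0.
  have : (v *m (H + lam%:M) *m v^T) 0 0 = 0 by rewrite vH mul0mx mxE.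
  rewrite mulmxDr mulmxDl mxE mul_mx_scalar -scalemxAl [X in _ + X]mxE.
  rewrite (_ : (v *m v^T) 0 0 = \sum_j v 0 j ^+ 2) // mxE.
  by apply: eq_bigr => j _; rewrite mxE expr2.
have s0 : 0 <= \sum_j v 0 j ^+ 2 by apply: sumr_ge0 => j _; exact: sqr_ge0.
have s1 : \sum_j v 0 j ^+ 2 = 0.
  apply/eqP; rewrite eq_le s0 andbT -(pmulr_rle0 _ lam0).
  by have := psd v; lra.
apply/rowP => j; rewrite mxE; apply/eqP; rewrite -sqrf_eq0; apply/eqP.
by apply: (psumr_eq0P (fun k _ => sqr_ge0 (v 0 k)) s1).
Qed.

Lemma psd_outer (R : realType) (d : nat) (z : 'cV[R]_d) (v : 'rV[R]_d) :
  0 <= (v *m (z *m z^T) *m v^T) 0 0.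
Proof.
have -> : v *m (z *m z^T) *m v^T = (v *m z) *m (v *m z)^T.
  by rewrite trmx_mul !mulmxA.
by rewrite mxE big_ord1 [X in _ * X]mxE -expr2 sqr_ge0.
Qed.

Lemma psd_sum (R : realType) (d m : nat) (c : R) (a : 'I_m -> R)
    (z : 'I_m -> 'cV[R]_d) (v : 'rV[R]_d) :
  0 <= c -> (forall i, 0 <= a i) ->
  0 <= (v *m (c *: \sum_i a i *: (z i *m (z i)^T)) *m v^T) 0 0.
Proof.
move=> c0 a0; rewrite -scalemxAr -scalemxAl mxE mulr_ge0 //.
rewrite mulmx_sumr mulmx_suml summxE; apply: sumr_ge0 => i _.
by rewrite -scalemxAr -scalemxAl mxE mulr_ge0 // psd_outer.
Qed.

Lemma psd_gram (R : realType) (n d : nat) (X : 'M[R]_(n, d)) (v : 'rV[R]_d) :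
  0 <= (v *m gram X *m v^T) 0 0.
Proof.
rewrite /gram -scalemxAr -scalemxAl mxE mulr_ge0 ?invr_ge0 //.
have -> : v *m (X^T *m X) *m v^T = (v *m X^T) *m (v *m X^T)^T.
  by rewrite trmx_mul trmxK !mulmxA.
by rewrite mxE; apply: sumr_ge0 => j _; rewrite [X in _ * X]mxE -expr2 sqr_ge0.
Qed.

Lemma gram_shift_unit (R : realType) (n d : nat) (X : 'M[R]_(n, d)) (lam : R) :
  0 < lam -> gram X + lam%:M \in unitmx.
Proof. by move=> l0; apply: psd_shift_unit => // v; exact: psd_gram. Qed.

(* Linearization of the ridge map [(H, g) |-> (H + lam)^-1 g] at [(H, g)]. *)
Lemma ridge_expand (R : realType) (d : nat) (H Hs : 'M[R]_d) (gs beta : 'cV[R]_d)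
    (lam : R) :
  H + lam%:M \in unitmx -> Hs + lam%:M \in unitmx ->
  let x := resolvent Hs lam *m gs - beta in
  x + resolvent H lam *m (Hs - H) *m x =
  resolvent H lam *m (gs - Hs *m beta - lam *: beta).
Proof.
move=> uH uHs x.
have E : (Hs + lam%:M) *m x = gs - Hs *m beta - lam *: beta.
  by rewrite /x mulmxBr mulKVmx // mulmxDl mul_scalar_mx opprD addrA.
rewrite -E; clearbody x; clear E.
rewrite (_ : Hs + lam%:M = (Hs - H) + (H + lam%:M)); last by rewrite addrA subrK.
by rewrite mulmxDl mulmxDr (mulmxA _ (H + _)) mulVmx // mul1mx mulmxA addrC.
Qed.

Definition outer_dev (R : realType) (n d : nat) (X : 'M[R]_(n, d))
    (x : 'cV[R]_n) : 'M[R]_d :=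
  zvec X x *m (zvec X x)^T - gram X.

Lemma weighted_avg_cst (R : realType) (V : lmodType R) (m : nat)
    (a : 'I_m -> R) (c : V) :
  (0 < m)%N -> \sum_i a i = m%:R -> m%:R^-1 *: \sum_i a i *: c = c.
Proof.
move=> m0 am; have mne : m%:R != 0 :> R by rewrite pnatr_eq0 -lt0n.
by rewrite -scaler_suml am scalerA mulVf // scale1r.
Qed.

(** Weights of total [m] reproduce the constant term [lam *: beta]. Their weighted average of
    influence vectors is then exactly the right side of [ridge_expand], with no approximation. *)
Lemma influence_avg (R : realType) (n d m : nat) (X : 'M[R]_(n, d))
    (y : 'cV[R]_n) (lam : R) (S : 'I_m -> 'cV[R]_n) (a : 'I_m -> R) :
  (0 < m)%N -> \sum_i a i = m%:R ->
  m%:R^-1 *: \sum_i a i *: influence X y lam (S i) =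
  resolvent (gram X) lam *m
   (m%:R^-1 *: \sum_i a i *: (uval y (S i) *: zvec X (S i)) -
    (m%:R^-1 *: \sum_i a i *: (zvec X (S i) *m (zvec X (S i))^T)) *m ridge X y lam
    - lam *: ridge X y lam).
Proof.
move=> m0 am; set beta := ridge X y lam.
rewrite -(weighted_avg_cst (lam *: beta) m0 am).
rewrite -scalemxAl -!scalerBr -scalemxAr; congr (_ *: _).
rewrite mulmx_suml -!sumrB mulmx_sumr; apply: eq_bigr => i _.
rewrite -scalemxAl -!scalerBr -scalemxAr; congr (_ *: (_ *m (_ - _))).
rewrite scalerBl; congr (_ - _).
rewrite -mulmxA; apply/matrixP => k l; rewrite !mxE big_ord1 !mxE mulrC.
by rewrite ord1.
Qed.

Lemma outer_dev_avg (R : realType) (n d m : nat) (X : 'M[R]_(n, d))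
    (S : 'I_m -> 'cV[R]_n) (a : 'I_m -> R) :
  (0 < m)%N -> \sum_i a i = m%:R ->
  m%:R^-1 *: \sum_i a i *: outer_dev X (S i) =
  m%:R^-1 *: \sum_i a i *: (zvec X (S i) *m (zvec X (S i))^T) - gram X.
Proof.
move=> m0 am; rewrite -[X in _ = _ - X](weighted_avg_cst (gram X) m0 am).
by rewrite -scalerBr -sumrB; congr (_ *: _); apply: eq_bigr => i _; rewrite scalerBr.
Qed.

Lemma boot_expand (R : realType) (n d m : nat) (X : 'M[R]_(n, d))
    (y : 'cV[R]_n) (lam : R) (S : 'I_m -> 'cV[R]_n) (v : {ffun 'I_m -> nat}) :
  (0 < m)%N -> 0 < lam -> (\sum_i v i)%N = m ->
  let x := boot_ridge X y lam S v - ridge X y lam in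
  x + resolvent (gram X) lam *m
      (m%:R^-1 *: \sum_i (v i)%:R *: outer_dev X (S i)) *m x =
  m%:R^-1 *: \sum_i (v i)%:R *: influence X y lam (S i).
Proof.
move=> m0 lam0 vm x.
have am : \sum_i (v i)%:R = m%:R :> R by rewrite -natr_sum vm.
rewrite influence_avg // outer_dev_avg //; apply: ridge_expand.
  exact: gram_shift_unit.
by apply: psd_shift_unit => // u; apply: psd_sum.
Qed.

(** Seeing the sketched estimator as a bootstrap replicate with unit weights transfers expansions
    and measurability to it. *)
Lemma sketched_ridgeE (R : realType) (n d m : nat) (X : 'M[R]_(n, d))
    (y : 'cV[R]_n) (lam : R) (S : 'I_m -> 'cV[R]_n) :
  sketched_ridge X y lam S = boot_ridge X y lam S [ffun=> 1%N].
Proof.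
rewrite /sketched_ridge /boot_ridge; congr (resolvent (_ *: _) _ *m (_ *: _)).
  by apply: eq_bigr => i _; rewrite ffunE scale1r.
by apply: eq_bigr => i _; rewrite ffunE scale1r.
Qed.

Lemma sketched_expand (R : realType) (n d m : nat) (X : 'M[R]_(n, d))
    (y : 'cV[R]_n) (lam : R) (S : 'I_m -> 'cV[R]_n) :
  (0 < m)%N -> 0 < lam ->
  let x := sketched_ridge X y lam S - ridge X y lam in
  x + resolvent (gram X) lam *m (m%:R^-1 *: \sum_i outer_dev X (S i)) *m x =
  m%:R^-1 *: \sum_i influence X y lam (S i).
Proof.
move=> m0 lam0; rewrite sketched_ridgeE /=.
have E (V : lmodType R) (F : 'I_m -> V) :
    \sum_i F i = \sum_i ([ffun=> 1%N] i : nat)%:R *: F i.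
  by apply: eq_bigr => i _; rewrite ffunE scale1r.
rewrite !(E _ (fun i => outer_dev _ _)) !(E _ (fun i => influence _ _ _ _)).
apply: boot_expand => //.
by under eq_bigr do rewrite ffunE; rewrite sum1_card card_ord.
Qed.

(** * Measurability of the estimators *)

Definition mx_measurable (R : realType) (disp : measure_display)
    (T : measurableType disp) (p q : nat) (F : T -> 'M[R]_(p, q)) : Prop :=
  forall i j, measurable_fun setT (fun t => F t i j).

(** Inversion is discontinuous at 0. Writing 1/x as x times the power -1 of x^2 handles both signs,
    and at 0 both sides are 0. *)
Lemma measurable_inv (R : realType) (disp : measure_display)
    (T : measurableType disp) (f : T -> R) :
  measurable_fun setT f -> measurable_fun setT (fun t => (f t)^-1).
Proof.
move=> mf; rewrite (_ : (fun t => _) = fun t => f t * (f t ^+ 2) `^ (-1)).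
  apply: measurable_funM => //.
  apply: (@measurableT_comp _ _ _ _ _ _ (fun x : R => x `^ (-1))).
    exact: measurable_powR.
  exact: measurable_funX.
apply/funext => t; rewrite powR_inv1 ?sqr_ge0 //.
have [->|f0] := eqVneq (f t) 0; first by rewrite invr0 mul0r.
by rewrite expr2 invfM mulrA divff // mul1r.
Qed.

Lemma mx_measurable_cst (R : realType) (disp : measure_display)
    (T : measurableType disp) (p q : nat) (A : 'M[R]_(p, q)) :
  mx_measurable (fun _ : T => A).
Proof. by move=> i j. Qed.

Lemma mx_measurableD (R : realType) (disp : measure_display)
    (T : measurableType disp) (p q : nat) (F G : T -> 'M[R]_(p, q)) :
  mx_measurable F -> mx_measurable G -> mx_measurable (fun t => F t + G t).
Proof.
move=> mF mG i j; rewrite (_ : (fun t => _) = fun t => F t i j + G t i j).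
  exact: measurable_funD.
by apply/funext => t; rewrite mxE.
Qed.

Lemma mx_measurableZ (R : realType) (disp : measure_display)
    (T : measurableType disp) (p q : nat) (c : T -> R) (F : T -> 'M[R]_(p, q)) :
  measurable_fun setT c -> mx_measurable F ->
  mx_measurable (fun t => c t *: F t).
Proof.
move=> mc mF i j; rewrite (_ : (fun t => _) = fun t => c t * F t i j).
  exact: measurable_funM.
by apply/funext => t; rewrite mxE.
Qed.

Lemma mx_measurableN (R : realType) (disp : measure_display)
    (T : measurableType disp) (p q : nat) (F : T -> 'M[R]_(p, q)) :
  mx_measurable F -> mx_measurable (fun t => - F t).
Proof.
move=> mF; rewrite (_ : (fun t => _) = fun t => (-1) *: F t).
  by apply: mx_measurableZ.
by apply/funext => t; rewrite scaleN1r.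
Qed.

Lemma mx_measurableB (R : realType) (disp : measure_display)
    (T : measurableType disp) (p q : nat) (F G : T -> 'M[R]_(p, q)) :
  mx_measurable F -> mx_measurable G -> mx_measurable (fun t => F t - G t).
Proof. by move=> mF mG; apply: mx_measurableD => //; exact: mx_measurableN. Qed.

Lemma mx_measurable_sum (R : realType) (disp : measure_display)
    (T : measurableType disp) (p q : nat) (I : finType)
    (F : I -> T -> 'M[R]_(p, q)) :
  (forall k, mx_measurable (F k)) -> mx_measurable (fun t => \sum_k F k t).
Proof.
move=> mF i j; rewrite (_ : (fun t => _) = fun t => \sum_k F k t i j).
  by apply: measurable_sum => k; exact: mF.
by apply/funext => t; rewrite summxE.
Qed.

Lemma mx_measurableM (R : realType) (disp : measure_display)
    (T : measurableType disp) (p q r : nat)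
    (F : T -> 'M[R]_(p, q)) (G : T -> 'M[R]_(q, r)) :
  mx_measurable F -> mx_measurable G -> mx_measurable (fun t => F t *m G t).
Proof.
move=> mF mG i j.
rewrite (_ : (fun t => _) = fun t => \sum_k F t i k * G t k j).
  by apply: measurable_sum => k; exact: measurable_funM.
by apply/funext => t; rewrite mxE.
Qed.

Lemma mx_measurable_tr (R : realType) (disp : measure_display)
    (T : measurableType disp) (p q : nat) (F : T -> 'M[R]_(p, q)) :
  mx_measurable F -> mx_measurable (fun t => (F t)^T).
Proof.
by move=> mF i j; rewrite (_ : (fun t => _) = fun t => F t j i) //;
   apply/funext => t; rewrite mxE.
Qed.

Lemma measurable_det (R : realType) (disp : measure_display)
    (T : measurableType disp) (p : nat) (F : T -> 'M[R]_p) :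
  mx_measurable F -> measurable_fun setT (fun t => \det (F t)).
Proof.
move=> mF; apply: measurable_sum => sg; apply: measurable_funM => //.
by apply: measurable_prod => i _; exact: mF.
Qed.

Lemma mx_measurable_inv (R : realType) (disp : measure_display)
    (T : measurableType disp) (p : nat) (F : T -> 'M[R]_p) :
  (forall t, F t \in unitmx) ->
  mx_measurable F -> mx_measurable (fun t => invmx (F t)).
Proof.
move=> uF mF; rewrite (_ : (fun t => _) = fun t => (\det (F t))^-1 *: \adj (F t)).
  apply: mx_measurableZ; first exact/measurable_inv/measurable_det.
  move=> i j.
  rewrite (_ : (fun t => _) = fun t => (-1) ^+ (j + i) * \det (row' j (col' i (F t)))).
    apply: measurable_funM => //; apply: measurable_det => k l.
    rewrite (_ : (fun t => _) = fun t => F t (lift j k) (lift i l)) //.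
    by apply/funext => t; rewrite !mxE.
  by apply/funext => t; rewrite mxE.
by apply/funext => t; rewrite /invmx uF.
Qed.

Lemma mx_measurable_zvec (R : realType) (disp : measure_display)
    (T : measurableType disp) (n d : nat) (X : 'M[R]_(n, d)) (r : T -> 'cV[R]_n) :
  mx_measurable r -> mx_measurable (fun t => zvec X (r t)).
Proof.
move=> mr; apply: mx_measurableZ => //.
by apply: mx_measurableM => //; exact: mx_measurable_cst.
Qed.

Lemma measurable_uval (R : realType) (disp : measure_display)
    (T : measurableType disp) (n : nat) (y : 'cV[R]_n) (r : T -> 'cV[R]_n) :
  mx_measurable r -> measurable_fun setT (fun t => uval y (r t)).
Proof.
move=> mr; apply: measurable_funM => //.
suff h : mx_measurable (fun t => y^T *m r t) by exact: h.
by apply: mx_measurableM => //; exact: mx_measurable_cst.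
Qed.

Lemma mx_measurable_outer_dev (R : realType) (disp : measure_display)
    (T : measurableType disp) (n d : nat) (X : 'M[R]_(n, d)) (r : T -> 'cV[R]_n) :
  mx_measurable r -> mx_measurable (fun t => outer_dev X (r t)).
Proof.
move=> mr; apply: mx_measurableB; last exact: mx_measurable_cst.
apply: mx_measurableM; first exact: mx_measurable_zvec.
by apply: mx_measurable_tr; exact: mx_measurable_zvec.
Qed.

Lemma mx_measurable_influence (R : realType) (disp : measure_display)
    (T : measurableType disp) (n d : nat) (X : 'M[R]_(n, d)) (y : 'cV[R]_n)
    (lam : R) (r : T -> 'cV[R]_n) :
  mx_measurable r -> mx_measurable (fun t => influence X y lam (r t)).
Proof.
move=> mr; have mz := mx_measurable_zvec X mr.
apply: mx_measurableM; first exact: mx_measurable_cst.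
apply: mx_measurableB; last exact: mx_measurable_cst.
apply: mx_measurableZ => //; apply: measurable_funB; first exact: measurable_uval.
suff h : mx_measurable (fun t => (zvec X (r t))^T *m ridge X y lam) by exact: h.
apply: mx_measurableM; [exact: mx_measurable_tr|exact: mx_measurable_cst].
Qed.

Lemma mx_measurable_boot_ridge (R : realType) (disp : measure_display)
    (T : measurableType disp) (n d m : nat) (X : 'M[R]_(n, d)) (y : 'cV[R]_n)
    (lam : R) (S : T -> 'I_m -> 'cV[R]_n) (v : {ffun 'I_m -> nat}) :
  0 < lam -> (forall i, mx_measurable (fun t => S t i)) ->
  mx_measurable (fun t => boot_ridge X y lam (S t) v).
Proof.
move=> lam0 mS; have mz i := mx_measurable_zvec X (mS i).
apply: mx_measurableM.
  apply: mx_measurable_inv => [t|].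
    by apply: psd_shift_unit => // u; apply: psd_sum.
  apply: mx_measurableD; last exact: mx_measurable_cst.
  apply: mx_measurableZ => //; apply: mx_measurable_sum => i.
  apply: mx_measurableZ => //; apply: mx_measurableM => //.
  exact: mx_measurable_tr.
apply: mx_measurableZ => //; apply: mx_measurable_sum => i.
apply: mx_measurableZ => //; apply: mx_measurableZ => //.
exact: measurable_uval.
Qed.

Lemma measurable_boot_error (R : realType) (disp : measure_display)
    (T : measurableType disp) (n d m : nat) (X : 'M[R]_(n, d)) (y : 'cV[R]_n)
    (lam : R) (S : T -> 'I_m -> 'cV[R]_n) (v : {ffun 'I_m -> nat}) :
  0 < lam -> (forall i, mx_measurable (fun t => S t i)) ->
  measurable_fun setT (fun t => boot_error X y lam (S t) v).
Proof.
move=> lam0 mS.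
apply: (measurable_frobenius (U := fun t => boot_ridge X y lam (S t) v -
  sketched_ridge X y lam (S t))) => a.
apply: (@mx_measurableB R _ T d 1); first exact: mx_measurable_boot_ridge.
rewrite (_ : (fun t => _) = fun t => boot_ridge X y lam (S t) [ffun=> 1%N]).
  exact: mx_measurable_boot_ridge.
by apply/funext => t; rewrite sketched_ridgeE.
Qed.

Lemma measurable_sketched_error (R : realType) (disp : measure_display)
    (T : measurableType disp) (n d m : nat) (X : 'M[R]_(n, d)) (y : 'cV[R]_n)
    (lam : R) (S : T -> 'I_m -> 'cV[R]_n) (b : 'cV[R]_d) :
  0 < lam -> (forall i, mx_measurable (fun t => S t i)) ->
  measurable_fun setT (fun t => frobenius (sketched_ridge X y lam (S t) - b)).
Proof.
move=> lam0 mS.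
apply: (measurable_frobenius (U := fun t => sketched_ridge X y lam (S t) - b)) => a.
apply: (@mx_measurableB R _ T d 1); last exact: mx_measurable_cst.
rewrite (_ : (fun t => _) = fun t => boot_ridge X y lam (S t) [ffun=> 1%N]).
  exact: mx_measurable_boot_ridge.
by apply/funext => t; rewrite sketched_ridgeE.
Qed.

(** * Means of matrices and of influence vectors *)

Lemma expectationE (R : realType) (disp : measure_display)
    (T : measurableType disp) (P : probability T R) (f : T -> R) :
  L1 P f -> ('E_P[f] = (mean P f)%:E)%E.
Proof. by move=> Lf; rewrite unlock; exact: meanE. Qed.

Lemma has_mx_meanP (R : realType) (disp : measure_display)
    (T : measurableType disp) (P : probability T R) (p q : nat)
    (M : T -> 'M[R]_(p, q)) (A : 'M[R]_(p, q)) :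
  has_mx_mean P M A <-> (forall i j, L1 P (fun t => M t i j) /\
    mean P (fun t => M t i j) = A i j).
Proof.
split=> h i j; have [h1 h2] := h i j; split=> //.
  by apply: EFin_inj; rewrite -h2 expectationE.
by rewrite expectationE // h2.
Qed.

Lemma has_mx_mean_mul (R : realType) (disp : measure_display)
    (T : measurableType disp) (P : probability T R) (p q r u : nat)
    (M : T -> 'M[R]_(p, q)) (A : 'M[R]_(p, q))
    (L : 'M[R]_(r, p)) (N : 'M[R]_(q, u)) :
  has_mx_mean P M A -> has_mx_mean P (fun t => L *m M t *m N) (L *m A *m N).
Proof.
move=> /has_mx_meanP h; apply/has_mx_meanP => i j.
have E (B : 'M[R]_(p, q)) : (L *m B *m N) i j =
    \sum_k \sum_l (L i l * N k j) * B l k.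
  rewrite mxE; apply: eq_bigr => k _; rewrite mxE mulr_suml.
  by apply: eq_bigr => l _; ring.
rewrite (_ : (fun t => _) = fun t => \sum_k \sum_l (L i l * N k j) * M t l k);
  last by apply/funext => t; exact: E.
have s1 k l : L1 P (fun t => (L i l * N k j) * M t l k).
  by apply: L1Z; have [] := h l k.
have s2 k : L1 P (fun t => \sum_l (L i l * N k j) * M t l k) by apply: L1_sum.
split; first exact: L1_sum.
rewrite mean_sum // E; apply: eq_bigr => k _.
rewrite mean_sum //; apply: eq_bigr => l _.
by have [hl hm] := h l k; rewrite meanZ // hm.
Qed.

Lemma has_mx_meanD (R : realType) (disp : measure_display)
    (T : measurableType disp) (P : probability T R) (p q : nat)
    (M N : T -> 'M[R]_(p, q)) (A B : 'M[R]_(p, q)) :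
  has_mx_mean P M A -> has_mx_mean P N B ->
  has_mx_mean P (fun t => M t + N t) (A + B).
Proof.
move=> /has_mx_meanP hM /has_mx_meanP hN; apply/has_mx_meanP => i j.
have [m1 m2] := hM i j; have [n1 n2] := hN i j.
rewrite (_ : (fun t => _) = fun t => M t i j + N t i j).
  by rewrite mxE meanD // m2 n2; split=> //; exact: L1D.
by apply/funext => t; rewrite mxE.
Qed.

Lemma has_mx_mean_cst (R : realType) (disp : measure_display)
    (T : measurableType disp) (P : probability T R) (p q : nat)
    (A : 'M[R]_(p, q)) : has_mx_mean P (fun=> A) A.
Proof.
by apply/has_mx_meanP => i j; rewrite mean_cst; split=> //; exact: L1_cst.
Qed.

(** Two design matrices are allowed so that one computation covers the Gram matrix ([Y = X]) and,
    with a single column [y], the cross moment. *)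
Lemma isotropic_outer (R : realType) (disp : measure_display)
    (T : measurableType disp) (P : probability T R) (n p q : nat)
    (X : 'M[R]_(n, p)) (Y : 'M[R]_(n, q)) (r : T -> 'cV[R]_n) :
  isotropic P r ->
  has_mx_mean P (fun t => zvec X (r t) *m (zvec Y (r t))^T)
    (n%:R^-1 *: (X^T *m Y)).
Proof.
move=> iso; have := has_mx_mean_mul (n%:R^-1 *: X^T) Y iso.
rewrite mulmx1 -scalemxAl; congr has_mx_mean; apply/funext => t.
rewrite /zvec linearZ /= -scalemxAr -!scalemxAl scalerA -expr2 exprVn.
by rewrite sqr_sqrtr // trmx_mul trmxK !mulmxA.
Qed.

Lemma outer_dev_mean (R : realType) (disp : measure_display)
    (T : measurableType disp) (P : probability T R) (n d : nat)
    (X : 'M[R]_(n, d)) (r : T -> 'cV[R]_n) :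
  isotropic P r -> has_mx_mean P (fun t => outer_dev X (r t)) 0.
Proof.
move=> iso; rewrite -(subrr (gram X)).
by apply: has_mx_meanD; [exact: isotropic_outer|exact: has_mx_mean_cst].
Qed.

Lemma cross_dev_mean (R : realType) (disp : measure_display)
    (T : measurableType disp) (P : probability T R) (n d : nat)
    (X : 'M[R]_(n, d)) (y : 'cV[R]_n) (r : T -> 'cV[R]_n) :
  isotropic P r ->
  has_mx_mean P (fun t => uval y (r t) *: zvec X (r t) - cross X y) 0.
Proof.
move=> iso; rewrite -(subrr (cross X y)).
apply: has_mx_meanD; last exact: has_mx_mean_cst.
have := isotropic_outer X y iso; congr has_mx_mean; apply/funext => t.
apply/matrixP => i j; rewrite (ord1 j) !mxE big_ord1 !mxE mulrC; congr (_ * _).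
by rewrite /uval mxE.
Qed.

(** The normal equation gives [gram X *m beta = cross X y - lam *: beta], which absorbs the penalty.
    The influence vector becomes linear in the two centred deviations whose fourth moments are
    assumed bounded. *)
Lemma influenceE (R : realType) (n d : nat) (X : 'M[R]_(n, d)) (y : 'cV[R]_n)
    (lam : R) (x : 'cV[R]_n) :
  0 < lam -> influence X y lam x = resolvent (gram X) lam *m
    ((uval y x *: zvec X x - cross X y) - outer_dev X x *m ridge X y lam).
Proof.
move=> lam0; rewrite /influence /outer_dev; congr (_ *m _).
have E : gram X *m ridge X y lam = cross X y - lam *: ridge X y lam.
  rewrite -[cross X y](mulKVmx (gram_shift_unit X lam0)) -/(resolvent _ _).
  by rewrite -/(ridge X y lam) mulmxDl mul_scalar_mx addrK.
rewrite mulmxBl E scalerBl -mulmxA.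
have -> : zvec X x *m ((zvec X x)^T *m ridge X y lam) =
    ((zvec X x)^T *m ridge X y lam) 0 0 *: zvec X x.
  by apply/matrixP => k l; rewrite (ord1 l) mxE big_ord1 [RHS]mxE mulrC.
have aux (a b c e : 'cV[R]_d) : a - b - e = a - c - (b - (c - e)).
  by apply/matrixP => k l; rewrite !mxE; ring.
exact: aux.
Qed.

Lemma influence_mean (R : realType) (disp : measure_display)
    (T : measurableType disp) (P : probability T R) (n d : nat)
    (X : 'M[R]_(n, d)) (y : 'cV[R]_n) (lam : R) (r : T -> 'cV[R]_n) :
  0 < lam -> isotropic P r ->
  has_mx_mean P (fun t => influence X y lam (r t)) 0.
Proof.
move=> lam0 iso.
have hu := cross_dev_mean X y iso; have hz := outer_dev_mean X iso.
have h1 := has_mx_mean_mul (resolvent (gram X) lam) (1%:M) hu.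
have h2 := has_mx_mean_mul (- resolvent (gram X) lam) (ridge X y lam) hz.
have := has_mx_meanD h1 h2; rewrite !mulmx0 !mul0mx addr0.
congr has_mx_mean; apply/funext => t.
rewrite influenceE // [RHS]mulmxBr mulmx1 !mulNmx; congr (_ - _).
exact: esym (mulmxA _ _ _).
Qed.

(** Products of two different centred rows have mean zero by independence, so only the [m] squares
    survive. *)
Lemma row_sum_sq_mean (R : realType) (disp : measure_display)
    (T : measurableType disp) (P : probability T R) (n m : nat)
    (s : 'I_m -> T -> 'cV[R]_n) (phi : 'cV[R]_n -> R) (v : R) :
  iid_rows P s ->
  measurable_fun (setT : set (g_sigma_algebraType (@open 'cV[R]_n))) phi ->
  (forall i, L1 P (fun t => phi (s i t) ^+ 2)) ->
  (forall i, mean P (fun t => phi (s i t)) = 0) ->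
  (forall i, mean P (fun t => phi (s i t) ^+ 2) <= v) ->
  L1 P (fun t => (\sum_i phi (s i t)) ^+ 2) /\
  mean P (fun t => (\sum_i phi (s i t)) ^+ 2) <= m%:R * v.
Proof.
move=> iid mphi L2 m0 hv.
have mrow i := measurable_row i iid mphi.
have Lphi i : L1 P (fun t => phi (s i t)).
  apply: L1_le (mrow i) (L1D (L1_cst P 1) (L2 i)) _ => t.
  rewrite -[phi (s i t) ^+ 2](real_normK (num_real _)).
  have := normr_ge0 (phi (s i t)); nra.
have cross i j : j != i -> L1 P (fun t => phi (s i t) * phi (s j t)) /\
    mean P (fun t => phi (s i t) * phi (s j t)) = 0.
  move=> /eqP ji.
  have mi : measurable_fun (setT : set (g_sigma_algebraType (rows_sigma s [set~ j])))
      (phi \o s i).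
    by apply: measurable_row_comp => // ij; apply: ji.
  have [h1 h2] := row_indep_mean iid mi mphi (Lphi i) (Lphi j).
  by split=> //; rewrite h2 [X in X * _]m0 mul0r.
have Lij i j : L1 P (fun t => phi (s i t) * phi (s j t)).
  have [->|ji] := eqVneq j i; last by have [] := cross i j ji.
  exact: L2.
have E : (fun t => (\sum_i phi (s i t)) ^+ 2) =
    fun t => \sum_i \sum_j phi (s i t) * phi (s j t).
  apply/funext => t; rewrite expr2 mulr_suml; apply: eq_bigr => i _.
  by rewrite mulr_sumr.
rewrite E; have Ls i : L1 P (fun t => \sum_j phi (s i t) * phi (s j t)).
  by apply: L1_sum => j _.
split; first by apply: L1_sum.
rewrite mean_sum // mulr_natl -[X in v *+ X]card_ord -sumr_const.
apply: ler_sum => i _; rewrite mean_sum // (bigD1 i) //= big1 ?addr0; first exact: hv.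
by move=> j ji; have [] := cross i j ji.
Qed.

(** * Part (a) *)

Lemma prod_weights_sum1 (R : realType) (m B : nat) : (0 < m)%N ->
  \sum_(f : {ffun 'I_B -> {ffun 'I_m -> 'I_m.+1}})
    \prod_b multinomial_pmf R (weight (f b)) = 1.
Proof.
move=> m0; rewrite -(bigA_distr_bigA (fun (b : 'I_B) v => multinomial_pmf R (weight v))).
by rewrite big1 // => b _; exact: multinomial_sum1.
Qed.

Lemma weight_inj (m : nat) : injective (@weight m).
Proof.
move=> v v' /ffunP h; apply/ffunP => i; apply/val_inj.
by have := h i; rewrite !ffunE.
Qed.

(** The conditional mass function is a constant, so integrating it over a sketch event [D] gives a
    product: the weights are independent of the sketch. *)
Lemma boot_weights_indep (R : realType) (disp : measure_display)
    (T : measurableType disp) (P : probability T R) (n m B : nat)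
    (s : 'I_m -> T -> 'cV[R]_n) (w : 'I_B -> T -> {ffun 'I_m -> nat})
    (v : 'I_B -> {ffun 'I_m -> nat}) (D : set T) :
  iid_rows P s -> boot_weights P s w -> sketch_sigma s D ->
  P ([set t | forall b, w b t = v b] `&` D) =
  ((\prod_b multinomial_pmf R (v b))%:E * P D)%E.
Proof.
move=> iid [_ hw] sD; have [_ _ h] := hw v.
have mD : measurable D.
  by apply: (rows_sigma_measurable (J := setT) iid); rewrite -sketch_sigmaE.
by rewrite -h // integral_cst.
Qed.

(** Weight vectors form a countable type, which makes the event a countable union over the values of
    [w]. *)
Lemma measurable_weights_event (R : realType) (disp : measure_display)
    (T : measurableType disp) (P : probability T R) (n m B : nat)
    (s : 'I_m -> T -> 'cV[R]_n) (w : 'I_B -> T -> {ffun 'I_m -> nat})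
    (G : ('I_B -> {ffun 'I_m -> nat}) -> set T) :
  iid_rows P s -> boot_weights P s w -> (forall v, sketch_sigma s (G v)) ->
  measurable [set t | G (w^~ t) t].
Proof.
move=> iid [mw _] mG.
have mGT v : measurable (G v).
  by apply: (rows_sigma_measurable (J := setT) iid); rewrite -sketch_sigmaE.
rewrite (_ : [set t | _] = \bigcup_(f : {ffun 'I_B -> {ffun 'I_m -> nat}})
   (\bigcap_(b in [set: 'I_B]) [set t | w b t = f b] `&` G f)).
  apply: countable_bigcupT_measurable => // f; apply: measurableI => //.
  by apply: fin_bigcap_measurable => // b _; exact: mw.
apply/seteqP; split=> t /=.
  move=> Gt; exists [ffun b => w b t] => //; split=> [b _ /=|]; first by rewrite ffunE.
  by rewrite (_ : fun_of_fin _ = w^~ t) //; apply/funext => b; rewrite ffunE.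
move=> [f _ [/= wf Gf]]; rewrite (_ : w^~ t = f) //.
by apply/funext => b; exact: wf.
Qed.

(** Fubini between sketch and weights: an event about both becomes the mean, over the sketch, of a
    finite sum over weight vectors. Both parts of the theorem use conditional probabilities in this
    form. *)
Lemma weights_disintegration (R : realType) (disp : measure_display)
    (T : measurableType disp) (P : probability T R) (n m B : nat)
    (s : 'I_m -> T -> 'cV[R]_n) (w : 'I_B -> T -> {ffun 'I_m -> nat})
    (G : ('I_B -> {ffun 'I_m -> nat}) -> set T) (A : set T) :
  (0 < m)%N -> iid_rows P s -> boot_weights P s w ->
  (forall v, sketch_sigma s (G v)) -> sketch_sigma s A ->
  fine (P ([set t | G (w^~ t) t] `&` A)) =
  mean P (fun t => \sum_(f : {ffun 'I_B -> {ffun 'I_m -> 'I_m.+1}})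
    (\prod_b multinomial_pmf R (weight (f b))) *
    (\1_(G (fun b => weight (f b))) t * \1_A t)).
Proof.
move=> m0 iid bw mG mA.
have up := rows_sigma_measurable (J := setT) iid.
have upT D : sketch_sigma s D -> measurable D by rewrite sketch_sigmaE => /up.
have sI D D' : sketch_sigma s D -> sketch_sigma s D' -> sketch_sigma s (D `&` D').
  exact: (@measurableI _ (g_sigma_algebraType _) D D').
have mW f : measurable [set t | forall b, w b t = f b].
  rewrite (_ : [set t | _] = \bigcap_(b in [set: 'I_B]) [set t | w b t = f b]).
    by apply: fin_bigcap_measurable => // b _; have [mw _] := bw; exact: mw.
  by apply/seteqP; split=> t /= h b => [_|]; exact: h.
pose W f := [set t | forall b, w b t = weight (f b)].
pose F := {ffun 'I_B -> {ffun 'I_m -> 'I_m.+1}}.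
have PW (f : F) D : sketch_sigma s D ->
   mean P (fun t => \1_(W f) t * \1_D t) =
   (\prod_b multinomial_pmf R (weight (f b))) * fine (P D).
  move=> sD; rewrite (_ : (fun t => _) = \1_(W f `&` D)); last by rewrite indicI.
  rewrite mean_indic; last by apply: measurableI; [exact: mW|exact: upT].
  rewrite (boot_weights_indep _ iid bw sD) fineM ?fin_num_measure //.
  exact: upT.
have LW (f : F) D : sketch_sigma s D -> L1 P (fun t => \1_(W f) t * \1_D t).
  move=> sD; rewrite (_ : (fun t => _) = \1_(W f `&` D)); last by rewrite indicI.
  by apply: integrable_indic; apply: measurableI; [exact: mW|exact: upT].
have sT : sketch_sigma s setT by exact: (@measurableT _ (g_sigma_algebraType _)).
set Ev := [set t | G (w^~ t) t] `&` A.
have mEv : measurable Ev.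
  by apply: measurableI; [exact: (measurable_weights_event iid bw)|exact: upT].
pose Gf (f : F) := G (fun b => weight (f b)).
have sGA f : sketch_sigma s (Gf f `&` A) := sI _ _ (mG _) mA.
(* [S0] indicates that the weights lie in the capped range, and [S1] that the event occurs as
   well. *)
pose S1 t : R := \sum_(f : F) \1_(W f) t * \1_(Gf f `&` A) t.
pose S0 t : R := \sum_(f : F) \1_(W f) t * \1_setT t.
have key t : S1 t = \1_Ev t /\ S0 t = 1 \/ S1 t = 0 /\ S0 t = 0.
  have [[f Wf]|nW] := pselect (exists f : F, W f t).
    have off g : g != f -> \1_(W g) t = 0 :> R.
      move=> gf; rewrite indicE memNset // => Wg.
      case/eqP: gf; apply/ffunP => b; apply: weight_inj.
      by rewrite -(Wf b) -(Wg b).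
    have D1 (H : F -> R) : \sum_(g : F) \1_(W g) t * H g = H f.
      rewrite (bigD1 f) //= big1 => [|g /off ->]; last by rewrite mul0r.
      by rewrite addr0 indicE (mem_set Wf) mul1r.
    left; rewrite /S1 /S0 (D1 (fun g => \1_(Gf g `&` A) t)) (D1 (fun=> \1_setT t)).
    rewrite !indicE in_setT; split=> //.
    have E : (t \in Ev) = (t \in Gf f `&` A).
      have wE : w^~ t = (fun b => weight (f b)) by apply/funext => b; rewrite Wf.
      apply/idP/idP => /set_mem [h1 h2]; apply/mem_set; split=> //.
        by rewrite /Gf -wE.
      by rewrite /= wE.
    by rewrite E.
  right; rewrite /S1 /S0 !big1 // => f _; rewrite indicE memNset ?mul0r // => Wf;
  by apply: nW; exists f.
have LS1 : L1 P S1 by apply: L1_sum => f _; exact: LW.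
have LS0 : L1 P S0 by apply: L1_sum => f _; exact: LW.
have mS0 : mean P S0 = 1.
  rewrite mean_sum; last by move=> f _; exact: LW.
  under eq_bigr do rewrite PW // probability_setT mulr1.
  exact: prod_weights_sum1.
have LEv : L1 P \1_Ev by exact: integrable_indic.
have -> : fine (P Ev) = mean P S1.
  rewrite -mean_indic //; apply/eqP; rewrite eq_le; apply/andP; split.
    (* The indicator of the event exceeds [S1] by at most [1 - S0], which has mean zero because the
       capped vectors carry the full mass. *)
    apply: (@le_trans _ _ (mean P (fun t => S1 t + (1 - S0 t)))).
      apply: mean_le => //; first by apply: L1D => //; apply: L1B => //; exact: L1_cst.
      move=> t; case: (key t) => -[-> ->]; first by rewrite subrr addr0.
      by rewrite add0r subr0 indicE; case: (_ \in _).
    rewrite meanD //; last by apply: L1B => //; exact: L1_cst.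
    by rewrite meanB //; [rewrite mean_cst mS0 subrr addr0|exact: L1_cst].
  by apply: mean_le => // t; case: (key t) => -[-> _].
have LGA f : L1 P (fun t => \1_(Gf f) t * \1_A t).
  rewrite (_ : (fun t => _) = \1_(Gf f `&` A)); last by rewrite indicI.
  by apply: integrable_indic; exact: upT.
rewrite !mean_sum; last 2 first.
- by move=> f _; apply: L1Z; exact: LGA.
- by move=> f _; exact: LW.
apply: eq_bigr => f _; rewrite PW // meanZ; last exact: LGA.
congr (_ * _); rewrite -mean_indic; last exact: upT.
by rewrite indicI.
Qed.

Lemma measurable_lt_set (R : realType) (disp : measure_display)
    (T : measurableType disp) (f g : T -> R) :
  measurable_fun setT f -> measurable_fun setT g ->
  measurable [set t | f t < g t].
Proof.
move=> mf mg; rewrite (_ : [set t | _] = (g \- f) @^-1` `]0, +oo[).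
  by rewrite -[X in measurable X]setTI; exact: measurable_funB.
by apply/seteqP; split=> t /=; rewrite in_itv /= andbT subr_gt0.
Qed.

Lemma measurable_le_set (R : realType) (disp : measure_display)
    (T : measurableType disp) (f g : T -> R) :
  measurable_fun setT f -> measurable_fun setT g ->
  measurable [set t | f t <= g t].
Proof.
move=> mf mg; rewrite (_ : [set t | _] = (g \- f) @^-1` `[0, +oo[).
  by rewrite -[X in measurable X]setTI; exact: measurable_funB.
by apply/seteqP; split=> t /=; rewrite in_itv /= andbT subr_ge0.
Qed.

Lemma measurable_half_line (R : realType) (x : R) :
  measurable [set z : R | (z <= x)%R].
Proof. exact: measurable_le_set. Qed.

Lemma mc_bound_coverage (R : realType) (V : finType) (B : nat)
    (alpha delta r : R) (pi : V -> R) (e : V -> R) :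
  0 < alpha < 1 -> 0 < delta -> (forall v, 0 <= pi v) -> \sum_v pi v = 1 ->
  \sum_(v | (e v < r)%R) pi v <= 1 - alpha ->
  1 - delta <= \sum_(f : {ffun 'I_B -> V}) (\prod_b pi (f b)) *
     (r%:E <= mc_bound alpha delta (fun b => e (f b)))%E%:R.
Proof.
move=> /andP[a0 a1] d0 pi0 pi1 le_p; rewrite /mc_bound.
case rk : (mc_rank B (1 - alpha) delta) => [k|].
  have p01 : 0 <= 1 - alpha <= 1 by apply/andP; split; lra.
  have := order_stat_coverage p01 rk pi0 pi1 le_p.
  by under [in X in _ -> X]eq_bigr do rewrite lee_fin.
under eq_bigr do rewrite leey mulr1.
rewrite -(bigA_distr_bigA (fun (b : 'I_B) v => pi v)) big1; last by move=> b _.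
lra.
Qed.

(** For a finite rank the event says that fewer than [k] errors lie below [q], a condition on a sum
    of indicators. *)
Lemma measurable_mc_bound_ge (R : realType) (disp : measure_display)
    (T : measurableType disp) (B : nat) (alpha delta : R) (q : T -> R)
    (e : 'I_B -> T -> R) :
  0 < alpha < 1 -> measurable_fun setT q ->
  (forall b, measurable_fun setT (e b)) ->
  measurable [set t | ((q t)%:E <= mc_bound alpha delta (e^~ t))%E].
Proof.
move=> /andP[a0 a1] mq me; rewrite /mc_bound.
case rk : (mc_rank B (1 - alpha) delta) => [k|]; last first.
  by rewrite (_ : [set t | _] = setT) //; apply/seteqP; split=> // t _ /=; rewrite leey.
have p01 : 0 <= 1 - alpha <= 1 by apply/andP; split; lra.
have [k0 kB _] := mc_rankP p01 rk.
pose N t : R := \sum_b \1_[set t | e b t < q t] t.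
have mN : measurable_fun setT N.
  apply: measurable_sum => b; apply: measurable_indic.
  exact: measurable_lt_set.
have NE t : N t = #|[set b | (e b t < q t)%R]%SET|%:R.
  rewrite -sum1_card natr_sum [RHS]big_mkcond; apply: eq_bigr => b _.
  have E : (t \in [set t | e b t < q t]) = (e b t < q t).
    by apply/idP/idP => [/set_mem|h] //; exact: mem_set.
  by rewrite indicE E inE; case: (e b t < q t).
rewrite (_ : [set t | _] = N @^-1` `]-oo, k%:R[).
  by rewrite -[X in measurable X]setTI; exact: mN.
by apply/seteqP; split=> t /=; rewrite lee_fin in_itv /= leNgt order_stat_lt //
  -ltnNge NE ltr_nat.
Qed.

(** A distribution function is monotone, so the quantile is below [c] exactly when some rational in
    [0, c) already reaches level [p]; this is a countable union. *)
Lemma quantile_measurable (R : realType) (disp : measure_display)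
    (T : measurableType disp) (kappa : T -> probability R R) (p : R) :
  p < 1 ->
  (forall U, measurable U -> measurable_fun setT (fun t => fine (kappa t U))) ->
  measurable_fun setT (fun t => quantile (kappa t) p).
Proof.
move=> p1 mk.
(* The infimum of an empty set would be a default value. Nonemptiness holds because the distribution
   function tends to 1 along the integers and [p < 1]. *)
have ne t : [set x : R | 0 <= x /\ (p%:E <= kappa t [set z : R | (z <= x)%R])%E] !=set0.
  apply: contrapT => h.
  pose F (n : nat) := [set z : R | z <= n%:R].
  have mF n : measurable (F n).
    exact: measurable_half_line.
  have UF : \bigcup_n F n = setT.
    apply/seteqP; split=> // z _; exists (Num.bound `|z|) => //=.
    by rewrite /F /= (le_trans (ler_norm z)) // ltW // archi_boundP.
  have cv : (kappa t \o F) x @[x --> \oo] --> kappa t (\bigcup_n F n).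
    apply: nondecreasing_cvg_mu => //; first by rewrite UF.
    by move=> a b ab; apply/subsetPset => z /= /le_trans; apply; rewrite ler_nat.
  have := cvg_lim (@ereal_hausdorff R) cv; rewrite UF probability_setT => lim1.
  suff : (lim ((kappa t \o F) x @[x --> \oo]) <= p%:E)%E.
    by rewrite lim1 lee_fin; lra.
  apply: lime_le; first by apply/cvg_ex; eexists; exact: cv.
  near=> n; rewrite /= leNgt; apply/negP => /ltW pn; apply: h.
  by exists n%:R; split.
have lb t : has_lbound [set x : R | 0 <= x /\ (p%:E <= kappa t [set z : R | (z <= x)%R])%E].
  by exists 0 => x [].
apply: (measurability _ (RGenInftyO.measurableE R)) => //.
move=> _ [_ [c ->] <-]; rewrite setTI.
rewrite (_ : _ @^-1` _ = \bigcup_(r : rat)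
   (if 0 <= ratr r :> R then if ratr r < c then
     (fun t => fine (kappa t [set z : R | (z <= ratr r)%R])) @^-1` `[p, +oo[
    else set0 else set0)).
  apply: countable_bigcupT_measurable => // r.
  case: ifP => // _; case: ifP => // _; rewrite -[X in measurable X]setTI.
  apply: mk => //.
  exact: measurable_half_line.
have fineE t (x : R) : (p <= fine (kappa t [set z : R | (z <= x)%R]))%R =
    (p%:E <= kappa t [set z : R | (z <= x)%R])%E.
  rewrite -lee_fin fineK // fin_num_measure //.
  exact: measurable_half_line.
apply/seteqP; split=> t /=.
  rewrite in_itv /= => /(inf_lt (ne t)) [x [x0 px] xc].
  have [r] := rat_in_itvoo xc; rewrite in_itv /= => /andP[xr rc].
  exists r => //; rewrite (le_trans x0 (ltW xr)) rc /= in_itv /= andbT fineE.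
  apply: (le_trans px); apply: le_measure; rewrite ?inE.
  - exact: measurable_half_line.
  - exact: measurable_half_line.
  - by move=> z /= zx; rewrite (le_trans zx) // ltW.
move=> [r _]; case: ifP => // r0; case: ifP => // rc.
rewrite /= !in_itv /= andbT fineE => pr; apply: le_lt_trans rc.
by apply: ge_inf.
Unshelve. all: by end_near.
Qed.

Lemma L1_mul_indic (R : realType) (disp : measure_display)
    (T : measurableType disp) (P : probability T R) (f : T -> R) (A : set T) :
  measurable A -> L1 P f -> L1 P (fun t => f t * \1_A t).
Proof.
move=> mA Lf; apply: L1_le (L1_norm Lf) _.
  by apply: measurable_funM; [exact: L1_measurable Lf|exact: measurable_indic].
move=> t; rewrite normrM indicE; case: (t \in A).
  by rewrite normr1 mulr1.
by rewrite normr0 mulr0.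
Qed.

(** The inequality is tested on the exceptional set itself. There [g - f] is positive but its
    integral is at most 0, so the set is negligible. *)
Lemma ae_le_of_mean (R : realType) (disp : measure_display)
    (T : measurableType disp) (P : probability T R) (f g : T -> R) :
  L1 P f -> L1 P g ->
  mean P (fun t => g t * \1_[set t | f t < g t] t) <=
    mean P (fun t => f t * \1_[set t | f t < g t] t) ->
  {ae P, forall t, g t <= f t}.
Proof.
move=> Lf Lg le_fg; set N := [set t | f t < g t] in le_fg *.
have mf := L1_measurable Lf; have mg := L1_measurable Lg.
have mN : measurable N by exact: measurable_lt_set.
have LN (h : T -> R) := L1_mul_indic (f := h) (P := P) mN.
pose h t := g t * \1_N t - f t * \1_N t.
have Lh : L1 P h by apply: L1B; exact: LN.
have h0 t : 0 <= h t.
  rewrite /h -mulrBl indicE; case tN : (t \in N); last by rewrite mulr0.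
  by rewrite mulr1 subr_ge0 ltW //; have := set_mem tN.
have mh0 : mean P h = 0.
  apply/eqP; rewrite eq_le mean_ge0 // andbT /h meanB ?subr_le0 //; exact: LN.
have : (\int[P]_(x in setT) `|(EFin \o h) x| = 0)%E.
  under eq_integral => x _ do rewrite /= ger0_norm //.
  by rewrite (meanE Lh) mh0.
move=> /(ae_eq_integral_abs P measurableT (measurable_int _ Lh)).
apply: filterS => t /(_ I) /= [ht0].
rewrite leNgt; apply/negP => fg.
by move: ht0; rewrite /h indicE mem_set //= !mulr1 => /eqP; rewrite subr_eq0 gt_eqF.
Qed.

Lemma integral_setI_mean (R : realType) (disp : measure_display)
    (T : measurableType disp) (P : probability T R) (f : T -> R) (A : set T) :
  measurable A -> L1 P f ->
  (\int[P]_(t in A) (f t)%:E = (mean P (fun t => f t * \1_A t))%:E)%E.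
Proof.
move=> mA Lf; have LA := L1_mul_indic mA Lf.
rewrite integral_mkcond -(meanE LA); apply: eq_integral => t _.
by rewrite patchE indicE; case: (t \in A); rewrite ?mulr1 ?mulr0.
Qed.

Lemma prod_weights_marginal (R : realType) (m B : nat) (b0 : 'I_B)
    (h : {ffun 'I_m -> 'I_m.+1} -> R) :
  (0 < m)%N ->
  \sum_(f : {ffun 'I_B -> {ffun 'I_m -> 'I_m.+1}})
    (\prod_b multinomial_pmf R (weight (f b))) * h (f b0) =
  \sum_v multinomial_pmf R (weight v) * h v.
Proof.
move=> m0.
transitivity (\sum_(f : {ffun 'I_B -> {ffun 'I_m -> 'I_m.+1}})
    \prod_b (if b == b0 then multinomial_pmf R (weight (f b)) * h (f b)
             else multinomial_pmf R (weight (f b)))).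
  apply: eq_bigr => f _; rewrite (bigD1 b0) //= [RHS](bigD1 b0) //= eqxx.
  rewrite mulrAC; congr (_ * _); apply: eq_bigr => b /negbTE -> //.
rewrite -(bigA_distr_bigA (fun (b : 'I_B) v => if b == b0 then
   multinomial_pmf R (weight v) * h v else multinomial_pmf R (weight v))).
rewrite (bigD1 b0) //= eqxx [X in _ * X]big1 ?mulr1 // => b /negbTE ->.
exact: multinomial_sum1.
Qed.

Lemma sketch_mx_measurable (R : realType) (disp : measure_display)
    (T : measurableType disp) (n m : nat) (s : 'I_m -> T -> 'cV[R]_n) (i : 'I_m) :
  @mx_measurable R _ (g_sigma_algebraType (rows_sigma s setT)) n 1 (s i).
Proof.
move=> a j; rewrite (ord1 j).
exact: (@measurable_row_comp R disp T n m s setT i (fun x => x a 0) I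
  (measurable_row_entry a)).
Qed.

(** The kernel [kappa] is known only through integrals over sketch events. It is compared almost
    everywhere with the explicit finite sum that gives the bootstrap distribution function, after
    which the counting argument applies to each sketch. *)
Theorem bootstrap_bound_coverage (R : realType) (d n m B : nat)
    (hm : (0 < m)%N) (hB : (0 < B)%N) (alpha delta : R)
    (X : 'M[R]_(n, d)) (y : 'cV[R]_n) (lam : R)
    (disp : measure_display) (T : measurableType disp) (P : probability T R)
    (s : 'I_m -> T -> 'cV[R]_n) (w : 'I_B -> T -> {ffun 'I_m -> nat}) :
  0 < alpha < 1 -> 0 < delta < 1 -> 0 < lam ->
  iid_rows P s -> boot_weights P s w ->
  let err (b : 'I_B) (t : T) := boot_error X y lam (s^~ t) (w b t) in
  let eps (t : T) := mc_bound alpha delta (err^~ t) in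
  forall kappa : T -> probability R R,
  cond_law P (sketch_sigma s) (err (Ordinal hB)) kappa ->
  let q (t : T) := quantile (kappa t) (1 - alpha) in
  forall Y : T -> R,
  cond_prob P (sketch_sigma s) [set t | ((q t)%:E <= eps t)%E] Y ->
  {ae P, forall t, 1 - delta <= Y t}.
Proof.
move=> al de lam0 iid bw err eps kappa claw q Y [Ymeas LY Yint].
have /andP[a0 a1] := al; have /andP[d0 d1] := de.
pose T' : measurableType _ := g_sigma_algebraType (rows_sigma s setT).
have up D : sketch_sigma s D -> measurable D.
  by rewrite sketch_sigmaE => /(rows_sigma_measurable iid).
have ms i : @mx_measurable R _ T' n 1 (s i) by exact: sketch_mx_measurable.
have me v : measurable_fun (setT : set T') (fun t => boot_error X y lam (s^~ t) v).
  exact: (@measurable_boot_error R _ T' n d m X y lam (fun t => s^~ t) v lam0 ms).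
have mq : measurable_fun (setT : set T') q.
  apply: (@quantile_measurable R _ T') => [|U mU]; first lra.
  move=> _ V mV; rewrite setTI; have [h _ _] := claw U mU.
  by have := h V mV; rewrite sketch_sigmaE.
pose e v t := boot_error X y lam (s^~ t) (weight v).
have e0 v t : 0 <= e v t by exact: frobenius_ge0.
pose pi v := multinomial_pmf R (@weight m v).
have pi0 v : 0 <= pi v by exact: multinomial_ge0.
have pi1 : \sum_v pi v = 1 by exact: multinomial_sum1.
(* The explicit conditional distribution function of one bootstrap error, obtained by summing the
   multinomial masses. *)
pose cdf t x := \sum_v pi v * \1_[set t | e v t <= x] t.
have mle v (x : R) : measurable ([set t | e v t <= x] : set T').
  by apply: measurable_le_set => //; exact: me.
have mleT v (x : R) : measurable ([set t | e v t <= x] : set T).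
  by apply: up; rewrite sketch_sigmaE; exact: mle.
have Lcdf x : L1 P (cdf^~ x).
  by apply: L1_sum => v _; apply: L1Z; exact: integrable_indic.
pose kap x t := fine (kappa t [set z : R | (z <= x)%R]).
have cdf_kap x : {ae P, forall t, cdf t x <= kap x t}.
  have [km Lk kint] := claw _ (measurable_half_line x).
  apply: ae_le_of_mean => //.
  set N := [set t | kap x t < cdf t x].
  have sN : sketch_sigma s N.
    rewrite sketch_sigmaE; apply: (@measurable_lt_set R _ T').
      by move=> _ V mV; rewrite setTI; have := km V mV; rewrite sketch_sigmaE.
    by apply: (@measurable_sum _ T') => v; apply: measurable_funM.
  have mN := up _ sN.
  have := kint _ sN; rewrite integral_setI_mean //.
  pose G (v : 'I_B -> {ffun 'I_m -> nat}) : set T :=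
    [set t | boot_error X y lam (s^~ t) (v (Ordinal hB)) <= x].
  have sG v : sketch_sigma s (G v).
    by rewrite sketch_sigmaE; apply: (@measurable_le_set R _ T').
  move=> /(congr1 fine); rewrite (weights_disintegration (G := G) hm iid bw sG sN) /=.
  move=> ->; rewrite le_eqVlt; apply/orP; left; apply/eqP; congr mean.
  apply/funext => t; rewrite /cdf mulr_suml.
  transitivity (\sum_v pi v * (\1_[set t | e v t <= x] t * \1_N t)).
    by apply: eq_bigr => v _; rewrite mulrA.
  by rewrite -(prod_weights_marginal (Ordinal hB)
    (fun v => \1_[set t | e v t <= x] t * \1_N t)).
have ae_q : {ae P, forall t, \sum_(v | (e v t < q t)%R) pi v <= 1 - alpha}.
  (* One null set must serve all levels [x], so the comparison is made at rationals only, enumerated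
     by [unpickle]. *)
  have : {ae P, forall t, forall k : nat, if unpickle k is Some r then
      cdf t (ratr r) <= kap (ratr r) t else true}.
    apply/ae_foralln => k; case: (unpickle k) => [r|]; first exact: cdf_kap.
    by apply: aeW.
  apply: filterS => t ht.
  have hr (r : rat) : cdf t (ratr r) <= kap (ratr r) t.
    by have := ht (pickle r); rewrite pickleK.
  have [q0|q0] := leP (q t) 0.
    rewrite big_pred0 => [|v]; first lra.
    by apply/negbTE; rewrite -leNgt; exact: le_trans q0 (e0 _ _).
  (* Finitely many errors lie below the quantile, so their maximum is still strictly below it and a
     rational [r] fits in between. At [r] the kernel has not reached [1 - alpha], by definition of
     the infimum. *)
  pose M := \big[Num.max/0]_(v | (e v t < q t)%R) e v t.
  have M0 : 0 <= M by rewrite /M; elim/big_ind: _ => // a b a0' b0'; rewrite le_max a0'.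
  have Mq : M < q t.
    by rewrite /M; elim/big_ind: _ => // a b; rewrite gt_max => -> ->.
  have [r] := rat_in_itvoo Mq; rewrite in_itv /= => /andP[Mr rq].
  have kr : kap (ratr r) t < 1 - alpha.
    rewrite ltNge; apply/negP => h.
    have : q t <= ratr r.
      apply: ge_inf; first by exists 0 => z [].
      split; first by rewrite (le_trans M0) // ltW.
      rewrite -[leRHS]fineK ?lee_fin //.
      by rewrite fin_num_measure //; exact: measurable_half_line.
    by rewrite leNgt rq.
  apply: le_trans (ltW kr); apply: le_trans (hr r).
  rewrite /cdf [leLHS]big_mkcond; apply: ler_sum => v _.
  case: ifPn => ev; last by rewrite mulr_ge0.
  rewrite indicE mem_set ?mulr1 //=; apply: ltW; apply: le_lt_trans Mr.
  by rewrite /M (bigD1 v) //= le_max lexx.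
(* Integrated over the event where [Y] is too small, the true conditional coverage is at least
   [1 - delta], which makes that event negligible. *)
apply: (@ae_le_of_mean _ _ _ _ Y (fun=> 1 - delta)) => //; first exact: L1_cst.
set N := [set t | Y t < 1 - delta].
have sN : sketch_sigma s N.
  rewrite (_ : N = Y @^-1` `]-oo, 1 - delta[).
    by apply: Ymeas; exact: measurable_itv.
  by apply/seteqP; split=> t /=; rewrite in_itv.
have mN := up _ sN.
have := Yint _ sN; rewrite integral_setI_mean //.
pose G (v : 'I_B -> {ffun 'I_m -> nat}) : set T := [set t |
   ((q t)%:E <= mc_bound alpha delta (fun b => boot_error X y lam (s^~ t) (v b)))%E].
have sG v : sketch_sigma s (G v).
  rewrite sketch_sigmaE.
  exact: (@measurable_mc_bound_ge R _ T' B alpha delta q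
    (fun b t => boot_error X y lam (s^~ t) (v b)) al mq (fun b => me (v b))).
have -> : [set t | ((q t)%:E <= eps t)%E] = [set t | G (w^~ t) t] by [].
move=> /(congr1 fine); rewrite (weights_disintegration (G := G) hm iid bw sG sN) /= => ->.
have LG f : L1 P (fun t => \1_(G f) t * \1_N t).
  rewrite (_ : (fun t => _) = \1_(G f `&` N)); last by rewrite indicI.
  by apply: integrable_indic; apply: measurableI => //; exact: up.
set F := fun t => \sum_(f : {ffun 'I_B -> {ffun 'I_m -> 'I_m.+1}}) _.
have LF : L1 P F by apply: L1_sum => f _; apply: L1Z; exact: LG.
have LN : L1 P (fun t => (1 - delta) * \1_N t) by apply: L1Z; exact: integrable_indic.
rewrite -lee_fin -!meanE //; apply: ae_ge0_le_integral => //.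
- by move=> t _; rewrite lee_fin mulr_ge0 //; lra.
- by have := measurable_int _ LN.
- move=> t _; rewrite lee_fin sumr_ge0 // => f _.
  by apply: mulr_ge0; [apply: prodr_ge0 => b _; exact: pi0|apply: mulr_ge0].
- by have := measurable_int _ LF.
apply: filterS ae_q => t ht _; rewrite lee_fin /F.
have := mc_bound_coverage B al d0 pi0 pi1 ht.
rewrite indicE; case tN : (t \in N); last first.
  by rewrite mulr0 sumr_ge0 // => f _; rewrite !mulr0.
rewrite mulr1 => /le_trans; apply; apply: ler_sum => f _.
rewrite mulr1n mulr1; apply: ler_wpM2l; first by apply: prodr_ge0 => b _; exact: pi0.
rewrite indicE ler_nat.
case h : (_ <= _)%E => //; rewrite mem_set //.
Qed.

(** * Comparison of the error and of its bootstrap *)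

Lemma smooth_lin (R : realType) (d : nat) (C C' c : R) (f g : 'cV[R]_d -> R) :
  smooth C f -> smooth C' g -> smooth (C + `|c| * C') (fun x => f x + c * g x).
Proof.
move=> [l [q [[f1 l1 q1 t1] [mf ml mq]]]] [l' [q' [[f2 l2 q2 t2] [mg ml' mq']]]].
have bnd (u v : R) : `|u| <= C -> `|v| <= C' -> `|u + c * v| <= C + `|c| * C'.
  move=> hu hv; apply: le_trans (ler_normD _ _) _.
  by rewrite normrM lerD // ler_wpM2l.
have md (F G : 'cV[R]_d -> R) : coord_measurable F -> coord_measurable G ->
    coord_measurable (fun x => F x + c * G x).
  move=> hF hG disp T U mU; apply: measurable_funD; first exact: hF.
  by apply: measurable_funM => //; exact: hG.
exists (fun a x => l a x + c * l' a x), (fun a b x => q a b x + c * q' a b x).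
split; last by split=> *; apply: md.
split=> [x|a x|a b x|x h]; [exact: bnd|exact: bnd|exact: bnd|]; set r := (X in `|X|).
have -> : r = (f (x + h) - (f x + \sum_a l a x * h a 0 +
      \sum_a \sum_b q a b x * (h a 0 * h b 0))) +
    c * (g (x + h) - (g x + \sum_a l' a x * h a 0 +
      \sum_a \sum_b q' a b x * (h a 0 * h b 0))).
  rewrite /r.
  have -> : \sum_a (l a x + c * l' a x) * h a 0 =
     \sum_a l a x * h a 0 + c * \sum_a l' a x * h a 0.
    by rewrite mulr_sumr -big_split; apply: eq_bigr => a _ /=; ring.
  have -> : \sum_a \sum_b (q a b x + c * q' a b x) * (h a 0 * h b 0) =
     \sum_a \sum_b q a b x * (h a 0 * h b 0) +
     c * \sum_a \sum_b q' a b x * (h a 0 * h b 0).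
    rewrite mulr_sumr -big_split; apply: eq_bigr => a _ /=.
    by rewrite mulr_sumr -big_split; apply: eq_bigr => b _ /=; ring.
  by ring.
apply: le_trans (ler_normD _ _) _; rewrite normrM mulrDl lerD ?t1 //.
by rewrite -mulrA ler_wpM2l ?t2.
Qed.

(* A third difference in [a] of [radial_bump a]: a smooth approximation of the
   indicator of the ball [frobenius x ^+ 2 <= a]. *)
Definition soft_ball (R : realType) (d : nat) (a eta : R) (x : 'cV[R]_d) : R :=
  (6 * eta ^+ 3)^-1 *
  (radial_bump (a + 3 * eta) x + (-3) * radial_bump (a + 2 * eta) x +
   3 * radial_bump (a + eta) x + (-1) * radial_bump a x).

(** Divided by [6 * eta ^+ 3], this is the distribution function at [u + 3 * eta] of a sum of three
    independent uniforms on [0, eta] (Irwin-Hall). Hence the values 0 and 1 at the ends and the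
    bounds in between. *)
Lemma third_difference_bounds (R : realFieldType) (u eta : R) : 0 < eta ->
  let D := pospart (u + 3 * eta) ^+ 3 + (-3) * pospart (u + 2 * eta) ^+ 3 +
    3 * pospart (u + eta) ^+ 3 + (-1) * pospart u ^+ 3 in
  [/\ 0 <= D <= 6 * eta ^+ 3, 0 <= u -> D = 6 * eta ^+ 3 & u <= - (3 * eta) -> D = 0].
Proof.
move=> eta0 D; have pE (v : R) : pospart v = if v <= 0 then 0 else v.
  by rewrite /pospart maxEle.
have e3 : 0 < eta ^+ 3 by rewrite exprn_gt0.
rewrite /D !pE.
have [h3|h3] := leP (u + 3 * eta) 0.
  have -> : (u + 2 * eta <= 0) by lra.
  have -> : (u + eta <= 0) by lra.
  have -> : u <= 0 by lra.
  by split; rewrite ?expr0n /=; lra.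
have [h2|h2] := leP (u + 2 * eta) 0.
  have -> : (u + eta <= 0) by lra.
  have -> : u <= 0 by lra.
  split; rewrite ?expr0n /=; try lra.
  have h : (u + 3 * eta) ^+ 3 <= eta ^+ 3 by apply: le_pow; lra.
  by have := exprn_ge0 3 (ltW h3); lra.
have [h1|h1] := leP (u + eta) 0.
  have -> : u <= 0 by lra.
  split; rewrite ?expr0n /=; try lra.
  (* The middle cubic is not monotone term by term. The facts [k1] to [k15] are nonnegative products
     of [s], [eta] and [eta - s] with their expansions, from which the two bounds follow
     linearly. *)
  pose s := u + 2 * eta; have -> : u + 3 * eta = s + eta by rewrite /s; ring.
  rewrite -/s; have s0 : 0 < s by []. have s1 : s <= eta by rewrite /s; lra.
  have k1 : 0 <= s ^+ 2 * (eta - s) by apply: mulr_ge0; [exact: sqr_ge0|lra].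
  have k2 : 0 <= eta ^+ 2 * (eta - s) by apply: mulr_ge0; [exact: sqr_ge0|lra].
  have k3 : 0 <= s ^+ 3 by apply: exprn_ge0; lra.
  have k4 : 0 <= s * (eta - s) * eta by do 2 (apply: mulr_ge0; try lra).
  have k5 : 0 <= s ^+ 2 * eta by apply: mulr_ge0; [exact: sqr_ge0|lra].
  have k6 : 0 <= s * eta ^+ 2 by apply: mulr_ge0; [lra|exact: sqr_ge0].
  have -> : (s + eta) ^+ 3 + -3 * s ^+ 3 + 3 * 0 + -1 * 0 =
    eta ^+ 3 + 3 * (s * eta ^+ 2) + 3 * (s ^+ 2 * eta) - 2 * s ^+ 3 by ring.
  have k7 : s ^+ 2 * (eta - s) = s ^+ 2 * eta - s ^+ 3 by ring.
  have k8 : eta ^+ 2 * (eta - s) = eta ^+ 3 - s * eta ^+ 2 by ring.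
  have k9 : s * (eta - s) * eta = s * eta ^+ 2 - s ^+ 2 * eta by ring.
  have k10 : 0 <= (eta - s) ^+ 3 by apply: exprn_ge0; lra.
  have k11 : (eta - s) ^+ 3 = eta ^+ 3 - 3 * (s * eta ^+ 2) + 3 * (s ^+ 2 * eta) - s ^+ 3 by ring.
  have k12 : 0 <= (eta - s) ^+ 2 * s by apply: mulr_ge0; [exact: sqr_ge0|lra].
  have k13 : (eta - s) ^+ 2 * s = s * eta ^+ 2 - 2 * (s ^+ 2 * eta) + s ^+ 3 by ring.
  have k14 : 0 <= (eta - s) ^+ 2 * eta by apply: mulr_ge0; [exact: sqr_ge0|lra].
  have k15 : (eta - s) ^+ 2 * eta = eta ^+ 3 - 2 * (s * eta ^+ 2) + s ^+ 2 * eta by ring.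
  by apply/andP; split; lra.
have [h0|h0] := leP u 0.
  have E : (u + 3 * eta) ^+ 3 + -3 * (u + 2 * eta) ^+ 3 + 3 * (u + eta) ^+ 3 +
      -1 * 0 ^+ 3 = 6 * eta ^+ 3 - (- u) ^+ 3 by ring.
  have k : (- u) ^+ 3 <= eta ^+ 3 by apply: le_pow; lra.
  have k' : 0 <= (- u) ^+ 3 by apply: exprn_ge0; lra.
  rewrite E; split; try lra.
  move=> u0; have u00 : u = 0 by apply/eqP; rewrite eq_le h0.
  by rewrite u00 oppr0 expr0n /= subr0.
have -> : (u + 3 * eta) ^+ 3 + -3 * (u + 2 * eta) ^+ 3 + 3 * (u + eta) ^+ 3 +
    -1 * u ^+ 3 = 6 * eta ^+ 3 by ring.
by split; lra.
Qed.

Lemma soft_ballP (R : realType) (d : nat) (a eta : R) (x : 'cV[R]_d) : 0 < eta ->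
  [/\ 0 <= soft_ball a eta x <= 1, frobenius x ^+ 2 <= a -> soft_ball a eta x = 1
    & a + 3 * eta <= frobenius x ^+ 2 -> soft_ball a eta x = 0].
Proof.
move=> eta0; have e3 : 0 < 6 * eta ^+ 3 by rewrite mulr_gt0 ?exprn_gt0.
have := third_difference_bounds (a - frobenius x ^+ 2) eta0.
rewrite /soft_ball /radial_bump; set u := a - _.
have -> : a + 3 * eta - frobenius x ^+ 2 = u + 3 * eta by rewrite /u; ring.
have -> : a + 2 * eta - frobenius x ^+ 2 = u + 2 * eta by rewrite /u; ring.
have -> : a + eta - frobenius x ^+ 2 = u + eta by rewrite /u; ring.
move=> /= [/andP[D0 D1] h1 h2]; split.
- rewrite mulr_ge0 ?invr_ge0 ?(ltW e3) //=.
  by rewrite mulrC ler_pdivrMr ?mul1r.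
- by move=> ha; rewrite h1 ?mulVf ?gt_eqF // /u; lra.
- by move=> ha; rewrite h2 ?mulr0 // /u; lra.
Qed.

(* 1600 is 200 times the sum 1 + 3 + 3 + 1 of the weights of a third difference. *)
Lemma smooth_soft_ball (R : realType) (d : nat) (M a eta : R) :
  0 < eta -> 1 <= M -> a + 3 * eta <= M ->
  smooth (1600 * M ^+ 3 / (6 * eta ^+ 3)) (@soft_ball R d a eta).
Proof.
move=> eta0 M1 aM; have s (b : R) : b <= M -> smooth (200 * M ^+ 3) (@radial_bump R d b).
  exact: smooth_radial_bump.
have e3 : 0 < 6 * eta ^+ 3 by rewrite mulr_gt0 ?exprn_gt0.
have s0 : smooth 0 (fun _ : 'cV[R]_d => 0 : R).
  exists (fun _ _ => 0), (fun _ _ _ => 0); split; last first.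
    by split=> [|?|? ?] disp T U _ /=; exact: measurable_cst.
  split=> *; rewrite ?normr0 //.
  rewrite big1 => [|a' _]; last by rewrite mul0r.
  rewrite big1 => [|a' _]; last by rewrite big1 // => b _; rewrite mul0r.
  by rewrite !addr0 subr0 normr0 mul0r.
have h1 := smooth_lin (-3) (s (a + 3 * eta) ltac:(lra)) (s (a + 2 * eta) ltac:(lra)).
have h2 := smooth_lin 3 h1 (s (a + eta) ltac:(lra)).
have h3 := smooth_lin (-1) h2 (s a ltac:(lra)).
have := smooth_lin (6 * eta ^+ 3)^-1 s0 h3.
rewrite (_ : 0 + _ = 1600 * M ^+ 3 / (6 * eta ^+ 3)).
  by congr smooth; apply/funext => x; rewrite add0r.
rewrite !normrN normr1 (ger0_norm (ltW _)) ?invr_gt0 // (ger0_norm (_ : 0 <= 3)) //.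
by field; rewrite gt_eqF.
Qed.

(** * Anti-concentration of the normalized sum *)

Definition centred_rows (R : realType) (disp : measure_display)
    (T : measurableType disp) (P : probability T R) (n m d : nat)
    (s : 'I_m -> T -> 'cV[R]_n) (psi : 'cV[R]_n -> 'cV[R]_d)
    (Om : 'M[R]_d) (K : R) : Prop :=
  [/\ iid_rows P s,
      forall a, measurable_fun (setT : set (g_sigma_algebraType (@open 'cV[R]_n)))
        (fun x => psi x a 0),
      forall i, L1 P (fun t => frobenius (psi (s i t)) ^+ 4) /\
        mean P (fun t => frobenius (psi (s i t)) ^+ 4) <= K,
      forall i a, mean P (fun t => psi (s i t) a 0) = 0
    & forall i a b, mean P (fun t => psi (s i t) a 0 * psi (s i t) b 0) = Om a b].

Lemma pow_le_fourth (R : realFieldType) (k : nat) (x : R) :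
  0 <= x -> (k <= 4)%N -> x ^+ k <= 1 + x ^+ 4.
Proof.
move=> x0 k4; have x40 : 0 <= x ^+ 4 by apply: exprn_ge0.
have [x1|x1] := leP x 1; first by rewrite (le_trans (exprn_ile1 _ x0 x1)) // lerDl.
by rewrite (@le_trans _ _ (x ^+ 4)) ?lerDr // ler_weXn2l // ltW.
Qed.

Lemma centred_rows_moments (R : realType) (disp : measure_display)
    (T : measurableType disp) (P : probability T R) (n m d : nat)
    (s : 'I_m -> T -> 'cV[R]_n) (psi : 'cV[R]_n -> 'cV[R]_d)
    (Om : 'M[R]_d) (K : R) (k : nat) (i : 'I_m) :
  centred_rows P s psi Om K -> (k <= 4)%N ->
  L1 P (fun t => frobenius (psi (s i t)) ^+ k) /\
  mean P (fun t => frobenius (psi (s i t)) ^+ k) <= 1 + K.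
Proof.
move=> [iid mpsi L4 _ _] k4; have [Li Ki] := L4 i.
have LD : L1 P (fun t => 1 + frobenius (psi (s i t)) ^+ 4) by apply: L1D => //; exact: L1_cst.
have le t : frobenius (psi (s i t)) ^+ k <= 1 + frobenius (psi (s i t)) ^+ 4.
  by apply: pow_le_fourth k4; exact: frobenius_ge0.
have L : L1 P (fun t => frobenius (psi (s i t)) ^+ k).
  apply: L1_le LD _.
    apply: measurable_funX; apply: measurable_frobenius => a.
    exact: (measurable_row i iid (mpsi a)).
  by move=> t; rewrite ger0_norm ?exprn_ge0 ?frobenius_ge0.
split=> //; apply: le_trans (mean_le L LD le) _.
by rewrite meanD ?mean_cst ?lerD2l //; exact: L1_cst.
Qed.

Lemma centred_rows_mul (R : realType) (disp : measure_display)
    (T : measurableType disp) (P : probability T R) (n m d e : nat)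
    (s : 'I_m -> T -> 'cV[R]_n) (psi : 'cV[R]_n -> 'cV[R]_d)
    (Om : 'M[R]_d) (K : R) (L : 'M[R]_(e, d)) (i : 'I_m) :
  centred_rows P s psi Om K ->
  [/\ row_moments P (s i) (fun x => L *m psi x),
      forall a, mean P (fun t => (L *m psi (s i t)) a 0) = 0,
      forall a b, mean P (fun t => (L *m psi (s i t)) a 0 * (L *m psi (s i t)) b 0) =
        (L *m Om *m L^T) a b
    & mean P (fun t => frobenius (L *m psi (s i t)) ^+ 3) <=
        frobenius L ^+ 3 * (1 + K)].
Proof.
move=> cr; have [iid mpsi L4 m0 mm] := cr.
have [L3 K3] := centred_rows_moments i cr (isT : (3 <= 4)%N).
have [_ Lp Lpp _] := row_momentsP iid mpsi L3.
have le t : frobenius (L *m psi (s i t)) ^+ 3 <=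
    frobenius L ^+ 3 * frobenius (psi (s i t)) ^+ 3.
  by rewrite -exprMn; apply: le_pow; [exact: frobenius_ge0|exact: frobeniusM].
have mL a : measurable_fun (setT : set (g_sigma_algebraType (@open 'cV[R]_n)))
    (fun x => (L *m psi x) a 0).
  rewrite (_ : (fun x => _) = fun x => \sum_k L a k * psi x k 0).
    by apply: measurable_sum => k; apply: measurable_funM.
  by apply/funext => x; rewrite mxE.
have LZ3 : L1 P (fun t => frobenius L ^+ 3 * frobenius (psi (s i t)) ^+ 3) by exact: L1Z.
have LL3 : L1 P (fun t => frobenius (L *m psi (s i t)) ^+ 3).
  apply: L1_le LZ3 _ => [|t].
    apply: measurable_funX; apply: measurable_frobenius => a.
    exact: (measurable_row i iid (mL a)).
  by rewrite ger0_norm ?exprn_ge0 ?frobenius_ge0.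
split; first exact: row_momentsP.
- move=> a; have h : has_mx_mean P (fun t => psi (s i t)) 0.
    by apply/has_mx_meanP => k j; rewrite (ord1 j) mxE.
  have /has_mx_meanP := has_mx_mean_mul L 1%:M h.
  move=> /(_ a 0)[_]; rewrite mulmx0 mul0mx mxE => <-.
  by congr mean; apply/funext => t; rewrite mulmx1.
- move=> a b; have h : has_mx_mean P (fun t => psi (s i t) *m (psi (s i t))^T) Om.
    apply/has_mx_meanP => k j.
    rewrite (_ : (fun t => _) = fun t => psi (s i t) k 0 * psi (s i t) j 0) //.
    by apply/funext => t; rewrite mxE big_ord1 mxE.
  have /has_mx_meanP := has_mx_mean_mul L L^T h.
  move=> /(_ a b)[_ <-]; congr mean; apply/funext => t.
  by rewrite !mulmxA -mulmxA -trmx_mul [RHS]mxE big_ord1 [X in _ = _ * X]mxE.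
- apply: le_trans (mean_le LL3 LZ3 le) _; rewrite meanZ //.
  by rewrite ler_wpM2l // exprn_ge0 // frobenius_ge0.
Qed.

Definition scaled_sum (R : realType) (n m d : nat) (psi : 'cV[R]_n -> 'cV[R]_d)
    (S : 'I_m -> 'cV[R]_n) : 'cV[R]_d :=
  (Num.sqrt m%:R)^-1 *: \sum_i psi (S i).

Lemma measurable_scaled_sum (R : realType) (disp : measure_display)
    (T : measurableType disp) (P : probability T R) (n m d : nat)
    (s : 'I_m -> T -> 'cV[R]_n) (psi : 'cV[R]_n -> 'cV[R]_d)
    (f : 'cV[R]_d -> R) :
  iid_rows P s ->
  (forall a, measurable_fun (setT : set (g_sigma_algebraType (@open 'cV[R]_n)))
     (fun x => psi x a 0)) ->
  coord_measurable f -> measurable_fun setT (fun t => f (scaled_sum psi (s^~ t))).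
Proof.
move=> iid mpsi mf; apply: mf => a.
rewrite (_ : (fun t => _) = fun t => (Num.sqrt m%:R)^-1 * \sum_i psi (s i t) a 0).
  apply: measurable_funM => //; apply: measurable_sum => i.
  exact: (measurable_row i iid (mpsi a)).
by apply/funext => t; rewrite /scaled_sum mxE summxE.
Qed.
Lemma measurable_smooth (R : realType) (d : nat) (C : R) (f : 'cV[R]_d -> R) :
  smooth C f -> coord_measurable f.
Proof. by move=> [l [q [_ []]]]. Qed.

Lemma scaled_sum_mulE (R : realType) (n m d : nat) (psi : 'cV[R]_n -> 'cV[R]_d)
    (S : 'I_m -> 'cV[R]_n) :
  scaled_sum psi S = \sum_i (Num.sqrt m%:R)^-1%:M *m psi (S i).
Proof. by rewrite /scaled_sum scaler_sumr; apply: eq_bigr => i _; rewrite mul_scalar_mx. Qed.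

(** Of [m] replacements each costs a third moment scaled by the cube of 1 over the square root of
    [m]; the total is of order 1 over the square root of [m]. *)
Lemma sqrt_nat_cube (R : realType) (m : nat) : (0 < m)%N ->
  m%:R * (Num.sqrt m%:R)^-1 ^+ 3 = (Num.sqrt m%:R)^-1 :> R.
Proof.
move=> m0; have q0 : 0 < Num.sqrt m%:R :> R by rewrite sqrtr_gt0 ltr0n.
have -> : m%:R = Num.sqrt m%:R ^+ 2 :> R by rewrite sqr_sqrtr // ler0n.
rewrite sqrtr_sqr (ger0_norm (ltW q0)); field; exact: lt0r_neq0.
Qed.

Lemma scalar_mx_frobenius (R : realType) (d : nat) (c : R) (x : 'cV[R]_d) :
  frobenius (c%:M *m x) = `|c| * frobenius x.
Proof. by rewrite mul_scalar_mx frobeniusZ. Qed.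

Lemma scaled_row_moments (R : realType) (disp : measure_display)
    (T : measurableType disp) (P : probability T R) (n m d : nat)
    (s : 'I_m -> T -> 'cV[R]_n) (psi : 'cV[R]_n -> 'cV[R]_d)
    (Om : 'M[R]_d) (K : R) (c : R) (i : 'I_m) :
  centred_rows P s psi Om K -> 0 <= c ->
  [/\ row_moments P (s i) (fun x => c%:M *m psi x),
      forall a, mean P (fun t => (c%:M *m psi (s i t)) a 0) = 0,
      forall a b, mean P (fun t => (c%:M *m psi (s i t)) a 0 *
        (c%:M *m psi (s i t)) b 0) = c ^+ 2 * Om a b
    & mean P (fun t => frobenius (c%:M *m psi (s i t)) ^+ 3) <= c ^+ 3 * (1 + K)].
Proof.
move=> cr c0; have [h1 h2 h3 _] := centred_rows_mul c%:M i cr.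
have [L3 K3] := centred_rows_moments i cr (isT : (3 <= 4)%N).
split=> //.
  by move=> a b; rewrite h3 tr_scalar_mx mul_mx_scalar mul_scalar_mx scalerA mxE expr2.
rewrite (_ : (fun t => _) = fun t => c ^+ 3 * frobenius (psi (s i t)) ^+ 3).
  by rewrite meanZ // ler_wpM2l // exprn_ge0.
by apply/funext => t; rewrite scalar_mx_frobenius ger0_norm // exprMn.
Qed.

(** The plateau has width 5 eta = eta + eta + 3 eta: a grid step below the radius, the margin added
    to the soft ball, and the ramp of the soft ball. A ramp on each side makes the support 11 eta
    wide. *)
Definition soft_annulus (R : realType) (d : nat) (b eta : R) (x : 'cV[R]_d) : R :=
  soft_ball (b + 5 * eta) eta x + (-1) * soft_ball (b - 3 * eta) eta x.

Lemma soft_annulusP (R : realType) (d : nat) (b eta : R) (x : 'cV[R]_d) : 0 < eta ->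
  [/\ 0 <= soft_annulus b eta x <= 1,
      b < frobenius x ^+ 2 <= b + 5 * eta -> soft_annulus b eta x = 1
    & soft_annulus b eta x != 0 ->
      b - 3 * eta < frobenius x ^+ 2 < (b - 3 * eta) + 11 * eta].
Proof.
move=> eta0; rewrite /soft_annulus.
have [/andP[u0 u1] uin uout] := soft_ballP (b + 5 * eta) x eta0.
have [/andP[v0 v1] vin vout] := soft_ballP (b - 3 * eta) x eta0.
move: u0 u1 uin uout v0 v1 vin vout.
move: (soft_ball _ _ _) (soft_ball _ _ _) (frobenius x ^+ 2) => u v r.
move=> u0 u1 uin uout v0 v1 vin vout; split.
- have [h|h] : r <= b \/ b <= r by case: (leP r b) => h; [left|right; exact: ltW].
    by rewrite uin; [apply/andP; split; lra|lra].
  by rewrite vout; [apply/andP; split; lra|lra].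
- by move=> /andP[h1 h2]; rewrite uin // vout; lra.
- move=> /eqP h; apply/andP; split; rewrite ltNge; apply/negP => h'; apply: h.
    by rewrite vin // uin; lra.
  by rewrite uout ?vout; lra.
Qed.

Lemma smooth_soft_annulus (R : realType) (d : nat) (M b eta : R) :
  0 < eta -> 1 <= M -> b + 8 * eta <= M ->
  smooth (2 * (1600 * M ^+ 3 / (6 * eta ^+ 3))) (@soft_annulus R d b eta).
Proof.
move=> eta0 M1 bM; set Cf := 1600 * _ / _.
have h1 : smooth Cf (@soft_ball R d (b + 5 * eta) eta) by apply: smooth_soft_ball => //; lra.
have h2 : smooth Cf (@soft_ball R d (b - 3 * eta) eta) by apply: smooth_soft_ball => //; lra.
by have := smooth_lin (-1) h1 h2; rewrite normrN normr1 (_ : Cf + _ = 2 * Cf) //; ring.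
Qed.

(* With [v = Om e_a / sqrt (Om a a)], the covariance of [psi] is [v v^T] plus that
   of [psi - (psi_a / Om a a) Om e_a]; the first part is traded for a simple
   random walk along [v], which spreads over a range of order one. *)
Lemma annulus_prob (R : realType) (disp : measure_display)
    (T : measurableType disp) (P : probability T R) (n m d : nat)
    (s : 'I_m -> T -> 'cV[R]_n) (psi : 'cV[R]_n -> 'cV[R]_d)
    (Om : 'M[R]_d) (K c M b eta : R) (a : 'I_d)
    (Cf := 1600 * M ^+ 3 / (6 * eta ^+ 3)) (W := fun t => scaled_sum psi (s^~ t)) :
  (0 < m)%N -> centred_rows P s psi Om K ->
  frobenius Om <= K -> 0 < c -> c <= Om a a ->
  0 < eta -> 1 <= M -> b + 8 * eta <= M ->
  mean P \1_[set t | b < frobenius (W t) ^+ 2 <= b + 5 * eta] <=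
  2 * Num.sqrt (11 * eta / (4 * c)) +
  (2 + 2 * Cf * ((1 + K) + 4 * ((frobenius (1%:M : 'M[R]_d) + K / c) ^+ 3 * (1 + K) +
     (K / Num.sqrt c) ^+ 3))) / Num.sqrt m%:R.
Proof.
move=> m0 cr Kom c0 cOm eta0 M1 bM.
have [iid mpsi L4 mean0 cov] := cr.
have i0 : 'I_m := Ordinal m0.
have K0 : 0 <= K by apply: le_trans Kom; exact: frobenius_ge0.
have Omsym p q : Om p q = Om q p.
  by rewrite -!(cov i0); congr mean; apply/funext => t; rewrite mulrC.
have Oaa0 : 0 < Om a a by apply: lt_le_trans cOm.
have sf := smooth_soft_annulus d eta0 M1 bM; rewrite -/Cf in sf.
set f := @soft_annulus R d b eta in sf.
set rm := Num.sqrt m%:R.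
have rm0 : 0 < rm by rewrite sqrtr_gt0 ltr0n.
have rmi0 : 0 <= rm^-1 by rewrite invr_ge0 ltW.
pose u := col a Om; pose k := (Om a a)^-1.
(* [N *m psi] is the residual of [psi] after regression on its coordinate [a], so its covariance is
   [Om] minus the rank-one part [v *m v^T]. *)
pose N : 'M[R]_d := 1%:M - k *: (u *m delta_mx 0 a).
pose v := (Num.sqrt (Om a a))^-1 *: u.
pose y (e : bool) : 'cV[R]_d := (-1) ^+ e *: (rm^-1 *: v).
pose L := rm^-1 *: N.
have y0 : \sum_e y e = 0.
  by rewrite big_bool /y /= expr1 expr0 scaleN1r scale1r addNr.
have ut : u^T = row a Om.
  by apply/rowP => q; rewrite !mxE Omsym.
have eNOmN : N *m Om *m N^T = Om - v *m v^T.
  have edu : (delta_mx 0 a : 'rV[R]_d) *m u = (Om a a)%:M.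
    by rewrite -rowE; apply/matrixP => p q; rewrite !ord1 !mxE eqxx.
  have eOm : (delta_mx 0 a : 'rV[R]_d) *m Om = u^T by rewrite -rowE ut.
  have Ome : Om *m (delta_mx 0 a : 'rV[R]_d)^T = u by rewrite trmx_delta -colE.
  have vv : v *m v^T = k *: (u *m u^T).
    rewrite /v linearZ /= -scalemxAl -scalemxAr scalerA -invfM.
    by rewrite -expr2 sqr_sqrtr // ltW.
  have kO : k * Om a a = 1 by rewrite mulVf // gt_eqF.
  rewrite vv /N mulmxBl mul1mx -scalemxAl -mulmxA eOm.
  have -> : (1%:M - k *: (u *m delta_mx 0 a))^T =
      1%:M - k *: ((delta_mx 0 a : 'rV[R]_d)^T *m u^T) :> 'M[R]_d.
    by rewrite raddfB /= trmx1 linearZ /= trmx_mul.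
  have eue : u^T *m (delta_mx 0 a : 'rV[R]_d)^T = (Om a a)%:M.
    by rewrite -trmx_mul edu tr_scalar_mx.
  have h0 : (Om - k *: (u *m u^T)) *m (delta_mx 0 a : 'rV[R]_d)^T = 0.
    by rewrite mulmxBl Ome -scalemxAl -mulmxA eue mul_mx_scalar scalerA kO scale1r subrr.
  by rewrite mulmxBr mulmx1 -scalemxAr mulmxA h0 mul0mx scaler0 subr0.
have vn : frobenius u <= K.
  apply: le_trans Kom.
  rewrite -[leLHS]ger0_norm ?frobenius_ge0 // -[leRHS]ger0_norm ?frobenius_ge0 //.
  rewrite -ler_sqr ?nnegrE // !real_normK ?num_real // frobenius_col frobenius_sq.
  apply: ler_sum => p _; rewrite mxE (bigD1 a) //= lerDl sumr_ge0 // => q _; exact: sqr_ge0.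
have sc0 : 0 < Num.sqrt c by rewrite sqrtr_gt0.
have scO : Num.sqrt c <= Num.sqrt (Om a a) by rewrite ler_wsqrtr.
have sO0 : 0 < Num.sqrt (Om a a) by rewrite sqrtr_gt0.
have vK : frobenius v <= K / Num.sqrt c.
  rewrite frobeniusZ ger0_norm ?invr_ge0 ?(ltW sO0) // mulrC.
  apply: ler_pM => //; rewrite ?frobenius_ge0 ?invr_ge0 ?(ltW sO0) //.
  by rewrite lef_pV2 ?posrE.
have vc : c <= frobenius v ^+ 2.
  rewrite frobeniusZ exprMn ger0_norm ?invr_ge0 ?(ltW sO0) // exprVn sqr_sqrtr ?(ltW Oaa0) //.
  rewrite ler_pdivlMl //; apply: (@le_trans _ _ (Om a a ^+ 2)).
    by rewrite expr2 ler_pM2l.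
  rewrite frobenius_col (bigD1 a) //= mxE lerDl sumr_ge0 // => q _; exact: sqr_ge0.
have NK : frobenius N <= frobenius (1%:M : 'M[R]_d) + K / c.
  apply: le_trans (frobeniusB _ _) _; rewrite lerD2l frobeniusZ.
  have d1 : frobenius (delta_mx 0 a : 'rV[R]_d) = 1.
    apply/eqP; rewrite -(@eqrXn2 _ 2) ?frobenius_ge0 // expr1n frobenius_sq big_ord1.
    rewrite (bigD1 a) //= mxE !eqxx expr1n big1 ?addr0 // => q /negbTE qa.
    by rewrite mxE qa andbF expr0n.
  have h : frobenius (u *m delta_mx 0 a) <= K.
    by apply: le_trans (frobeniusM _ _) _; rewrite d1 mulr1.
  have kc : k <= c^-1 by rewrite lef_pV2 ?posrE.
  have k0 : 0 <= k by rewrite invr_ge0 ltW.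
  have ci0 : 0 <= c^-1 by rewrite invr_ge0 ltW.
  rewrite ger0_norm // mulrC.
  by apply: ler_pM => //; exact: frobenius_ge0.
have N0 : 0 <= frobenius (1%:M : 'M[R]_d) + K / c.
  by apply: le_trans NK; exact: frobenius_ge0.
set q := frobenius (1%:M : 'M[R]_d) + K / c in NK N0 *.
have K10 : 0 <= 1 + K by lra.
have X_ i := scaled_row_moments i cr rmi0.
have Z_ i := centred_rows_mul L i cr.
have LN : frobenius L = rm^-1 * frobenius N by rewrite frobeniusZ ger0_norm.
have yn e : frobenius (y e) = rm^-1 * frobenius v.
  by rewrite /y !frobeniusZ normrX normrN normr1 expr1n mul1r ger0_norm.
pose Y := rm^-1 ^+ 3 * (4 * (q ^+ 3 * (1 + K) + (K / Num.sqrt c) ^+ 3)).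
(* The residual and the two-point step reproduce the covariance exactly: [D] is 0 and only third
   moments contribute. *)
have := @lindeberg R disp T P n m d s bool (2 * Cf) 0 (rm^-1 ^+ 3 * (1 + K)) (fun=> Y) f
  (fun x => rm^-1%:M *m psi x) (fun x => L *m psi x) y iid _ sf _ _ _ _ y0 _ _ _.
rewrite card_bool big_bool /= => /(_ isT).
move=> /(_ (fun i => let: And4 h _ _ _ := X_ i in h)
           (fun i => let: And4 h _ _ _ := Z_ i in h)
           (fun i => let: And4 _ h _ _ := X_ i in h)
           (fun i => let: And4 _ h _ _ := Z_ i in h)).
move=> LIN; unshelve epose proof (LIN _ _ _) as hAB.
- move=> i; rewrite big1 // => p _; rewrite big1 // => p' _.
  have [_ _ -> _] := X_ i; have [_ _ -> _] := Z_ i.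
  rewrite /L linearZ /= -!scalemxAl -scalemxAr eNOmN big_bool !mxE big_ord1 !mxE.
  rewrite /= !expr1 !expr0; apply/eqP; rewrite normr_eq0; apply/eqP.
  by move: (rm^-1) ((Num.sqrt (Om a a))^-1) => ? ?; field.
- by move=> i; have [_ _ _ h] := X_ i.
- move=> i e; have [RZ _ _ h] := Z_ i.
  have [_ _ _ LZ3] := row_moments_shift (y e) iid RZ; have [_ _ _ LZ] := RZ.
  have LC : L1 P (fun=> frobenius (y e) ^+ 3) := L1_cst P _.
  have LR : L1 P (fun t => 4 * (frobenius (L *m psi (s i t)) ^+ 3 + frobenius (y e) ^+ 3)).
    exact: L1Z (L1D LZ LC).
  apply: le_trans (mean_le LZ3 LR _) _ => [t|].
    apply: le_trans (cubeD_le _ _); rewrite ?frobenius_ge0 //.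
    by apply: le_pow; [exact: frobenius_ge0|exact: frobeniusD].
  rewrite (meanZ _ (L1D LZ LC)) (meanD LZ LC) mean_cst /Y mulrCA ler_wpM2l // mulrDr lerD //.
    apply: le_trans h _; rewrite LN exprMn -mulrA.
    apply: ler_wpM2l; first exact: exprn_ge0.
    apply: ler_wpM2r => //; apply: le_pow => //; exact: frobenius_ge0.
  rewrite yn exprMn; apply: ler_wpM2l; first exact: exprn_ge0.
  by apply: le_pow => //; exact: frobenius_ge0.
move: hAB {LIN}; set A := mean P _; set B := mean P _ => hAB.
have Wsum t : \sum_(i < m) (rm^-1)%:M *m psi (s i t) = W t by rewrite /W scaled_sum_mulE.
have mf := measurable_smooth sf.
have fb x : `|f x| <= 1.
  have [/andP[f0 f1] _ _] := soft_annulusP b x eta0.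
  by rewrite ger0_norm.
have Lf : L1 P (fun t => f (\sum_(i < m) (rm^-1)%:M *m psi (s i t))).
  apply: (L1_bounded _ (c := 1)) => [|t]; last exact: fb.
  rewrite (_ : (fun t => _) = fun t => f (W t)); first exact: (measurable_scaled_sum iid mpsi mf).
  by apply/funext => t; rewrite Wsum.
have mA : measurable [set t | b < frobenius (W t) ^+ 2 <= b + 5 * eta].
  have mW := measurable_scaled_sum iid mpsi (@measurable_frobenius_sq R d).
  rewrite (_ : [set t | _] = [set t | b < frobenius (W t) ^+ 2] `&`
    [set t | frobenius (W t) ^+ 2 <= b + 5 * eta]).
    by apply: measurableI; [apply: measurable_lt_set|apply: measurable_le_set].
  by apply/seteqP; split=> t /=; [move=> /andP|move=> h; apply/andP].
have E1 : mean P \1_[set t | b < frobenius (W t) ^+ 2 <= b + 5 * eta] <= A.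
  apply: mean_le Lf _ => [|t]; first exact: integrable_indic.
  have [/andP[f0 f1] fin _] := soft_annulusP b (W t) eta0.
  rewrite Wsum indicE; case: (boolP (t \in _)) => [/set_mem /= h|_] //.
  by rewrite /f fin.
(* The walk makes [m] steps of size |v| over the square root of [m], with |v|^2 >= c. The window
   [tau] therefore grows like the square root of [m], and after division only the first summand of
   the bound survives for large [m]. *)
have E2 : B <= 2 * (rm * Num.sqrt (11 * eta / (4 * c)) + 1) / rm.
  have rd0 : 0 <= rm * Num.sqrt (11 * eta / (4 * c)) by rewrite mulr_ge0 ?sqrtr_ge0 // ltW.
  have fv0 : 0 < frobenius v.
    rewrite -(ltr_pXn2r (ltn0Sn 1)) ?nnegrE ?frobenius_ge0 //.
    by rewrite expr0n /= (lt_le_trans c0).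
  have bd x : iter m (avg_shift y) f x <= 2 * (rm * Num.sqrt (11 * eta / (4 * c)) + 1) / rm.
    apply: (@walk_small_ball R d m (rm^-1 *: v) x f (b - 3 * eta) (11 * eta)) => //.
    - by rewrite frobeniusZ mulr_gt0 // ger0_norm // invr_gt0.
    - rewrite frobeniusZ ger0_norm // !exprMn [Num.sqrt (11 * eta / _) ^+ 2]sqr_sqrtr; last first.
        by rewrite divr_ge0 //; lra.
      have -> : 4 * (rm^-1 ^+ 2 * frobenius v ^+ 2) * (rm ^+ 2 * (11 * eta / (4 * c))) =
          11 * eta * (frobenius v ^+ 2 / c).
        by field; rewrite !gt_eqF.
      rewrite -[leLHS]mulr1 ler_wpM2l //; first lra.
      by rewrite ler_pdivlMr // mul1r.
    - by move=> z; have [] := soft_annulusP b z eta0.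
    - by move=> z; have [] := soft_annulusP b z eta0.
  have c20 : (0 < #|{: bool}|)%N by rewrite card_bool.
  have mi : measurable_fun setT
      (fun t => iter m (avg_shift y) f (\sum_(i < m) L *m psi (s i t))).
    apply: (measurable_smooth (smooth_iter_avg_shift y m c20 sf)) => p.
    rewrite (_ : (fun t => _) = fun t => \sum_i \sum_k L p k * psi (s i t) k 0).
      apply: measurable_sum => i; apply: measurable_sum => k'.
      by apply: measurable_funM => //; exact: (measurable_row i iid (mpsi k')).
    by apply/funext => t; rewrite summxE; apply: eq_bigr => i _; rewrite mxE.
  rewrite -[leRHS](mean_cst P); apply: mean_le => // [|]; last exact: L1_cst.
  have [l [qq [[h1 _ _ _] _]]] := smooth_iter_avg_shift y m c20 sf.
  exact: (L1_bounded P mi (fun t => h1 _)).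
have {}hAB : A <= B + m%:R * (2 * Cf * (0 + rm^-1 ^+ 3 * (1 + K) + 2^-1 * (Y + Y))).
  by move: hAB; rewrite ler_norml => /andP[_]; rewrite lerBlDl.
apply: (le_trans E1); apply: (le_trans hAB); apply: (le_trans (lerD E2 (lexx _))).
have -> : m%:R * (2 * Cf * (0 + rm^-1 ^+ 3 * (1 + K) + 2^-1 * (Y + Y))) =
   m%:R * rm^-1 ^+ 3 * (2 * Cf * (1 + K + 4 * (q ^+ 3 * (1 + K) + (K / Num.sqrt c) ^+ 3))).
  by rewrite /Y; field; rewrite !gt_eqF.
rewrite sqrt_nat_cube // -/rm le_eqVlt; apply/orP; left; apply/eqP.
by field; rewrite !gt_eqF.
Qed.
(** Here [Z = 0], so the hybrids end in the pure bootstrap expectation of a fixed sample [x]. The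
    sample is deterministic: it will be a realized sketch, whereas the mean runs over a fresh
    one. *)
Lemma bootstrap_lindeberg (R : realType) (disp : measure_display)
    (T : measurableType disp) (P : probability T R) (n m d : nat)
    (s : 'I_m -> T -> 'cV[R]_n) (psi : 'cV[R]_n -> 'cV[R]_d)
    (Om : 'M[R]_d) (K C : R) (f : 'cV[R]_d -> R) (x : 'I_m -> 'cV[R]_d)
    (xbar := m%:R^-1 *: \sum_i x i) (rm := Num.sqrt m%:R) :
  (0 < m)%N -> centred_rows P s psi Om K -> smooth C f ->
  `|mean P (fun t => f (scaled_sum psi (s^~ t))) -
    \sum_v multinomial_pmf R (weight v) *
       f (\sum_i (rm^-1 *: (x i - xbar)) *+ weight v i)| <=
  C * (\sum_a \sum_b `|Om a b - m%:R^-1 * \sum_k (x k - xbar) a 0 * (x k - xbar) b 0| +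
       ((1 + K) + m%:R^-1 * \sum_k frobenius (x k - xbar) ^+ 3) / rm).
Proof.
move=> m0 cr sf; have [iid mpsi L4 mean0 cov] := cr.
have mR0 : 0 < m%:R :> R by rewrite ltr0n.
have mi0 : 0 <= m%:R^-1 :> R by rewrite invr_ge0 ltW.
have rm0 : 0 < rm by rewrite sqrtr_gt0 ltr0n.
have rmi0 : 0 <= rm^-1 by rewrite invr_ge0 ltW.
have rm2 : rm^-1 ^+ 2 = m%:R^-1 by rewrite exprVn sqr_sqrtr // ltW.
pose y (i : 'I_m) := rm^-1 *: (x i - xbar).
have y0 : \sum_k y k = 0.
  rewrite -scaler_sumr sumrB sumr_const card_ord /xbar -scaler_nat scalerA.
  by rewrite mulfV ?gt_eqF // scale1r subrr scaler0.
have X_ i := scaled_row_moments i cr rmi0.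
set Dl := \sum_a _; pose rho' (k : 'I_m) := rm^-1 ^+ 3 * frobenius (x k - xbar) ^+ 3.
have Lc i c : L1 P (fun=> c : R) := L1_cst P c.
have Z_ i : row_moments P (s i) (fun _ => 0 : 'cV[R]_d).
  split=> *; [exact: measurable_cst|exact: Lc|exact: Lc|exact: Lc].
have := @lindeberg R disp T P n m d s 'I_m C (m%:R^-1 * Dl) (rm^-1 ^+ 3 * (1 + K)) rho' f
  (fun x => rm^-1%:M *m psi x) (fun x => 0) y iid _ sf _ Z_ _ _ y0 _ _ _.
rewrite card_ord => /(_ m0).
move=> /(_ (fun i => let: And4 h _ _ _ := X_ i in h)
           (fun i => let: And4 _ h _ _ := X_ i in h)).
move=> LIN; unshelve epose proof (LIN _ _ _ _) as hAB.
- by move=> i a; rewrite -[RHS](mean_cst P); congr mean; apply/funext => t; rewrite mxE.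
- move=> i; rewrite /Dl mulr_sumr; apply: ler_sum => a _; rewrite mulr_sumr; apply: ler_sum => b _.
  have [_ _ -> _] := X_ i.
  rewrite (_ : mean P _ = 0); last first.
    by rewrite -[RHS](mean_cst P); congr mean; apply/funext => t; rewrite mxE mul0r.
  rewrite add0r rm2 -[X in X * `|_|](ger0_norm mi0) -normrM mulrBr.
  rewrite (_ : \sum_k y k a 0 * y k b 0 = m%:R^-1 * \sum_k (x k - xbar) a 0 * (x k - xbar) b 0) //.
  by rewrite mulr_sumr; apply: eq_bigr => k _; rewrite -rm2 !mxE; ring.
- by move=> i; have [_ _ _ h] := X_ i.
- move=> i k; rewrite (_ : (fun t => _) = fun=> rho' k) ?mean_cst //.
  by apply/funext => t; rewrite add0r /y frobeniusZ ger0_norm // exprMn.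
move: hAB {LIN}; rewrite (_ : (fun t => iter _ _ _ _) = fun=> iter m (avg_shift y) f 0); last first.
  by apply/funext => t; rewrite big1.
rewrite mean_cst -(multinomial_sum y f).
have -> : (fun t => f (\sum_(i < m) (rm^-1)%:M *m psi (s i t))) =
    (fun t => f (scaled_sum psi (s^~ t))).
  by apply/funext => t; rewrite scaled_sum_mulE.
move=> /le_trans; apply; rewrite le_eqVlt; apply/orP; left; apply/eqP.
rewrite /rho' -mulr_sumr; set G := \sum_k _.
have -> : m%:R * (C * (m%:R^-1 * Dl + rm^-1 ^+ 3 * (1 + K) + m%:R^-1 * (rm^-1 ^+ 3 * G))) =
  C * (Dl + m%:R * rm^-1 ^+ 3 * (1 + K + m%:R^-1 * G)) by field; rewrite !gt_eqF.
by rewrite sqrt_nat_cube // -/rm mulrC [_^-1 * _]mulrC mulrC.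
Qed.

(** * Empirical moments and the mass of bootstrap balls *)

Lemma sum_norm_le_frobenius (R : realType) (d : nat) (A : 'M[R]_d) :
  \sum_a \sum_b `|A a b| <= d%:R * frobenius A.
Proof.
rewrite pair_bigA /= -ler_sqr ?nnegrE; last 2 first.
- by apply: sumr_ge0.
- by rewrite mulr_ge0 // frobenius_ge0.
have := cauchy_schwarz (fun=> 1) (fun p : 'I_d * 'I_d => `|A p.1 p.2|).
rewrite expr1n sumr_const card_prod card_ord natrM exprMn frobenius_sq_pair => h.
apply: le_trans _ (le_trans h _).
  by rewrite le_eqVlt (eq_bigr _ (fun k _ => mul1r `|A k.1 k.2|)) eqxx.
rewrite expr2 ler_wpM2l ?mulr_ge0 // ler_sum // => k _.
by rewrite real_normK // num_real.
Qed.

(** The centred empirical covariance is the raw second moment minus the outer square of the mean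
    [xbar], and the two corrections are bounded apart. *)
Lemma empirical_cov_le (R : realType) (d m : nat) (Om : 'M[R]_d)
    (x : 'I_m -> 'cV[R]_d) (xbar := m%:R^-1 *: \sum_i x i) :
  (0 < m)%N ->
  \sum_a \sum_b `|Om a b - m%:R^-1 * \sum_k (x k - xbar) a 0 * (x k - xbar) b 0| <=
  d%:R * (frobenius (m%:R^-1 *: \sum_k (x k *m (x k)^T - Om)) + frobenius xbar ^+ 2).
Proof.
move=> m0; have mR0 : m%:R != 0 :> R by rewrite pnatr_eq0 -lt0n.
pose A := - (m%:R^-1 *: \sum_k (x k *m (x k)^T - Om)) + xbar *m xbar^T.
rewrite (_ : \sum_a _ = \sum_a \sum_b `|A a b|); last first.
  apply: eq_bigr => a _; apply: eq_bigr => b _; congr (`|_|).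
  rewrite /A !mxE big_ord1 !mxE summxE.
  have -> : \sum_(i < m) (x i *m (x i)^T - Om) a b =
      \sum_i x i a 0 * x i b 0 - m%:R * Om a b.
    rewrite mulr_natl -[X in Om a b *+ X]card_ord -sumr_const -sumrB.
    by apply: eq_bigr => i _; rewrite !mxE big_ord1 !mxE.
  have -> : \sum_k (x k - xbar) a 0 * (x k - xbar) b 0 =
      \sum_k x k a 0 * x k b 0 - m%:R * (xbar a 0 * xbar b 0).
    transitivity (\sum_k (x k a 0 * x k b 0 - x k a 0 * xbar b 0 - xbar a 0 * x k b 0
        + xbar a 0 * xbar b 0)).
      by apply: eq_bigr => k _; rewrite !mxE; ring.
    rewrite big_split /= !sumrB sumr_const card_ord -mulr_suml -mulr_sumr.
    have xE c : \sum_k x k c 0 = m%:R * xbar c 0.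
      by rewrite /xbar mxE summxE mulrA mulfV // mul1r.
    by rewrite !xE -[_ *+ m]mulr_natl; ring.
  by rewrite /xbar !mxE !summxE; field.
apply: le_trans (sum_norm_le_frobenius _) _; rewrite ler_wpM2l //.
apply: le_trans (frobeniusD _ _) _; rewrite frobeniusN lerD2l.
by apply: le_trans (frobeniusM _ _) _; rewrite frobenius_tr expr2.
Qed.

Lemma empirical_cube_le (R : realType) (d m : nat) (x : 'I_m -> 'cV[R]_d) (v : 'cV[R]_d) :
  (0 < m)%N ->
  m%:R^-1 * \sum_k frobenius (x k - v) ^+ 3 <=
  4 * (1 + m%:R^-1 * \sum_k frobenius (x k) ^+ 4 + frobenius v ^+ 3).
Proof.
move=> m0; have mR0 : m%:R != 0 :> R by rewrite pnatr_eq0 -lt0n.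
have mi0 : 0 <= m%:R^-1 :> R by rewrite invr_ge0.
have le k : frobenius (x k - v) ^+ 3 <=
    4 * ((1 + frobenius v ^+ 3) + frobenius (x k) ^+ 4).
  have x0 := frobenius_ge0 (x k); have v0 := frobenius_ge0 v.
  apply: (@le_trans _ _ ((frobenius (x k) + frobenius v) ^+ 3)).
    by apply: le_pow; [exact: frobenius_ge0|exact: frobeniusB].
  apply: le_trans (cubeD_le x0 v0) _; have := pow_le_fourth x0 (isT : (3 <= 4)%N); lra.
apply: (@le_trans _ _ (m%:R^-1 * \sum_k 4 * ((1 + frobenius v ^+ 3) + frobenius (x k) ^+ 4))).
  by rewrite ler_wpM2l // ler_sum.
rewrite -mulr_sumr big_split /= sumr_const card_ord -[_ *+ m]mulr_natl.
by rewrite le_eqVlt; apply/orP; left; apply/eqP; field.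
Qed.

Lemma frobenius_sqD (R : realType) (p q : nat) (A B : 'M[R]_(p, q)) :
  frobenius (A + B) ^+ 2 =
  frobenius A ^+ 2 + 2 * (\sum_i \sum_j A i j * B i j) + frobenius B ^+ 2.
Proof.
rewrite !frobenius_sq mulr_sumr -!big_split /=; apply: eq_bigr => i _.
rewrite mulr_sumr -!big_split /=; apply: eq_bigr => j _; rewrite mxE; ring.
Qed.

Lemma iter_avg_shift_sq (R : realType) (p q : nat) (K : finType)
    (y : K -> 'M[R]_(p, q)) (N : nat) (x : 'M[R]_(p, q)) :
  (0 < #|K|)%N -> \sum_k y k = 0 ->
  iter N (avg_shift y) (fun x => frobenius x ^+ 2) x =
  frobenius x ^+ 2 + N%:R * (#|K|%:R^-1 * \sum_k frobenius (y k) ^+ 2).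
Proof.
move=> K0 y0; have KR : #|K|%:R != 0 :> R by rewrite pnatr_eq0 -lt0n.
elim: N x => [|N IH] x; first by rewrite mul0r addr0.
rewrite iterS /avg_shift; set S := #|K|%:R^-1 * \sum_k frobenius (y k) ^+ 2 in IH *.
rewrite (eq_bigr _ (fun k _ => IH (x + y k))).
rewrite (eq_bigr (fun k => (frobenius x ^+ 2 + N%:R * S) +
   2 * (\sum_i \sum_j x i j * y k i j) + frobenius (y k) ^+ 2)); last first.
  by move=> k _; rewrite frobenius_sqD; ring.
rewrite 2!big_split /= sumr_const -[X in _ + X + _]mulr_sumr.
rewrite (_ : \sum_k \sum_i \sum_j x i j * y k i j = 0); last first.
  rewrite exchange_big big1 // => i _; rewrite exchange_big big1 // => j _.
  by rewrite -mulr_sumr -summxE y0 mxE mulr0.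
rewrite mulr0 addr0 mulrDr -/S -(mulr_natl (frobenius x ^+ 2 + N%:R * S) #|K|) (mulKf KR) -natr1.
by ring.
Qed.

(** The weighted mean is a sum of [m] independent centred draws, whose variances add. Centring only
    decreases the empirical second moment. *)
Lemma multinomial_variance (R : realType) (p q m : nat) (z : 'I_m -> 'M[R]_(p, q))
    (zbar := m%:R^-1 *: \sum_i z i) :
  (0 < m)%N ->
  \sum_v multinomial_pmf R (weight v) *
     frobenius (m%:R^-1 *: \sum_i (weight v i)%:R *: (z i - zbar)) ^+ 2 <=
  m%:R^-1 * (m%:R^-1 * \sum_i frobenius (z i) ^+ 2).
Proof.
move=> m0; have mR0 : m%:R != 0 :> R by rewrite pnatr_eq0 -lt0n.
have mi0 : 0 <= m%:R^-1 :> R by rewrite invr_ge0.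
pose y i := m%:R^-1 *: (z i - zbar).
have s0 : \sum_k (z k - zbar) = 0.
  by rewrite sumrB sumr_const card_ord /zbar -scaler_nat scalerA mulfV // scale1r subrr.
have y0 : \sum_k y k = 0 by rewrite -scaler_sumr s0 scaler0.
have K0 : (0 < #|'I_m|)%N by rewrite card_ord.
have := iter_avg_shift_sq m 0 K0 y0.
rewrite -(multinomial_sum y (fun x => frobenius x ^+ 2)) frobenius0 expr0n add0r card_ord.
rewrite mulrA mulfV // mul1r => h.
rewrite (eq_bigr (fun v => multinomial_pmf R (weight v) *
    frobenius (\sum_i y i *+ weight v i) ^+ 2)); last first.
  move=> v _; congr (_ * frobenius _ ^+ 2); rewrite scaler_sumr; apply: eq_bigr => i _.
  by rewrite /y -scaler_nat !scalerA mulrC.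
rewrite h (eq_bigr (fun k => (m%:R^-1) ^+ 2 * frobenius (z k - zbar) ^+ 2)); last first.
  by move=> k _; rewrite frobeniusZ exprMn ger0_norm.
rewrite -mulr_sumr expr2 -mulrA ler_wpM2l // ler_wpM2l //.
have -> : \sum_k frobenius (z k) ^+ 2 =
    \sum_k frobenius (z k - zbar) ^+ 2 + m%:R * frobenius zbar ^+ 2.
  rewrite (eq_bigr (fun k => frobenius (z k - zbar) ^+ 2 +
    2 * (\sum_i \sum_j (z k - zbar) i j * zbar i j) + frobenius zbar ^+ 2)); last first.
    by move=> k _; rewrite -frobenius_sqD subrK.
  rewrite 2!big_split /= sumr_const card_ord -[X in _ + X + _]mulr_sumr.
  rewrite -(mulr_natl (frobenius zbar ^+ 2) m).
  rewrite (_ : \sum_k \sum_i \sum_j _ = 0) ?mulr0 ?addr0 //.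
  rewrite exchange_big big1 // => i _; rewrite exchange_big big1 // => j _.
  by rewrite -mulr_suml -summxE s0 mxE mul0r.
by rewrite lerDl mulr_ge0 // sqr_ge0.
Qed.
Lemma perturbed_le (R : realType) (d : nat) (A D : 'M[R]_d) (x u : 'cV[R]_d)
    (K eps : R) :
  frobenius A <= K -> frobenius D <= eps -> x + A *m D *m x = u ->
  (1 - K * eps) * frobenius x <= frobenius u /\
  frobenius u <= (1 + K * eps) * frobenius x.
Proof.
move=> AK De E; have x0 := frobenius_ge0 x.
have h : frobenius (A *m D *m x) <= K * eps * frobenius x.
  apply: le_trans (frobeniusM _ _) _; rewrite ler_wpM2r //.
  apply: le_trans (frobeniusM _ _) _; apply: ler_pM => //; exact: frobenius_ge0.
have := frobeniusD x (A *m D *m x); have := frobeniusB (x + A *m D *m x) (A *m D *m x).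
by rewrite addrK E; split; lra.
Qed.

(** Subtracting the two expansions gives u' - u = (I + A D')(x' - x) + A (D' - D) x, and |x| <= 2
    |u| turns the last term into a multiple of the observed influence mean. *)
Lemma boot_increment_le (R : realType) (d : nat) (A D D' : 'M[R]_d)
    (x x' u u' : 'cV[R]_d) (K eps : R) :
  frobenius A <= K -> frobenius D <= eps -> frobenius (D' - D) <= eps ->
  K * eps <= 2^-1 -> x + A *m D *m x = u -> x' + A *m D' *m x' = u' ->
  frobenius (u' - u) <=
    (1 + 2 * (K * eps)) * frobenius (x' - x) + 2 * (K * eps) * frobenius u.
Proof.
move=> AK De De' Ke Ex Ex'; have [hx _] := perturbed_le AK De Ex.
have K0 : 0 <= K by apply: le_trans AK; exact: frobenius_ge0.
have e0 : 0 <= eps by apply: le_trans De; exact: frobenius_ge0.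
have D'e : frobenius D' <= 2 * eps.
  by rewrite -(subrK D D'); apply: le_trans (frobeniusD _ _) _; lra.
have [_ h1] := perturbed_le AK D'e (erefl (x' - x + A *m D' *m (x' - x))).
have E : u' - u = (x' - x + A *m D' *m (x' - x)) + A *m (D' - D) *m x.
  rewrite -Ex -Ex' !mulmxBr mulmxBl.
  move: (A *m D *m x) (A *m D' *m x) (A *m D' *m x') => p1 p2 p3.
  by apply/matrixP => i j; rewrite !mxE; ring.
have h2 : frobenius (A *m (D' - D) *m x) <= K * eps * frobenius x.
  apply: le_trans (frobeniusM _ _) _; rewrite ler_wpM2r ?frobenius_ge0 //.
  apply: le_trans (frobeniusM _ _) _; apply: ler_pM => //; exact: frobenius_ge0.
have h3 : frobenius x <= 2 * frobenius u.
  have := frobenius_ge0 x; have := frobenius_ge0 u; nra.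
have h4 : K * eps * frobenius x <= K * eps * (2 * frobenius u).
  by rewrite ler_wpM2l // mulr_ge0.
rewrite E; apply: le_trans (frobeniusD _ _) _; lra.
Qed.

(** A small bootstrap error forces a small linear sum, on which the soft ball equals 1, unless the
    reweighted Gram matrix deviates by more than [eps]. Chebyshev's inequality with
    [multinomial_variance] pays for those weights. *)
Lemma bootstrap_mass (R : realType) (n d m : nat) (X : 'M[R]_(n, d))
    (y : 'cV[R]_n) (lam : R) (S : 'I_m -> 'cV[R]_n) (K eps r a eta M1 M2 : R)
    (psi := fun i => influence X y lam (S i))
    (psibar := m%:R^-1 *: \sum_i psi i) (rm := Num.sqrt m%:R) :
  (0 < m)%N -> 0 < lam -> frobenius (resolvent (gram X) lam) <= K ->
  0 < eps -> K * eps <= 2^-1 ->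
  frobenius (m%:R^-1 *: \sum_i outer_dev X (S i)) <= eps ->
  m%:R * frobenius psibar ^+ 2 <= M1 ->
  m%:R^-1 * \sum_i frobenius (outer_dev X (S i)) ^+ 2 <= M2 ->
  0 < eta -> 0 <= r ->
  ((1 + 2 * (K * eps)) * r + 2 * (K * eps) * Num.sqrt M1) ^+ 2 <= a + eta ->
  \sum_(v | boot_error X y lam S (weight v) < r / rm) multinomial_pmf R (weight v) <=
  \sum_v multinomial_pmf R (weight v) *
    soft_ball (a + eta) eta (\sum_i (rm^-1 *: (psi i - psibar)) *+ weight v i) +
  M2 / (m%:R * eps ^+ 2).
Proof.
move=> m0 lam0 AK eps0 Ke De hM1 hM2 eta0 r0 ha.
have mR0 : 0 < m%:R :> R by rewrite ltr0n.
have rm0 : 0 < rm by rewrite sqrtr_gt0.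
have K0 : 0 <= K by apply: le_trans AK; exact: frobenius_ge0.
pose zbar := m%:R^-1 *: \sum_i outer_dev X (S i).
pose Z (v : {ffun 'I_m -> 'I_m.+1}) :=
  m%:R^-1 *: \sum_i (weight v i)%:R *: (outer_dev X (S i) - zbar).
pose Wv (v : {ffun 'I_m -> 'I_m.+1}) := \sum_i (rm^-1 *: (psi i - psibar)) *+ weight v i.
have e20 : 0 < eps ^+ 2 by rewrite exprn_gt0.
have ei0 : 0 <= (eps ^+ 2)^-1 by rewrite invr_ge0 ltW.
apply: (@le_trans _ _ (\sum_v (multinomial_pmf R (weight v) * soft_ball (a + eta) eta (Wv v) +
   (eps ^+ 2)^-1 * (multinomial_pmf R (weight v) * frobenius (Z v) ^+ 2)))); last first.
  rewrite big_split /= lerD2l -mulr_sumr.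
  have -> : M2 / (m%:R * eps ^+ 2) = (eps ^+ 2)^-1 * (m%:R^-1 * M2).
    by field; rewrite !gt_eqF.
  apply: ler_wpM2l; first by rewrite invr_ge0 ltW.
  apply: le_trans (multinomial_variance _ m0) _.
  by apply: ler_wpM2l => //; rewrite invr_ge0 ltW.
rewrite big_mkcond; apply: ler_sum => v _.
have pv0 := multinomial_ge0 R (weight v).
have [/andP[s0 s1] sin _] := soft_ballP (a + eta) (Wv v) eta0.
have Z0 : 0 <= frobenius (Z v) ^+ 2 by exact: sqr_ge0.
have ge0 : 0 <= multinomial_pmf R (weight v) * soft_ball (a + eta) eta (Wv v) +
   (eps ^+ 2)^-1 * (multinomial_pmf R (weight v) * frobenius (Z v) ^+ 2).
  by apply: addr_ge0; apply: mulr_ge0 => //; exact: mulr_ge0.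
case: ifP => // hv.
(* A vector of total other than [m] has mass zero, and the expansion of the replicate is stated for
   total [m]. *)
have [sv|sv] := eqVneq (\sum_i weight v i)%N m; last first.
  by move: ge0; rewrite /multinomial_pmf (negbTE sv).
have [Ze|Ze] := leP (frobenius (Z v)) eps; last first.
  apply: (@le_trans _ _ (multinomial_pmf R (weight v) * (frobenius (Z v) ^+ 2 / eps ^+ 2))).
    rewrite ler_peMr // ler_pdivlMr // mul1r; apply: le_pow; exact: ltW.
  by rewrite mulrA [leLHS]mulrC lerDr mulr_ge0.
rewrite sin.
  by rewrite mulr1 lerDl; apply: mulr_ge0 => //; exact: mulr_ge0.
pose x := sketched_ridge X y lam S - ridge X y lam.
pose x' := boot_ridge X y lam S (weight v) - ridge X y lam.
have svR : \sum_i (weight v i)%:R = m%:R :> R by rewrite -natr_sum sv.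
have avgE (V : lmodType R) (F : 'I_m -> V) :
    m%:R^-1 *: \sum_i (weight v i)%:R *: (F i - m%:R^-1 *: \sum_j F j) =
    m%:R^-1 *: \sum_i (weight v i)%:R *: F i - m%:R^-1 *: \sum_j F j.
  rewrite (eq_bigr (fun i => (weight v i)%:R *: F i - (weight v i)%:R *: (m%:R^-1 *: \sum_j F j))).
    by rewrite sumrB scalerBr weighted_avg_cst.
  by move=> i _; rewrite scalerBr.
have h := boot_increment_le AK De _ Ke (sketched_expand X y S m0 lam0)
   (boot_expand X y S m0 lam0 sv).
have {h} := h _; rewrite -(avgE _ (outer_dev X \o S)) -/zbar => /(_ Ze).
rewrite -(avgE _ psi) -/x -/x' -/psibar.
set U := (X in frobenius X <= _ -> _) => h.
have WU : Wv v = rm *: U.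
  rewrite /Wv /U !scaler_sumr; apply: eq_bigr => i _.
  rewrite -scaler_nat !scalerA; congr (_ *: _).
  have -> : m%:R = rm ^+ 2 :> R by rewrite sqr_sqrtr // ltW.
  by rewrite expr2 invfM mulrA mulfV ?gt_eqF // mul1r mulrC.
rewrite WU frobeniusZ exprMn real_normK ?num_real // -exprMn.
apply: le_trans ha; apply: le_pow; first by rewrite mulr_ge0 ?frobenius_ge0 // ltW.
have hp : rm * frobenius psibar <= Num.sqrt M1.
  have <- : Num.sqrt ((rm * frobenius psibar) ^+ 2) = rm * frobenius psibar.
    by rewrite sqrtr_sqr ger0_norm // mulr_ge0 ?frobenius_ge0 // ltW.
  by rewrite ler_wsqrtr // exprMn sqr_sqrtr // ltW.
have hb : rm * frobenius (x' - x) <= r.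
  by move: hv; rewrite ltr_pdivlMr // mulrC /boot_error /x' /x opprB addrA subrK => /ltW.
apply: (@le_trans _ _ (rm * ((1 + 2 * (K * eps)) * frobenius (x' - x) +
    2 * (K * eps) * frobenius psibar))).
  by rewrite ler_wpM2l // ltW.
rewrite mulrDr; apply: lerD; rewrite mulrCA; apply: ler_wpM2l => //;
  rewrite ?mulr_ge0 ?addr_ge0 ?mulr_ge0 //; exact: ltW.
Qed.

(** * Usable sketches and the choice of the radius *)

Lemma row_avg_frobenius (R : realType) (disp : measure_display)
    (T : measurableType disp) (P : probability T R) (n m p q : nat)
    (s : 'I_m -> T -> 'cV[R]_n) (phi : 'cV[R]_n -> 'M[R]_(p, q)) (V : R) :
  (0 < m)%N -> iid_rows P s ->
  (forall a b, measurable_fun (setT : set (g_sigma_algebraType (@open 'cV[R]_n)))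
     (fun x => phi x a b)) ->
  (forall i, L1 P (fun t => frobenius (phi (s i t)) ^+ 2) /\
     mean P (fun t => frobenius (phi (s i t)) ^+ 2) <= V) ->
  (forall i a b, mean P (fun t => phi (s i t) a b) = 0) ->
  L1 P (fun t => frobenius (m%:R^-1 *: \sum_i phi (s i t)) ^+ 2) /\
  mean P (fun t => frobenius (m%:R^-1 *: \sum_i phi (s i t)) ^+ 2) <=
    (p * q)%:R * V / m%:R.
Proof.
move=> m0 iid mphi L2 mean0; have mR0 : 0 < m%:R :> R by rewrite ltr0n.
have Lab i a b : L1 P (fun t => phi (s i t) a b ^+ 2) /\
    mean P (fun t => phi (s i t) a b ^+ 2) <= V.
  have [Li Vi] := L2 i.
  have le t : phi (s i t) a b ^+ 2 <= frobenius (phi (s i t)) ^+ 2.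
    rewrite -[phi _ a b ^+ 2]real_normK ?num_real //.
    by apply: le_pow => //; exact: le_frobenius.
  have L : L1 P (fun t => phi (s i t) a b ^+ 2).
    apply: L1_le Li _ => [|t]; last by rewrite ger0_norm // sqr_ge0.
    by apply: measurable_funX; exact: (measurable_row i iid (mphi a b)).
  by split=> //; apply: le_trans (mean_le L Li le) Vi.
have h a b := row_sum_sq_mean iid (mphi a b) (fun i => (Lab i a b).1)
  (fun i => mean0 i a b) (fun i => (Lab i a b).2).
rewrite (_ : (fun t => frobenius _ ^+ 2) = fun t => \sum_a \sum_b
    (m%:R^-1) ^+ 2 * (\sum_i phi (s i t) a b) ^+ 2); last first.
  apply/funext => t; rewrite frobenius_sq; apply: eq_bigr => a _; apply: eq_bigr => b _.
  by rewrite mxE summxE exprMn.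
have Lh a b : L1 P (fun t => (m%:R^-1) ^+ 2 * (\sum_i phi (s i t) a b) ^+ 2).
  by apply: L1Z; have [] := h a b.
have Lh' a : L1 P (fun t => \sum_b (m%:R^-1) ^+ 2 * (\sum_i phi (s i t) a b) ^+ 2).
  by apply: L1_sum => b _.
split; first by apply: L1_sum => a _.
rewrite mean_sum //; apply: (@le_trans _ _ (\sum_(a < p) \sum_(b < q) V / m%:R)).
  apply: ler_sum => a _; rewrite mean_sum //; apply: ler_sum => b _.
  have [Ls hs] := h a b; rewrite meanZ //.
  apply: (@le_trans _ _ ((m%:R^-1) ^+ 2 * (m%:R * V))).
    by rewrite ler_wpM2l // exprn_ge0 // invr_ge0 ltW.
  by rewrite le_eqVlt; apply/orP; left; apply/eqP; field; rewrite gt_eqF.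
rewrite !sumr_const !card_ord -mulrnA -[leLHS]mulr_natl mulrA [(q * p)%N]mulnC.
by [].
Qed.

Lemma mean_row_avg_le (R : realType) (disp : measure_display)
    (T : measurableType disp) (P : probability T R) (m : nat)
    (f : 'I_m -> T -> R) (V : R) :
  (0 < m)%N -> (forall i, L1 P (f i) /\ mean P (f i) <= V) ->
  L1 P (fun t => m%:R^-1 * \sum_i f i t) /\
  mean P (fun t => m%:R^-1 * \sum_i f i t) <= V.
Proof.
move=> m0 h; have Ls : L1 P (fun t => \sum_i f i t).
  by apply: L1_sum => i _; have [] := h i.
split; first exact: L1Z.
rewrite meanZ // mean_sum => [|i _]; last by have [] := h i.
rewrite ler_pdivrMl ?ltr0n // mulr_natl -[X in V *+ X]card_ord -sumr_const.
by apply: ler_sum => i _; have [] := h i.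
Qed.

(* A sum of Markov ratios, so that its expectation bounds the probability of
   every event that makes a sketch unusable at once. *)
Definition sketch_defect (R : realType) (n d m : nat) (X : 'M[R]_(n, d))
    (y : 'cV[R]_n) (lam : R) (Om : 'M[R]_d) (e1 e2 M1 M2 M3 : R)
    (S : 'I_m -> 'cV[R]_n) : R :=
  let psi i := influence X y lam (S i) in
  let zeta i := outer_dev X (S i) in
  frobenius (m%:R^-1 *: \sum_i zeta i) ^+ 2 / e1 ^+ 2 +
  frobenius (scaled_sum (influence X y lam) S) ^+ 2 / M1 +
  (m%:R^-1 * \sum_i frobenius (zeta i) ^+ 2) / M2 +
  (m%:R^-1 * \sum_i frobenius (psi i) ^+ 4) / M3 +
  frobenius (m%:R^-1 *: \sum_i (psi i *m (psi i)^T - Om)) ^+ 2 / e2 ^+ 2.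

Lemma scaled_sum_sq (R : realType) (n m d : nat) (psi : 'cV[R]_n -> 'cV[R]_d)
    (S : 'I_m -> 'cV[R]_n) : (0 < m)%N ->
  frobenius (scaled_sum psi S) ^+ 2 =
  m%:R * frobenius (m%:R^-1 *: \sum_i psi (S i)) ^+ 2.
Proof.
move=> m0; have mR0 : 0 < m%:R :> R by rewrite ltr0n.
rewrite /scaled_sum !frobeniusZ !exprMn !real_normK ?num_real // exprVn sqr_sqrtr ?ltW //.
by field; rewrite gt_eqF.
Qed.

Definition centred_matrices (R : realType) (disp : measure_display)
    (T : measurableType disp) (P : probability T R) (n m p q : nat)
    (s : 'I_m -> T -> 'cV[R]_n) (zeta : 'cV[R]_n -> 'M[R]_(p, q)) (K : R) : Prop :=
  [/\ forall a b, measurable_fun (setT : set (g_sigma_algebraType (@open 'cV[R]_n)))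
        (fun x => zeta x a b),
      forall i, L1 P (fun t => frobenius (zeta (s i t)) ^+ 2) /\
        mean P (fun t => frobenius (zeta (s i t)) ^+ 2) <= K
    & forall i a b, mean P (fun t => zeta (s i t) a b) = 0].

Lemma sketch_defect_mean (R : realType) (disp : measure_display)
    (T : measurableType disp) (P : probability T R) (n d m : nat)
    (s : 'I_m -> T -> 'cV[R]_n) (X : 'M[R]_(n, d))
    (y : 'cV[R]_n) (lam : R) (Om : 'M[R]_d) (K e1 e2 M1 M2 M3 : R) :
  (0 < m)%N -> centred_rows P s (influence X y lam) Om K ->
  centred_matrices P s (outer_dev X) K -> frobenius Om <= K ->
  0 < e1 -> 0 < e2 -> 0 < M1 -> 0 < M2 -> 0 < M3 ->
  L1 P (fun t => sketch_defect X y lam Om e1 e2 M1 M2 M3 (s^~ t)) /\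
  mean P (fun t => sketch_defect X y lam Om e1 e2 M1 M2 M3 (s^~ t)) <=
    (d * d)%:R * K / m%:R / e1 ^+ 2 + d%:R * (1 + K) / M1 + K / M2 + K / M3 +
    (d * d)%:R * (2 * K + 2 * K ^+ 2) / m%:R / e2 ^+ 2.
Proof.
move=> m0 cr [mz Lz z0] OmK e10 e20 M10 M20 M30; have [iid mpsi L4 mean0 cov] := cr.
have mR0 : 0 < m%:R :> R by rewrite ltr0n.
set psi := influence X y lam in cr mpsi L4 mean0 cov *.
have K0 : 0 <= K by apply: le_trans OmK; exact: frobenius_ge0.
have [T1 V1] := row_avg_frobenius m0 iid mz Lz z0.
have mpsi' a (b : 'I_1) : measurable_fun (setT : set (g_sigma_algebraType (@open 'cV[R]_n)))
    (fun x => psi x a b) by rewrite (ord1 b).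
have mean0' i a (b : 'I_1) : mean P (fun t => psi (s i t) a b) = 0 by rewrite (ord1 b).
have [T2 V2] := row_avg_frobenius m0 iid mpsi'
  (fun i => centred_rows_moments i cr (isT : (2 <= 4)%N)) mean0'.
have [T3 V3] := mean_row_avg_le m0 Lz.
have [T4 V4] := mean_row_avg_le m0 L4.
pose om x := psi x *m (psi x)^T - Om.
have omE x a b : om x a b = psi x a 0 * psi x b 0 - Om a b.
  by rewrite /om !mxE big_ord1 !mxE.
have mom a b : measurable_fun (setT : set (g_sigma_algebraType (@open 'cV[R]_n)))
    (fun x => om x a b).
  rewrite (_ : (fun x => _) = fun x => psi x a 0 * psi x b 0 - Om a b).
    by apply: measurable_funB => //; apply: measurable_funM.
  by apply/funext => x; rewrite omE.
have Lom i : L1 P (fun t => frobenius (om (s i t)) ^+ 2) /\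
    mean P (fun t => frobenius (om (s i t)) ^+ 2) <= 2 * K + 2 * K ^+ 2.
  have [L4i K4i] := L4 i.
  have le t : frobenius (om (s i t)) ^+ 2 <= 2 * frobenius (psi (s i t)) ^+ 4 + 2 * K ^+ 2.
    have p0 := frobenius_ge0 (psi (s i t)); have o0 := frobenius_ge0 Om.
    have h : frobenius (om (s i t)) <= frobenius (psi (s i t)) ^+ 2 + K.
      apply: le_trans (frobeniusB _ _) _; apply: lerD => //.
      by apply: le_trans (frobeniusM _ _) _; rewrite frobenius_tr expr2.
    apply: (@le_trans _ _ ((frobenius (psi (s i t)) ^+ 2 + K) ^+ 2)).
      by apply: le_pow => //; exact: frobenius_ge0.
    rewrite (_ : frobenius (psi (s i t)) ^+ 4 = (frobenius (psi (s i t)) ^+ 2) ^+ 2); last by ring.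
    move: (frobenius (psi (s i t)) ^+ 2) => u; have := sqr_ge0 (u - K); lra.
  have LR : L1 P (fun t => 2 * frobenius (psi (s i t)) ^+ 4 + 2 * K ^+ 2).
    by apply: L1D; [exact: L1Z|exact: L1_cst].
  have L : L1 P (fun t => frobenius (om (s i t)) ^+ 2).
    apply: L1_le LR _ => [|t]; last by rewrite ger0_norm // sqr_ge0.
    rewrite (_ : (fun t => _) = fun t => \sum_a \sum_b om (s i t) a b ^+ 2).
      apply: measurable_sum => a; apply: measurable_sum => b; apply: measurable_funX.
      exact: (measurable_row i iid (mom a b)).
    by apply/funext => t; rewrite frobenius_sq.
  split=> //; apply: le_trans (mean_le L LR le) _.
  rewrite meanD ?mean_cst ?meanZ //; [lra|exact: L1Z|exact: L1_cst].
have mom0 i a b : mean P (fun t => om (s i t) a b) = 0.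
  have [_ _ Lpp _] := row_momentsP iid mpsi (centred_rows_moments i cr (isT : (3 <= 4)%N)).1.
  rewrite (_ : (fun t => _) = fun t => psi (s i t) a 0 * psi (s i t) b 0 - Om a b).
    by rewrite meanB ?mean_cst ?cov ?subrr //; exact: L1_cst.
  by apply/funext => t; rewrite omE.
have [T5 V5] := row_avg_frobenius m0 iid mom Lom mom0.
have T2' := L1Z m%:R T2.
have Wq : (fun t => frobenius (scaled_sum psi (s^~ t)) ^+ 2) =
    fun t => m%:R * frobenius (m%:R^-1 *: \sum_i psi (s i t)) ^+ 2.
  by apply/funext => t; rewrite scaled_sum_sq.
rewrite -Wq in T2'.
have V2' : mean P (fun t => frobenius (scaled_sum psi (s^~ t)) ^+ 2) <= d%:R * (1 + K).
  rewrite Wq meanZ //; apply: (@le_trans _ _ (m%:R * ((d * 1)%:R * (1 + K) / m%:R))).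
    by rewrite ler_wpM2l // ltW.
  by rewrite muln1 mulrCA mulfV ?mulr1 // gt_eqF.
have LM (f : T -> R) (c V : R) : 0 < c -> L1 P f -> mean P f <= V ->
    L1 P (fun t => f t / c) /\ mean P (fun t => f t / c) <= V / c.
  move=> c0 Lf Vf; rewrite (_ : (fun t => f t / c) = fun t => c^-1 * f t).
    by split; [exact: L1Z|rewrite meanZ // mulrC ler_wpM2r // invr_ge0 ltW].
  by apply/funext => t; rewrite mulrC.
have LD (f g : T -> R) (U V : R) : L1 P f /\ mean P f <= U -> L1 P g /\ mean P g <= V ->
    L1 P (fun t => f t + g t) /\ mean P (fun t => f t + g t) <= U + V.
  move=> [Lf Uf] [Lg Vg]; split; first exact: L1D.
  by rewrite meanD // lerD.
have e1p : 0 < e1 ^+ 2 by rewrite exprn_gt0.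
have e2p : 0 < e2 ^+ 2 by rewrite exprn_gt0.
exact: (LD _ _ _ _ (LD _ _ _ _ (LD _ _ _ _ (LD _ _ _ _ (LM _ _ _ e1p T1 V1)
  (LM _ _ _ M10 T2' V2')) (LM _ _ _ M20 T3 V3)) (LM _ _ _ M30 T4 V4)) (LM _ _ _ e2p T5 V5)).
Qed.

Lemma sketch_defect_lt1 (R : realType) (n d m : nat) (X : 'M[R]_(n, d))
    (y : 'cV[R]_n) (lam : R) (Om : 'M[R]_d) (e1 e2 M1 M2 M3 : R)
    (S : 'I_m -> 'cV[R]_n)
    (psi := fun i => influence X y lam (S i)) (zeta := fun i => outer_dev X (S i)) :
  0 < e1 -> 0 < e2 -> 0 < M1 -> 0 < M2 -> 0 < M3 ->
  0 <= sketch_defect X y lam Om e1 e2 M1 M2 M3 S /\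
  (sketch_defect X y lam Om e1 e2 M1 M2 M3 S < 1 ->
   [/\ frobenius (m%:R^-1 *: \sum_i zeta i) <= e1,
       frobenius (scaled_sum (influence X y lam) S) ^+ 2 <= M1,
       m%:R^-1 * \sum_i frobenius (zeta i) ^+ 2 <= M2,
       m%:R^-1 * \sum_i frobenius (psi i) ^+ 4 <= M3
     & frobenius (m%:R^-1 *: \sum_i (psi i *m (psi i)^T - Om)) <= e2]).
Proof.
move=> e10 e20 M10 M20 M30; rewrite /sketch_defect -/psi -/zeta.
set x1 := frobenius _; set x2 := frobenius (scaled_sum _ _) ^+ 2.
set x3 := m%:R^-1 * \sum_i frobenius (zeta i) ^+ 2.
set x4 := m%:R^-1 * _; set x5 := frobenius (m%:R^-1 *: \sum_i (_ - _)).
have q0 (u e : R) : 0 < e -> 0 <= u -> 0 <= u / e by move=> e0 u0; rewrite divr_ge0 // ltW.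
have f1 : 0 <= x1 by exact: frobenius_ge0.
have f5 : 0 <= x5 by exact: frobenius_ge0.
have y1 : 0 <= x1 ^+ 2 / e1 ^+ 2 by apply: q0; rewrite ?sqr_ge0 ?exprn_gt0.
have y2 : 0 <= x2 / M1 by apply: q0; rewrite ?sqr_ge0.
have y3 : 0 <= x3 / M2.
  by apply: q0 => //; apply: mulr_ge0; rewrite ?invr_ge0 // sumr_ge0 // => *; exact: sqr_ge0.
have y4 : 0 <= x4 / M3.
  apply: q0 => //; apply: mulr_ge0; rewrite ?invr_ge0 // sumr_ge0 // => *.
  by rewrite exprn_ge0 // frobenius_ge0.
have y5 : 0 <= x5 ^+ 2 / e2 ^+ 2 by apply: q0; rewrite ?sqr_ge0 ?exprn_gt0.
have lt1 (u e : R) : 0 < e -> u / e < 1 -> u <= e.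
  by move=> e0; rewrite ltr_pdivrMr // mul1r => /ltW.
have sq (u e : R) : 0 <= u -> 0 < e -> u ^+ 2 <= e ^+ 2 -> u <= e.
  by move=> u0 e0; rewrite ler_sqr // nnegrE ltW.
split; first by lra.
move=> h; split.
- by apply: sq => //; apply: lt1; [rewrite exprn_gt0|lra].
- by apply: lt1 => //; lra.
- by apply: lt1 => //; lra.
- by apply: lt1 => //; lra.
- by apply: sq => //; apply: lt1; [rewrite exprn_gt0|lra].
Qed.
(** [S] is one realized sketch and [s] an independent source for the reference law of W. The
    good-sketch bounds make the empirical covariance and third moments of [S] close enough for the
    two laws to be exchanged. *)
Lemma good_sketch_mass (R : realType) (disp : measure_display)
    (T : measurableType disp) (P : probability T R) (n d m : nat)
    (s : 'I_m -> T -> 'cV[R]_n) (X : 'M[R]_(n, d)) (y : 'cV[R]_n) (lam : R)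
    (S : 'I_m -> 'cV[R]_n) (Om : 'M[R]_d) (K e1 e2 M1 M2 M3 M r a eta : R)
    (psi := influence X y lam) (rm := Num.sqrt m%:R)
    (Cf := 1600 * M ^+ 3 / (6 * eta ^+ 3)) :
  (0 < m)%N -> 0 < lam -> centred_rows P s psi Om K ->
  frobenius (resolvent (gram X) lam) <= K -> 0 < e1 -> K * e1 <= 2^-1 ->
  frobenius (m%:R^-1 *: \sum_i outer_dev X (S i)) <= e1 ->
  frobenius (scaled_sum psi S) ^+ 2 <= M1 ->
  m%:R^-1 * \sum_i frobenius (outer_dev X (S i)) ^+ 2 <= M2 ->
  m%:R^-1 * \sum_i frobenius (psi (S i)) ^+ 4 <= M3 ->
  frobenius (m%:R^-1 *: \sum_i (psi (S i) *m (psi (S i))^T - Om)) <= e2 ->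
  0 < eta -> 1 <= M -> a + 4 * eta <= M -> 0 <= r ->
  ((1 + 2 * (K * e1)) * r + 2 * (K * e1) * Num.sqrt M1) ^+ 2 <= a + eta ->
  \sum_(v | boot_error X y lam S (weight v) < r / rm) multinomial_pmf R (weight v) <=
  mean P (fun t => soft_ball (a + eta) eta (scaled_sum psi (s^~ t))) +
  Cf * (d%:R * (e2 + M1 / m%:R) +
        (1 + K + 4 * (1 + M3 + (1 + M1 ^+ 2))) / rm) + M2 / (m%:R * e1 ^+ 2).
Proof.
move=> m0 lam0 cr AK e10 Ke h1 h2 h3 h4 h5 eta0 M1' aM r0 ha.
have mR0 : 0 < m%:R :> R by rewrite ltr0n.
have mR1 : 1 <= m%:R :> R by rewrite ler1n.
have rm0 : 0 < rm by rewrite sqrtr_gt0.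
set psibar := m%:R^-1 *: \sum_i psi (S i).
have hp : m%:R * frobenius psibar ^+ 2 <= M1 by rewrite -scaled_sum_sq.
have p2 : 0 <= frobenius psibar ^+ 2 by exact: sqr_ge0.
have pm : frobenius psibar ^+ 2 <= M1 / m%:R by rewrite ler_pdivlMr // mulrC.
have pM : frobenius psibar ^+ 2 <= M1.
  by apply: le_trans hp; rewrite ler_peMl.
have p3 : frobenius psibar ^+ 3 <= 1 + M1 ^+ 2.
  apply: le_trans (pow_le_fourth (frobenius_ge0 _) (isT : (3 <= 4)%N)) _.
  by rewrite lerD2l (exprM _ 2 2); apply: le_pow.
apply: le_trans (bootstrap_mass (K := K) (a := a) m0 lam0 AK e10 Ke h1 hp h3 eta0 r0 ha) _.
rewrite lerD2r.
have sf : smooth Cf (@soft_ball R d (a + eta) eta) by apply: smooth_soft_ball => //; lra.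
have := bootstrap_lindeberg (fun i => psi (S i)) m0 cr sf.
rewrite distrC ler_norml => /andP[_]; rewrite lerBlDl => /le_trans; apply.
rewrite lerD2l.
have Cf0 : 0 <= Cf.
  have M0 : 0 <= M := le_trans ler01 M1'.
  apply: divr_ge0; apply: mulr_ge0; [exact: ler0n|exact: exprn_ge0|exact: ler0n|].
  by apply: exprn_ge0; exact: ltW.
apply: ler_wpM2l => //; apply: lerD.
  apply: le_trans (empirical_cov_le Om (fun i => psi (S i)) m0) _.
  by rewrite ler_wpM2l // lerD.
rewrite ler_wpM2r ?invr_ge0 ?(ltW rm0) // lerD2l.
apply: le_trans (empirical_cube_le _ _ m0) _; rewrite ler_wpM2l //.
by rewrite lerD // lerD2l.
Qed.

Lemma good_sketch_error (R : realType) (n d m : nat) (X : 'M[R]_(n, d))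
    (y : 'cV[R]_n) (lam : R) (S : 'I_m -> 'cV[R]_n) (K e1 : R) :
  (0 < m)%N -> 0 < lam -> frobenius (resolvent (gram X) lam) <= K ->
  0 < e1 -> K * e1 <= 2^-1 ->
  frobenius (m%:R^-1 *: \sum_i outer_dev X (S i)) <= e1 ->
  Num.sqrt m%:R * frobenius (sketched_ridge X y lam S - ridge X y lam) <=
    (1 + 2 * (K * e1)) * frobenius (scaled_sum (influence X y lam) S).
Proof.
move=> m0 lam0 AK e10 Ke De.
have rm0 : 0 < Num.sqrt m%:R :> R by rewrite sqrtr_gt0 ltr0n.
have K0 : 0 <= K by apply: le_trans AK; exact: frobenius_ge0.
have [h _] := perturbed_le AK De (sketched_expand X y S m0 lam0).
have Ke0 : 0 <= K * e1 by rewrite mulr_ge0 // ltW.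
have -> : frobenius (scaled_sum (influence X y lam) S) =
    Num.sqrt m%:R * frobenius (m%:R^-1 *: \sum_i influence X y lam (S i)).
  apply/eqP; rewrite -(@eqrXn2 _ 2) ?frobenius_ge0 ?mulr_ge0 ?frobenius_ge0 ?(ltW rm0) //.
  by rewrite scaled_sum_sq // exprMn [Num.sqrt m%:R ^+ 2]sqr_sqrtr ?ler0n.
rewrite mulrCA ler_pM2l //.
move: h; move: (frobenius _) (frobenius_ge0 (sketched_ridge X y lam S - ridge X y lam)) => x x0.
move: (frobenius _) => u; move: (K * e1) Ke Ke0 => w Ke Ke0 h.
(* For 0 <= w <= 1/2 one has (1 + 2w)(1 - w) >= 1, which inverts the linearization. *)
apply: (@le_trans _ _ ((1 + 2 * w) * ((1 - w) * x))).
  by rewrite [leRHS]mulrA ler_peMl //; nra.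
by rewrite ler_wpM2l // addr_ge0 // mulr_ge0.
Qed.

(** The radius is sought on the grid of multiples of [eta]: the first point whose tail drops to
    [alpha + 2 * kappa]. Its predecessor still has a larger tail, which gives the two-sided control
    without continuity of the law. *)
Lemma quantile_radius (R : realType) (disp : measure_display)
    (T : measurableType disp) (P : probability T R) (Y : T -> R)
    (V alpha kappa eta M : R) :
  L1 P Y -> (forall t, 0 <= Y t) -> mean P Y <= V ->
  0 < alpha -> 0 < kappa -> alpha + 3 * kappa < 1 -> 0 < eta -> 0 <= M ->
  (forall b, b <= M -> mean P \1_[set t | b < Y t <= b + 5 * eta] <= kappa) ->
  exists a, [/\ eta <= a, a <= V / alpha + eta,
    mean P \1_[set t | a < Y t] <= alpha + 2 * kappa
  & alpha + 2 * kappa < mean P \1_[set t | a - eta < Y t]].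
Proof.
move=> LY Y0 YV al0 ka0 ak eta0 M0 anti.
have mY := L1_measurable LY.
have mgt (a : R) : measurable [set t | a < Y t] by exact: measurable_lt_set.
have V0 : 0 <= V by apply: le_trans YV; exact: mean_ge0.
have mark a : 0 < a -> mean P \1_[set t | a < Y t] <= V / a.
  move=> a0; apply: (@le_trans _ _ (mean P (fun t => a^-1 * Y t))).
    apply: mean_le => [||t]; [exact: integrable_indic|exact: L1Z|].
    rewrite indicE; case: (boolP (t \in _)) => [/set_mem /= h|_].
      by rewrite mulrC ler_pdivlMr // mul1r ltW.
    by rewrite mulr_ge0 // invr_ge0 ltW.
  by rewrite meanZ // mulrC ler_wpM2r // invr_ge0 ltW.
pose Q (j : nat) := mean P \1_[set t | j%:R * eta < Y t] <= alpha + 2 * kappa.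
have exQ : exists j, Q j.
  exists (Num.truncn (V / alpha / eta)).+1.
  set j := _.+1; have hj : V / alpha < j%:R * eta.
    by rewrite -ltr_pdivrMr //; exact: truncnS_gt.
  have je0 : 0 < j%:R * eta by rewrite mulr_gt0 // ltr0n.
  apply: le_trans (mark _ je0) _; apply: (@le_trans _ _ alpha); last lra.
  by rewrite ler_pdivrMr // mulrC -ler_pdivrMr // ltW.
case: (ex_minnP exQ) => -[|j] Qj minj.
  (* If the grid point 0 already qualified, nearly all the mass would sit at 0, inside the thin
     annulus from [- eta]. That would force [1 <= alpha + 3 * kappa]. *)
  have /anti h : - eta <= M by lra.
  have mA : measurable [set t | - eta < Y t <= - eta + 5 * eta].
    rewrite (_ : [set t | _] = [set t | - eta < Y t] `&` [set t | Y t <= - eta + 5 * eta]).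
      by apply: measurableI => //; exact: measurable_le_set.
    by apply/seteqP; split=> t /=; [move=> /andP|move=> ?; apply/andP].
  have : 1 <= alpha + 3 * kappa; last by lra.
  rewrite -[leLHS](mean_cst P).
  apply: (@le_trans _ _ (mean P (fun t => \1_[set t | 0%:R * eta < Y t] t +
     \1_[set t | - eta < Y t <= - eta + 5 * eta] t))).
    apply: mean_le => [||t]; [exact: L1_cst|by apply: L1D; exact: integrable_indic|].
    have [h0|h0] := ltP 0 (Y t).
      by rewrite indicE mem_set ?lerDl //= mul0r.
    by rewrite [X in _ <= _ + X]indicE mem_set ?lerDr //=; apply/andP; split; have := Y0 t; lra.
  rewrite meanD; [|exact: integrable_indic|exact: integrable_indic].
  by move: Qj h; rewrite /Q; lra.
exists (j.+1%:R * eta).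
have Qj' : alpha + 2 * kappa < mean P \1_[set t | j%:R * eta < Y t].
  by rewrite ltNge; apply/negP => h; have := minj j h; rewrite ltnn.
have e : j.+1%:R * eta - eta = j%:R * eta by rewrite -natr1; ring.
split=> //; last by rewrite e.
- by rewrite ler_peMl ?ler1n //; exact: ltW.
(* The previous grid point has a tail above [alpha], so Markov's inequality bounds it by
   [V / alpha]. *)
- rewrite -lerBlDr e; case: j {Qj minj e} Qj' => [|j] Qj'.
    rewrite mul0r; apply: divr_ge0 => //; exact: ltW.
  have j0 : 0 < j.+1%:R * eta by rewrite mulr_gt0 // ltr0n.
  rewrite ler_pdivlMr // mulrC -ler_pdivlMr //.
  by apply: le_trans (mark _ j0); apply: le_trans (ltW Qj'); lra.
Qed.
(** The fixed [r] sits between error and bound. [U] collects the sketches whose error may exceed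
    [r], and [bad], at least 1 on unusable sketches, bounds their indicator. *)
Lemma coverage_of_good_sketch (R : realType) (disp : measure_display)
    (T : measurableType disp) (P : probability T R) (n d m B : nat)
    (X : 'M[R]_(n, d)) (y : 'cV[R]_n) (lam alpha delta r : R)
    (s : 'I_m -> T -> 'cV[R]_n) (w : 'I_B -> T -> {ffun 'I_m -> nat})
    (bad : ('I_m -> 'cV[R]_n) -> R) (U : set T)
    (err := fun t => frobenius (sketched_ridge X y lam (s^~ t) - ridge X y lam)) :
  (0 < m)%N -> 0 < lam -> 0 < alpha < 1 -> 0 < delta < 1 ->
  iid_rows P s -> boot_weights P s w ->
  measurable U -> L1 P (fun t => bad (s^~ t)) -> (forall S, 0 <= bad S) ->
  (forall t, bad (s^~ t) < 1 -> ~ U t -> err t <= r) ->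
  (forall t, bad (s^~ t) < 1 ->
     \sum_(v | boot_error X y lam (s^~ t) (weight v) < r)
        multinomial_pmf R (weight v) <= 1 - alpha) ->
  1 - delta - 2 * mean P (fun t => bad (s^~ t)) - mean P \1_U <=
  fine (P [set t | ((err t)%:E <=
    mc_bound alpha delta (fun b => boot_error X y lam (s^~ t) (w b t)))%E]).
Proof.
move=> m0 lam0 al de iid bw mU Lbad bad0 hU hmass.
pose T' : measurableType _ := g_sigma_algebraType (rows_sigma s setT).
have ms i : @mx_measurable R _ T' n 1 (s i) by exact: sketch_mx_measurable.
have me v : measurable_fun (setT : set T') (fun t => boot_error X y lam (s^~ t) v).
  exact: (@measurable_boot_error R _ T' n d m X y lam (fun t => s^~ t) v lam0 ms).
have merr : measurable_fun (setT : set T') err.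
  exact: (@measurable_sketched_error R _ T' n d m X y lam (fun t => s^~ t) _ lam0 ms).
have up D : sketch_sigma s D -> measurable D.
  by rewrite sketch_sigmaE => /(rows_sigma_measurable iid).
pose G (q : T -> R) (v : 'I_B -> {ffun 'I_m -> nat}) : set T := [set t |
   ((q t)%:E <= mc_bound alpha delta (fun b => boot_error X y lam (s^~ t) (v b)))%E].
have sG q v : measurable_fun (setT : set T') q -> sketch_sigma s (G q v).
  move=> mq; rewrite sketch_sigmaE.
  exact: (@measurable_mc_bound_ge R _ T' B alpha delta q
    (fun b t => boot_error X y lam (s^~ t) (v b)) al mq (fun b => me (v b))).
pose D := [set t | err t <= r].
have sD : sketch_sigma s D.
  by rewrite sketch_sigmaE; apply: (@measurable_le_set R _ T').
have mD := up _ sD.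
have mr : measurable_fun (setT : set T') (fun=> r) by exact: measurable_cst.
have sGr v := sG (fun=> r) v mr.
have mcov : measurable [set t | G err (w^~ t) t].
  by apply: (measurable_weights_event iid bw) => v; exact: sG.
have mGr : measurable [set t | G (fun=> r) (w^~ t) t].
  exact: (measurable_weights_event iid bw sGr).
set F := mean P (fun t => bad _).
have Lf (f : {ffun 'I_B -> {ffun 'I_m -> 'I_m.+1}}) :
    L1 P (fun t => \1_(G (fun=> r) (fun b => weight (f b))) t * \1_D t).
  rewrite (_ : (fun t => _) = \1_(G (fun=> r) (fun b => weight (f b)) `&` D));
    last by rewrite indicI.
  exact: integrable_indic (measurableI _ _ (up _ (sGr _)) mD).
have LU : L1 P \1_U by exact: integrable_indic.
apply: (@le_trans _ _ (fine (P ([set t | G (fun=> r) (w^~ t) t] `&` D)))); last first.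
  apply: fine_le; rewrite ?fin_num_measure //; first exact: measurableI.
  apply: le_measure; rewrite ?inE //; first exact: measurableI.
  by move=> t [h1 h2]; apply: le_trans h1; rewrite lee_fin.
rewrite (weights_disintegration m0 iid bw sGr sD).
set H := fun t => \sum_f _.
have LH : L1 P H by apply: L1_sum => f _; apply: L1Z; exact: Lf.
have LB : L1 P (fun t => 2 * bad (s^~ t)) by exact: L1Z.
have L1d : L1 P (fun=> 1 - delta) by exact: L1_cst.
have -> : 1 - delta - 2 * F - mean P \1_U =
   mean P (fun t => (1 - delta) - 2 * bad (s^~ t) - \1_U t).
  by rewrite (meanB (L1B L1d LB) LU) (meanB L1d LB) mean_cst (meanZ _ Lbad).
apply: mean_le => [||t]; [exact: L1B (L1B L1d LB) LU|exact: LH|].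
have H0 : 0 <= H t.
  apply: sumr_ge0 => f _; apply: mulr_ge0; last exact: mulr_ge0.
  by apply: prodr_ge0 => b _; exact: multinomial_ge0.
have U0 : 0 <= \1_U t :> R by [].
have b0 := bad0 (s^~ t); have /andP[d0 d1] := de.
(* On unusable sketches and on [U] the left side is at most 0, so only the remaining sketches need
   the counting argument. *)
have [hb|hb] := leP 1 (bad (s^~ t)); first by lra.
have [tU|tU] := boolP (t \in U).
  by rewrite indicE tU; move: H0 b0 d0 d1; rewrite mulr1n; lra.
have tD : \1_D t = 1 :> R.
  by rewrite indicE mem_set //; apply: hU => //; move=> /mem_set; exact/negP.
have := mc_bound_coverage B al d0 (fun v => multinomial_ge0 R (weight v))
  (multinomial_sum1 R m0) (hmass t hb).
set H' := \sum_f _; have -> : H' = H t; last by lra.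
apply: eq_bigr => f _; rewrite tD mulr1 indicE; congr (_ * (nat_of_bool _)%:R).
case: (boolP (t \in _)) => [/set_mem /= -> //|/negP h].
by apply: contra_notF h => h; exact: mem_set.
Qed.
(** With u and v the two square roots, the excess is at most 3 t (u + v)^2, and (u + v)^2 <= 2 (M +
    M1); hence the factor 6. *)
Lemma inflate_le (R : rcfType) (a M1 M eta t : R) :
  0 <= a -> a <= M -> 0 <= M1 -> 0 <= t -> t <= 1 -> 6 * t * (M + M1) <= eta ->
  ((1 + t) * Num.sqrt a + t * Num.sqrt M1) ^+ 2 <= a + eta.
Proof.
move=> a0 aM M10 t0 t1 h.
have u2 := sqr_sqrtr a0; have v2 := sqr_sqrtr M10.
move: (Num.sqrt a) (Num.sqrt M1) (sqrtr_ge0 a) (sqrtr_ge0 M1) u2 v2 => u v u0 v0 u2 v2.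
have e1 : ((1 + t) * u + t * v) ^+ 2 =
   u ^+ 2 + (2 * t * (u * (u + v)) + t ^+ 2 * (u + v) ^+ 2) by ring.
rewrite e1 u2 lerD2l; apply: le_trans h.
have uv : u * (u + v) <= (u + v) ^+ 2 by rewrite expr2 ler_wpM2r ?addr_ge0 // lerDl.
have tt : t ^+ 2 * (u + v) ^+ 2 <= t * (u + v) ^+ 2.
  by rewrite ler_wpM2r ?sqr_ge0 // expr2 ler_piMr.
have sq : (u + v) ^+ 2 <= 2 * (M + M1).
  have := sqr_ge0 (u - v); have -> : (u - v) ^+ 2 = u ^+ 2 - 2 * (u * v) + v ^+ 2 by ring.
  have -> : (u + v) ^+ 2 = u ^+ 2 + 2 * (u * v) + v ^+ 2 by ring.
  by rewrite u2 v2; lra.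
apply: (@le_trans _ _ (3 * t * (u + v) ^+ 2)).
  have : 2 * t * (u * (u + v)) <= 2 * t * (u + v) ^+ 2 by rewrite ler_wpM2l // mulr_ge0.
  lra.
have -> : 6 * t * (M + M1) = 3 * t * (2 * (M + M1)) by ring.
by rewrite ler_wpM2l // mulr_ge0.
Qed.

Lemma deflate_le (R : rcfType) (a x M eta t : R) :
  0 <= x -> x ^+ 2 <= a - eta -> a <= M -> 0 <= eta -> 0 <= t -> t <= 1 ->
  6 * t * M <= eta -> (1 + t) * x <= Num.sqrt a.
Proof.
move=> x0 hx aM eta0 t0 t1 h.
have x2 : 0 <= x ^+ 2 by exact: sqr_ge0.
have a0 : 0 <= a by lra.
have tM : t * x ^+ 2 <= t * M by rewrite ler_wpM2l //; lra.
rewrite -ler_sqr ?nnegrE ?mulr_ge0 ?sqrtr_ge0 ?addr_ge0 // sqr_sqrtr //.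
have -> : ((1 + t) * x) ^+ 2 = x ^+ 2 + 2 * (t * x ^+ 2) + t * (t * x ^+ 2) by ring.
have : t * (t * x ^+ 2) <= t * x ^+ 2 by rewrite ler_piMl // mulr_ge0.
lra.
Qed.

(** One threshold serves every numerator up to [G], so all error terms can share it. *)
Lemma eventually_small (R : realType) (G kappa : R) : 0 <= G -> 0 < kappa ->
  exists m0, forall m g, (m0 <= m)%N -> (0 < m)%N -> 0 <= g -> g <= G ->
    g / Num.sqrt m%:R <= kappa /\ g / m%:R <= kappa.
Proof.
move=> G0 k0; exists (Num.truncn ((G / kappa) ^+ 2)).+1 => m g m0m m0 g0 gG.
have hm : (G / kappa) ^+ 2 <= m%:R.
  apply: le_trans (ltW (truncnS_gt _)) _; by rewrite ler_nat.
have mR1 : 1 <= m%:R :> R by rewrite ler1n.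
have rm1 : 1 <= Num.sqrt m%:R :> R by rewrite -[leLHS]sqrtr1 ler_wsqrtr.
have rm0 : 0 < Num.sqrt m%:R :> R by apply: lt_le_trans rm1.
have h : g / Num.sqrt m%:R <= kappa.
  rewrite ler_pdivrMr // mulrC -ler_pdivrMr //; apply: (@le_trans _ _ (G / kappa)).
    by rewrite ler_wpM2r // invr_ge0 ltW.
  rewrite -ler_sqr ?nnegrE ?sqrtr_ge0 ?divr_ge0 ?(ltW k0) // sqr_sqrtr //.
split=> //; apply: le_trans h; rewrite ler_wpM2l // lef_pV2 ?posrE //; last first.
  by apply: lt_le_trans mR1.
by rewrite -[leRHS](@sqr_sqrtr _ m%:R) // expr2 ler_peMl // ltW.
Qed.

Lemma annulus_measurable (R : realType) (disp : measure_display)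
    (T : measurableType disp) (Y : T -> R) (a b : R) :
  measurable_fun setT Y -> measurable [set t | a < Y t <= b].
Proof.
move=> mY; rewrite (_ : [set t | _] = [set t | a < Y t] `&` [set t | Y t <= b]).
  by apply: measurableI; [exact: measurable_lt_set|exact: measurable_le_set].
by apply/seteqP; split=> u /=; [move=> /andP|move=> ?; apply/andP].
Qed.

Lemma mean_gt_split (R : realType) (disp : measure_display)
    (T : measurableType disp) (P : probability T R) (Y : T -> R) (a eta : R) :
  measurable_fun setT Y -> 0 < eta ->
  mean P \1_[set t | a - eta < Y t] <=
  mean P \1_[set t | a < Y t] + mean P \1_[set t | a - eta < Y t <= a - eta + 5 * eta].
Proof.
move=> mY eta0.
have LG b : L1 P \1_[set t | b < Y t] by apply: integrable_indic; exact: measurable_lt_set.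
have LA b c : L1 P \1_[set t | b < Y t <= c].
  by apply: integrable_indic; exact: annulus_measurable.
rewrite -(meanD (LG _) (LA _ _)); apply: mean_le (LG _) (L1D (LG _) (LA _ _)) _ => u.
rewrite [leLHS]indicE; case: (boolP (u \in _)) => [/set_mem /= h|_]; last by rewrite addr_ge0.
have [h'|h'] := ltP a (Y u); first by rewrite [X in X + _]indicE mem_set // lerDl.
by rewrite [X in _ + X]indicE mem_set ?lerDr //=; apply/andP; split=> //; lra.
Qed.

(** The soft ball vanishes beyond [a + 4 * eta], so it exceeds the hard ball of squared radius
    [a - eta] only on an annulus of width [5 * eta]. *)
Lemma mean_soft_ball_le (R : realType) (disp : measure_display)
    (T : measurableType disp) (P : probability T R) (d : nat) (W : T -> 'cV[R]_d)
    (a eta : R) (Y := fun t => frobenius (W t) ^+ 2) :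
  measurable_fun setT Y -> measurable_fun setT (fun t => soft_ball (a + eta) eta (W t)) ->
  0 < eta ->
  mean P (fun t => soft_ball (a + eta) eta (W t)) <=
  1 - mean P \1_[set t | a - eta < Y t] +
  mean P \1_[set t | a - eta < Y t <= a - eta + 5 * eta].
Proof.
move=> mY ms eta0.
have LG b : L1 P \1_[set t | b < Y t] by apply: integrable_indic; exact: measurable_lt_set.
have LA b c : L1 P \1_[set t | b < Y t <= c].
  by apply: integrable_indic; exact: annulus_measurable.
have Ls : L1 P (fun t => soft_ball (a + eta) eta (W t)).
  apply: (L1_bounded _ (c := 1)) => // u.
  by have [/andP[h1 h2] _ _] := soft_ballP (a + eta) (W u) eta0; rewrite ger0_norm.
have L1G b : L1 P (fun t => 1 - \1_[set t | b < Y t] t) by exact: L1B (L1_cst P 1) (LG _).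
rewrite -[X in X - _](mean_cst P) -(meanB (L1_cst P 1) (LG _)) -(meanD (L1G _) (LA _ _)).
apply: mean_le Ls (L1D (L1G _) (LA _ _)) _ => u.
have [/andP[h1 h2] _ h3] := soft_ballP (a + eta) (W u) eta0.
rewrite !indicE; case: (boolP (u \in [set t | a - eta < Y t])) => [/set_mem /= h|_]; last first.
  by rewrite subr0 (le_trans h2) // lerDl.
have [h'|h'] := leP (Y u) (a - eta + 5 * eta).
  by rewrite mem_set /= ?h ?h' // subrK.
by rewrite h3 ?subrr ?add0r //; move: h'; rewrite /Y; lra.
Qed.

(** The threshold [m0] is chosen before the probability space, the design and the covariance. This
    uniformity makes the passage to the limit immediate. *)
Theorem finite_coverage (R : realType) (d : nat) (alpha delta kappa K c : R) :
  0 < alpha < 1 -> 0 < delta < 1 -> 0 < kappa -> alpha + 3 * kappa < 1 ->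
  1 <= K -> 0 < c ->
  exists m0, forall (disp : measure_display) (T : measurableType disp)
    (P : probability T R) (n m B : nat) (X : 'M[R]_(n, d)) (y : 'cV[R]_n) (lam : R)
    (s : 'I_m -> T -> 'cV[R]_n) (w : 'I_B -> T -> {ffun 'I_m -> nat})
    (Om : 'M[R]_d) (a : 'I_d),
  (m0 <= m)%N -> (0 < m)%N -> 0 < lam -> boot_weights P s w ->
  centred_rows P s (influence X y lam) Om K ->
  centred_matrices P s (outer_dev X) K ->
  frobenius (resolvent (gram X) lam) <= K -> frobenius Om <= K -> c <= Om a a ->
  1 - alpha - delta - 5 * kappa <=
  fine (P [set t | ((frobenius (sketched_ridge X y lam (s^~ t) - ridge X y lam))%:E <=
    mc_bound alpha delta (fun b => boot_error X y lam (s^~ t) (w b t)))%E]).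
Proof.
move=> al de ka0 ak K1 c0; have /andP[al0 al1] := al.
have K0 : 0 < K by apply: lt_le_trans K1.
pose V : R := d%:R * (1 + K).
have V0 : 0 <= V by rewrite mulr_ge0 // addr_ge0 // ltW.
have Va0 : 0 <= V / alpha by rewrite divr_ge0 // ltW.
(* The radius is at most [V / alpha + eta] with [eta <= 1]; the 10 covers the margins of up to
   [8 * eta] around it. *)
pose M := V / alpha + 10; have M1_ : 1 <= M by rewrite /M; lra.
(* The 44 makes the random-walk term 2 sqrt(11 eta / (4 c)) at most [kappa / 2]. *)
pose eta := Num.min 1 (c * kappa ^+ 2 / 44).
have eta0 : 0 < eta.
  by rewrite lt_min ltr01 /= divr_gt0 // mulr_gt0 // exprn_gt0.
have eta1 : eta <= 1 by rewrite ge_min lexx.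
have etac : eta <= c * kappa ^+ 2 / 44 by rewrite ge_min lexx orbT.
pose Cf := 1600 * M ^+ 3 / (6 * eta ^+ 3).
have Cf0 : 0 <= Cf.
  apply: divr_ge0; apply: mulr_ge0; [exact: ler0n| |exact: ler0n|].
    by apply: exprn_ge0; apply: le_trans ler01 M1_.
  by apply: exprn_ge0; exact: ltW.
pose g1 := 2 + 2 * Cf * ((1 + K) + 4 * ((frobenius (1%:M : 'M[R]_d) + K / c) ^+ 3 * (1 + K) +
     (K / Num.sqrt c) ^+ 3)).
have sc : 2 * Num.sqrt (11 * eta / (4 * c)) <= kappa / 2.
  have k4 : 0 <= kappa / 4 by rewrite divr_ge0 // ltW.
  have h : Num.sqrt (11 * eta / (4 * c)) <= Num.sqrt ((kappa / 4) ^+ 2).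
    rewrite ler_wsqrtr // ler_pdivrMr; last by rewrite mulr_gt0.
    have -> : (kappa / 4) ^+ 2 * (4 * c) = 11 * (c * kappa ^+ 2 / 44) by field.
    by rewrite ler_wpM2l.
  by move: h; rewrite sqrtr_sqr (ger0_norm k4); lra.
have q0 (u v : R) : 0 <= u -> 0 < v -> 0 <= u / v by move=> u0 v0; rewrite divr_ge0 // ltW.
(* Each of the five Markov ratios in [sketch_defect] gets a share [kappa / 5]. The added 1 keeps
   [Mw] positive when [V] is 0. *)
pose Mw := 5 * V / kappa + 1; pose Mz := 5 * K / kappa.
have Mw0 : 0 < Mw by apply: ltr_wpDl => //; apply: q0 => //; exact: mulr_ge0.
have Mz0 : 0 < Mz by rewrite divr_gt0 // mulr_gt0.
(* Next, [e1] is fixed so that the relative linearization error [t = 2 * (K * e1)] satisfies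
   [6 * t * (M + Mw) = eta], the budget of [inflate_le]. *)
have MMw0 : 0 < M + Mw by rewrite addr_gt0 // (lt_le_trans ltr01).
pose e1 := eta / (12 * K * (M + Mw)).
have e10 : 0 < e1 by rewrite divr_gt0 // !mulr_gt0.
(* The covariance mismatch enters the comparison multiplied by [Cf * d%:R]; this choice holds it to
   [kappa / 4]. *)
pose e2 := kappa / (4 * (Cf * d%:R + 1)).
have Cfd0 : 0 <= Cf * d%:R by rewrite mulr_ge0.
have e20 : 0 < e2 by rewrite divr_gt0 // mulr_gt0 // ltr_wpDl.
pose t := 2 * (K * e1).
have tE : 6 * t * (M + Mw) = eta.
  by rewrite /t /e1; field; rewrite !gt_eqF.
have t0 : 0 <= t by apply: mulr_ge0 => //; apply: mulr_ge0; exact: ltW.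
have t1 : t <= 1.
  have : t * 6 <= t * (6 * (M + Mw)) by rewrite ler_wpM2l //; lra.
  by rewrite mulrA [t * 6]mulrC tE; lra.
have Ke : K * e1 <= 2^-1 by move: t1; rewrite /t; lra.
pose g2 := (d * d)%:R * K / e1 ^+ 2.
pose g3 := (d * d)%:R * (2 * K + 2 * K ^+ 2) / e2 ^+ 2.
pose g4 := Cf * (d%:R * Mw).
pose g5 := Cf * (1 + K + 4 * (1 + Mz + (1 + Mw ^+ 2))).
pose g6 := Mz / e1 ^+ 2.
have K0' := ltW K0.
have sqc0 : 0 < Num.sqrt c by rewrite sqrtr_gt0.
have g10 : 0 <= g1.
  rewrite /g1; apply: addr_ge0 => //; apply: mulr_ge0; first exact: mulr_ge0.
  apply: addr_ge0; first exact: addr_ge0.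
  apply: mulr_ge0 => //; apply: addr_ge0; last by apply: exprn_ge0; exact: q0.
  apply: mulr_ge0; last exact: addr_ge0.
  by apply: exprn_ge0; apply: addr_ge0; [exact: frobenius_ge0|exact: q0].
have g20 : 0 <= g2 by apply: q0; rewrite ?mulr_ge0 ?exprn_gt0.
have g30 : 0 <= g3.
  apply: q0; last by rewrite exprn_gt0.
  by apply: mulr_ge0 => //; apply: addr_ge0; apply: mulr_ge0 => //; exact: sqr_ge0.
have Mw0' := ltW Mw0; have Mz0' := ltW Mz0.
have g40 : 0 <= g4 by apply: mulr_ge0 => //; exact: mulr_ge0.
have g50 : 0 <= g5.
  apply: mulr_ge0 => //; apply: addr_ge0; first exact: addr_ge0.
  by apply: mulr_ge0 => //; apply: addr_ge0; apply: addr_ge0 => //; exact: sqr_ge0.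
have g60 : 0 <= g6 by apply: q0 => //; rewrite exprn_gt0.
pose G := g1 + g2 + g3 + g4 + g5 + g6.
have G0 : 0 <= G by move: g10 g20 g30 g40 g50 g60; rewrite /G; clear; lra.
have k5 : 0 < kappa / 5 by rewrite divr_gt0.
have [m0 small] := eventually_small G0 k5; exists m0.
move=> disp T P n m B X y lam s w Om a m0m mp lam0 bw cr cz AK OmK cOm.
have sm g := small m g m0m mp; have [iid mpsi L4 mean0 cov] := cr.
have mR0 : 0 < m%:R :> R by rewrite ltr0n.
have [s1 _] := sm g1 g10 ltac:(move: g10 g20 g30 g40 g50 g60; rewrite /G; clear; lra).
have [_ s2] := sm g2 g20 ltac:(move: g10 g20 g30 g40 g50 g60; rewrite /G; clear; lra).
have [_ s3] := sm g3 g30 ltac:(move: g10 g20 g30 g40 g50 g60; rewrite /G; clear; lra).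
have [_ s4] := sm g4 g40 ltac:(move: g10 g20 g30 g40 g50 g60; rewrite /G; clear; lra).
have [s5 _] := sm g5 g50 ltac:(move: g10 g20 g30 g40 g50 g60; rewrite /G; clear; lra).
have [_ s6] := sm g6 g60 ltac:(move: g10 g20 g30 g40 g50 g60; rewrite /G; clear; lra).
pose psi := influence X y lam; rewrite -/psi in cr mpsi L4 mean0 cov.
pose W t := scaled_sum psi (s^~ t); pose Y t := frobenius (W t) ^+ 2.
have Y0 u : 0 <= Y u by exact: sqr_ge0.
pose bad := @sketch_defect R n d m X y lam Om e1 e2 Mw Mz Mz.
have [Lbad] := sketch_defect_mean mp cr cz OmK e10 e20 Mw0 Mz0 Mz0.
rewrite -/bad => bad_le.
have {}bad_le : mean P (fun t => bad (s^~ t)) <= kappa.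
  apply: (le_trans bad_le); rewrite -/V.
  have -> : (d * d)%:R * K / m%:R / e1 ^+ 2 = g2 / m%:R.
    by rewrite /g2; field; rewrite !gt_eqF.
  have -> : (d * d)%:R * (2 * K + 2 * K ^+ 2) / m%:R / e2 ^+ 2 = g3 / m%:R.
    by rewrite /g3; field; rewrite !gt_eqF.
  have h1 : V / Mw <= kappa / 5.
    rewrite ler_pdivrMr // /Mw mulrDr mulr1.
    have -> : kappa / 5 * (5 * V / kappa) = V by field; rewrite gt_eqF.
    by rewrite lerDl; exact: ltW.
  have h2 : K / Mz = kappa / 5 by rewrite /Mz; field; rewrite !gt_eqF.
  by move: s2 s3 h1 ka0; rewrite h2; clear; lra.
have mY : measurable_fun setT Y.
  exact: (measurable_scaled_sum iid mpsi (@measurable_frobenius_sq R d)).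
have [LY YV] : L1 P Y /\ mean P Y <= V.
  have [h1 h2] := row_avg_frobenius (phi := psi) mp iid
    (fun a (b : 'I_1) => ltac:(rewrite (ord1 b); exact: mpsi))
    (fun i => centred_rows_moments i cr (isT : (2 <= 4)%N))
    (fun i a (b : 'I_1) => ltac:(rewrite (ord1 b); exact: mean0)).
  have YE : Y = fun t => m%:R * frobenius (m%:R^-1 *: \sum_i psi (s i t)) ^+ 2.
    by apply/funext => u; rewrite /Y /W scaled_sum_sq.
  rewrite YE; split; first exact: L1Z.
  rewrite meanZ // -ler_pdivlMl // mulrC; apply: (le_trans h2).
  by rewrite muln1.
have anti b : b <= M - 8 * eta -> mean P \1_[set t | b < Y t <= b + 5 * eta] <= kappa.
  move=> bM; have bM' : b + 8 * eta <= M by move: bM; clear; lra.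
  apply: (le_trans (annulus_prob mp cr OmK c0 cOm eta0 M1_ bM')).
  by rewrite -/Cf -/g1; move: s1 sc ka0; clear; lra.
have M8 : 0 <= M - 8 * eta by rewrite /M; move: Va0 eta1; clear; lra.
have [rad [etar radV Qa Qb]] := quantile_radius LY Y0 YV al0 ka0 ak eta0 M8 anti.
have rad0 : 0 <= rad by exact: le_trans (ltW eta0) etar.
have radM : rad <= M by rewrite /M; move: radV eta1; clear; lra.
have mgt (b : R) : measurable [set t | b < Y t] by exact: measurable_lt_set.
have h_ann : mean P \1_[set t | rad - eta < Y t <= rad - eta + 5 * eta] <= kappa.
  by apply: anti; rewrite /M; move: radV eta1; clear; lra.
have hU : mean P \1_[set t | rad - eta < Y t] <= alpha + 3 * kappa.
  apply: (le_trans (mean_gt_split P rad mY eta0)).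
  by move: Qa h_ann; clear; lra.
have mass_le : mean P (fun t => soft_ball (rad + eta) eta (W t)) <= 1 - alpha - kappa.
  have sf : smooth Cf (@soft_ball R d (rad + eta) eta).
    by apply: smooth_soft_ball => //; rewrite /M; move: radV eta1; clear; lra.
  have ms := measurable_scaled_sum iid mpsi (measurable_smooth sf).
  apply: (le_trans (mean_soft_ball_le P mY ms eta0)).
  by move: Qb h_ann; clear; lra.
have rm0 : 0 < Num.sqrt m%:R :> R by rewrite sqrtr_gt0.
(* The failure event uses the smaller squared radius [rad - eta]: the gap [eta] absorbs the
   nonlinear part of the estimation error. *)
pose U := [set u | rad - eta < Y u].
have bad0 S : 0 <= bad S by have [] := sketch_defect_lt1 X y lam Om S e10 e20 Mw0 Mz0 Mz0.
have key := @coverage_of_good_sketch R disp T P n d m B X y lam alpha delta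
  (Num.sqrt rad / Num.sqrt m%:R) s w bad U mp lam0 al de iid bw (mgt _) Lbad bad0.
apply: le_trans (key _ _).
(* The loss of [5 * kappa] is [2 * kappa] for unusable sketches and [3 * kappa] beyond [alpha] for
   [U]. *)
- by move: hU bad_le; rewrite /U; clear; lra.
- move=> u bu /negP; rewrite -leNgt => Yu.
  have [_ /(_ bu) [De _ _ _ _]] := sketch_defect_lt1 X y lam Om (s^~ u) e10 e20 Mw0 Mz0 Mz0.
  rewrite ler_pdivlMr // mulrC.
  apply: le_trans (good_sketch_error y mp lam0 AK e10 Ke De) _.
  apply: (@deflate_le _ _ _ M eta) => //; [exact: frobenius_ge0|exact: ltW|].
  by rewrite -tE; apply: ler_wpM2l; [apply: mulr_ge0|rewrite lerDl ltW].
- move=> u bu.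
  have [_ /(_ bu) [D1 D2 D3 D4 D5]] := sketch_defect_lt1 X y lam Om (s^~ u) e10 e20 Mw0 Mz0 Mz0.
  have aM : rad + 4 * eta <= M by rewrite /M; move: radV eta1; clear; lra.
  have infl : ((1 + t) * Num.sqrt rad + t * Num.sqrt Mw) ^+ 2 <= rad + eta.
    by apply: (@inflate_le _ _ _ M) => //; rewrite tE.
  apply: le_trans (good_sketch_mass mp lam0 cr AK e10 Ke D1 D2 D3 D4 D5 eta0 M1_ aM
    (sqrtr_ge0 _) infl) _.
  rewrite -/Cf -/psi.
  have e2k : Cf * d%:R * e2 <= kappa / 4.
    rewrite /e2 mulrA ler_pdivrMr; last by rewrite mulr_gt0 // ltr_wpDl.
    have -> : kappa / 4 * (4 * (Cf * d%:R + 1)) = Cf * d%:R * kappa + kappa by field.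
    by rewrite lerDl ltW.
  have E4 : Cf * (d%:R * (e2 + Mw / m%:R) +
        (1 + K + 4 * (1 + Mz + (1 + Mw ^+ 2))) / Num.sqrt m%:R) =
      Cf * d%:R * e2 + g4 / m%:R + g5 / Num.sqrt m%:R.
    by rewrite /g4 /g5; ring.
  have E6 : Mz / (m%:R * e1 ^+ 2) = g6 / m%:R by rewrite /g6; field; rewrite !gt_eqF.
  by rewrite E4 E6; move: mass_le e2k s4 s5 s6 ka0; rewrite /W; clear; lra.
Qed.

(** * Passage to the limit *)

(** The form at [v + t *: w] is a nonnegative quadratic in [t]; its minimum gives the inequality
    when [c > 0]. *)
Lemma psd_cauchy_schwarz (R : realType) (d : nat) (N : 'M[R]_d) (v w : 'rV[R]_d) :
  N^T = N -> (forall u : 'rV[R]_d, 0 <= (u *m N *m u^T) 0 0) ->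
  (v *m N *m w^T) 0 0 ^+ 2 <= (v *m N *m v^T) 0 0 * (w *m N *m w^T) 0 0.
Proof.
move=> sN pN; set a := (v *m N *m v^T) 0 0; set c := (w *m N *m w^T) 0 0.
set b := (v *m N *m w^T) 0 0.
have sb : (w *m N *m v^T) 0 0 = b.
  by rewrite /b -[v *m N *m w^T]trmxK [RHS]mxE !trmx_mul trmxK sN mulmxA.
have q t : 0 <= a + 2 * t * b + t ^+ 2 * c.
  have := pN (v + t *: w).
  have -> : (v + t *: w) *m N *m (v + t *: w)^T = v *m N *m v^T + t *: (v *m N *m w^T) +
      (t *: (w *m N *m v^T) + t *: (t *: (w *m N *m w^T))).
    have -> : (v + t *: w) *m N = v *m N + t *: (w *m N) by rewrite mulmxDl -scalemxAl.
    have -> : (v + t *: w)^T = v^T + t *: w^T by rewrite raddfD /= linearZ.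
    rewrite mulmxDl !mulmxDr -!scalemxAr.
    by rewrite -(scalemxAl t (w *m N) v^T) -(scalemxAl t (w *m N) w^T).
  have -> : a + 2 * t * b + t ^+ 2 * c = a + t * b + (t * (w *m N *m v^T) 0 0 + t * (t * c)).
    by rewrite sb; ring.
  rewrite /a /b /c; move: (v *m N *m v^T) (v *m N *m w^T) (w *m N *m v^T) (w *m N *m w^T).
  by move=> A1 A2 A3 A4; rewrite !mxE.
have a0 : 0 <= a by exact: pN.
have c0 : 0 <= c by exact: pN.
have [c00|cp] := leP c 0.
  have cE : c = 0 by apply/eqP; rewrite eq_le c00.
  have [->|b0] := eqVneq b 0; first by rewrite expr0n /= mulr_ge0.
  (* With [c = 0] the quadratic is affine; this [t] would give it the value -1 unless [b]
     vanishes. *)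
  have := q (- (a + 1) / (2 * b)); rewrite cE mulr0 addr0.
  have -> : a + 2 * (- (a + 1) / (2 * b)) * b = -1 by field.
  by lra.
have := q (- b / c).
have -> : a + 2 * (- b / c) * b + (- b / c) ^+ 2 * c = (a * c - b ^+ 2) / c.
  by field; rewrite gt_eqF.
by rewrite pmulr_lge0 ?invr_gt0 // subr_ge0.
Qed.

Lemma row_sq (R : realType) (d : nat) (v : 'rV[R]_d) : (v *m v^T) 0 0 = frobenius v ^+ 2.
Proof.
by rewrite frobenius_sq big_ord1 mxE; apply: eq_bigr => j _; rewrite mxE expr2.
Qed.

Lemma entry_le_frobenius (R : realType) (d : nat) (N : 'M[R]_d) (v w : 'rV[R]_d) :
  `|(v *m N *m w^T) 0 0| <= frobenius v * frobenius N * frobenius w.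
Proof.
apply: le_trans (le_frobenius _ _ _) _; apply: le_trans (frobeniusM _ _) _.
by rewrite frobenius_tr ler_wpM2r ?frobenius_ge0 // frobeniusM.
Qed.

Lemma frobenius_eq0 (R : realType) (p q : nat) (A : 'M[R]_(p, q)) :
  frobenius A = 0 -> A = 0.
Proof.
move=> h; apply/matrixP => i j; rewrite mxE; apply/eqP; rewrite -normr_eq0 eq_le normr_ge0 andbT.
by rewrite -h le_frobenius.
Qed.

(* Cauchy-Schwarz for the form of [N], applied to [v] and [v N^-1]. *)
Lemma psd_unit_margin (R : realType) (d : nat) (N : 'M[R]_d) :
  N^T = N -> (forall u : 'rV[R]_d, 0 <= (u *m N *m u^T) 0 0) -> N \in unitmx ->
  exists2 e, 0 < e & forall v : 'rV[R]_d, e * frobenius v ^+ 2 <= (v *m N *m v^T) 0 0.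
Proof.
move=> sN pN uN; pose f := frobenius (invmx N) + 1.
have f0 : 0 < f by rewrite ltr_wpDl // frobenius_ge0.
exists f^-1; first by rewrite invr_gt0.
move=> v; have [->|v0] := eqVneq v 0; first by rewrite !mul0mx mxE frobenius0 expr0n mulr0.
have vp : 0 < frobenius v.
  by rewrite lt_def frobenius_ge0 andbT; apply: contra_neq v0 => /frobenius_eq0.
have sI : (invmx N)^T = invmx N by rewrite trmx_inv sN.
have := psd_cauchy_schwarz v (v *m invmx N) sN pN.
have -> : v *m N *m (v *m invmx N)^T = v *m v^T.
  by rewrite trmx_mul sI mulmxA -(mulmxA v) mulmxV // mulmx1.
have -> : v *m invmx N *m N *m (v *m invmx N)^T = v *m invmx N *m v^T.
  by rewrite -(mulmxA v) mulVmx // mulmx1 trmx_mul sI mulmxA.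
rewrite row_sq => h; set Q := (v *m N *m v^T) 0 0 in h *.
have Q0 : 0 <= Q by exact: pN.
have h1 : (v *m invmx N *m v^T) 0 0 <= f * frobenius v ^+ 2.
  apply: le_trans (ler_norm _) _; apply: le_trans (entry_le_frobenius _ _ _) _.
  rewrite mulrAC -expr2 mulrC ler_wpM2r ?sqr_ge0 // lerDl.
  exact: ler01.
have h2 : (frobenius v ^+ 2) ^+ 2 <= Q * (f * frobenius v ^+ 2).
  by apply: le_trans h _; rewrite ler_wpM2l.
have v2 : 0 < frobenius v ^+ 2 by rewrite exprn_gt0.
rewrite ler_pdivrMl // -(ler_pM2r v2) -expr2; apply: (le_trans h2).
by rewrite mulrA [Q * f]mulrC.
Qed.

(* The supremum of the [l] for which [M - l] is positive semidefinite is an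
   eigenvalue: otherwise [psd_unit_margin] would allow a larger [l]. *)
Lemma least_eigenvalue_bound (R : realType) (d : nat) (M : 'M[R]_d) (c : R) (a0 : 'I_d) :
  M^T = M -> (forall u : 'rV[R]_d, 0 <= (u *m M *m u^T) 0 0) ->
  (forall a, eigenvalue M a -> c <= a) ->
  forall v : 'rV[R]_d, c * frobenius v ^+ 2 <= (v *m M *m v^T) 0 0.
Proof.
move=> sM pM eM.
pose S := [set l : R | forall v : 'rV[R]_d, l * frobenius v ^+ 2 <= (v *m M *m v^T) 0 0].
have S0 : S 0 by move=> v /=; rewrite mul0r.
have ubS : has_ubound S.
  exists (M a0 a0) => l /(_ (delta_mx 0 a0)).
  have -> : frobenius (delta_mx 0 a0 : 'rV[R]_d) ^+ 2 = 1.
    by rewrite -row_sq trmx_delta mul_delta_mx mxE !eqxx.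
  by rewrite -rowE trmx_delta -colE !mxE mulr1.
have supS : has_sup S by split; [exists 0|].
have Smu : S (sup S).
  move=> v /=; have [->|v0] := eqVneq v 0.
    by rewrite !mul0mx mxE frobenius0 expr0n mulr0.
  have v2 : 0 < frobenius v ^+ 2.
    rewrite exprn_gt0 // lt_def frobenius_ge0 andbT.
    by apply: contra_neq v0 => /frobenius_eq0.
  rewrite -ler_pdivlMr //; apply: ge_sup; first by exists 0.
  by move=> l /(_ v); rewrite ler_pdivlMr.
have qN (v : 'rV[R]_d) : (v *m (M - (sup S)%:M) *m v^T) 0 0 =
    (v *m M *m v^T) 0 0 - sup S * frobenius v ^+ 2.
  rewrite mulmxBr mulmxBl mul_mx_scalar -scalemxAl -row_sq.
  by move: (v *m M *m v^T) (v *m v^T) => A B; rewrite !mxE.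
have emu : eigenvalue M (sup S).
  apply: contrapT => nE.
  have uN : M - (sup S)%:M \in unitmx.
    rewrite -row_free_unit -kermx_eq0; apply/negPn/negP => h; apply: nE.
    by rewrite /eigenvalue /eigenspace.
  have [|u|e e0 he] := psd_unit_margin _ _ uN.
  - by rewrite linearB /= sM tr_scalar_mx.
  - by rewrite qN subr_ge0; exact: Smu.
  - have : S (sup S + e) by move=> v /=; have := he v; rewrite qN mulrDl lerBrDl.
    by move=> /(sup_upper_bound supS) /=; rewrite gerDl leNgt e0.
move=> v; apply: le_trans (Smu v); rewrite ler_wpM2r ?sqr_ge0 //.
exact: eM.
Qed.

(** Row [i] of the inverse solves v M = e_i, so c |v|^2 <= v_i <= |v| and each of the [d] rows has
    norm at most 1/c. *)
Lemma inverse_frobenius_le (R : realType) (d : nat) (M : 'M[R]_d) (c : R) :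
  M^T = M -> 0 < c -> M \in unitmx ->
  (forall v : 'rV[R]_d, c * frobenius v ^+ 2 <= (v *m M *m v^T) 0 0) ->
  frobenius (invmx M) <= d%:R / c.
Proof.
move=> sM c0 uM hM.
have hr i : frobenius (row i (invmx M)) <= c^-1.
  set v := row i _; have vE : v *m M = delta_mx 0 i by rewrite -row_mul mulVmx // row1.
  have := hM v; rewrite vE -rowE => h.
  have h1 : c * frobenius v ^+ 2 <= frobenius v.
    apply: le_trans h _; apply: le_trans (ler_norm _) _; rewrite -[leRHS]frobenius_tr.
    by rewrite mxE; exact: le_frobenius.
  have [v0|v0] := leP (frobenius v) 0; first by rewrite (le_trans v0) // invr_ge0 ltW.
  move: h1; rewrite expr2 mulrA -ler_pdivlMr // mulfV ?gt_eqF // => h1.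
  by rewrite -[leRHS]mul1r ler_pdivlMr // mulrC.
have c1 : 0 <= c^-1 by rewrite invr_ge0 ltW.
rewrite -ler_sqr ?nnegrE ?frobenius_ge0 ?mulr_ge0 //.
rewrite frobenius_sq; apply: (@le_trans _ _ (\sum_(i < d) c^-1 ^+ 2)).
  apply: ler_sum => i _; apply: (@le_trans _ _ (frobenius (row i (invmx M)) ^+ 2)).
    by rewrite frobenius_sq big_ord1; apply: ler_sum => j _; rewrite mxE.
  by apply: le_pow => //; exact: frobenius_ge0.
rewrite sumr_const card_ord -(mulr_natl (c^-1 ^+ 2)) exprMn ler_wpM2r ?exprn_ge0 //.
by rewrite expr2 -natrM ler_nat; case: (d) => // k; exact: leq_pmull.
Qed.

Lemma resolvent_frobenius_le (R : realType) (n d : nat) (X : 'M[R]_(n, d)) (lam c : R)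
    (a0 : 'I_d) :
  0 < lam -> 0 < c -> c <= lambda_min (gram X + lam%:M) ->
  frobenius (resolvent (gram X) lam) <= d%:R / c.
Proof.
move=> lam0 c0 hc; set M := gram X + lam%:M in hc *.
have sM : M^T = M.
  by rewrite /M linearD /= tr_scalar_mx /gram linearZ /= trmx_mul trmxK.
have pM (u : 'rV[R]_d) : 0 <= (u *m M *m u^T) 0 0.
  rewrite /M mulmxDr mulmxDl mul_mx_scalar -scalemxAl mxE addr_ge0 ?psd_gram //.
  by rewrite mxE row_sq mulr_ge0 ?sqr_ge0 // ltW.
apply: inverse_frobenius_le => //; first exact: gram_shift_unit.
apply: least_eigenvalue_bound => // a ea; apply: (le_trans hc).
(* An infimum of a set without lower bound defaults to 0, which the hypothesis [0 < c] excludes. *)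
rewrite /lambda_min; apply: ge_inf => //; apply: contrapT => nl.
by move: hc; rewrite /lambda_min inf_out ?leNgt ?c0 // => -[].
Qed.
Lemma open_mx_measurable (R : realType) (n : nat) :
  @mx_measurable R _ (g_sigma_algebraType (@open 'cV[R]_n)) n 1 id.
Proof. by move=> a b; rewrite (ord1 b); exact: measurable_row_entry. Qed.

Lemma L1_of_expectation (R : realType) (disp : measure_display)
    (T : measurableType disp) (P : probability T R) (f : T -> R) (L : R) :
  measurable_fun setT f -> (forall t, 0 <= f t) -> ('E_P[f] <= L%:E)%E ->
  L1 P f /\ mean P f <= L.
Proof.
move=> mf f0 hE; have Lf : L1 P f.
  apply/integrableP; split; first exact/measurable_EFinP.
  move: hE; rewrite unlock => hE; apply: le_lt_trans (ltry L); apply: le_trans hE.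
  by under eq_integral => t _ do rewrite /= ger0_norm //.
by split=> //; move: hE; rewrite (expectationE Lf) lee_fin.
Qed.

Lemma pow4D_le (R : realFieldType) (x y : R) : (x + y) ^+ 4 <= 8 * (x ^+ 4 + y ^+ 4).
Proof.
have sq (u v : R) : (u + v) ^+ 2 <= 2 * (u ^+ 2 + v ^+ 2).
  have := sqr_ge0 (u - v); have -> : (u - v) ^+ 2 = u ^+ 2 - 2 * (u * v) + v ^+ 2 by ring.
  have -> : (u + v) ^+ 2 = u ^+ 2 + 2 * (u * v) + v ^+ 2 by ring.
  by lra.
have -> : (x + y) ^+ 4 = ((x + y) ^+ 2) ^+ 2 by ring.
apply: (@le_trans _ _ ((2 * (x ^+ 2 + y ^+ 2)) ^+ 2)).
  by apply: le_pow => //; exact: sqr_ge0.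
have := sq (x ^+ 2) (y ^+ 2).
have -> : (2 * (x ^+ 2 + y ^+ 2)) ^+ 2 = 4 * (x ^+ 2 + y ^+ 2) ^+ 2 by ring.
have -> : 8 * (x ^+ 4 + y ^+ 4) = 4 * (2 * ((x ^+ 2) ^+ 2 + (y ^+ 2) ^+ 2)) by ring.
by move=> h; rewrite ler_wpM2l.
Qed.

(** By [influenceE] the influence vector is at most KA (|cross deviation| + Kb |outer deviation|).
    The convexity factor 8 for fourth powers gives the constant, and equality in law carries the
    moments of row [i0] to all rows. *)
Lemma influence_rows (R : realType) (disp : measure_display)
    (T : measurableType disp) (P : probability T R) (n d m : nat)
    (s : 'I_m -> T -> 'cV[R]_n) (i0 : 'I_m) (X : 'M[R]_(n, d)) (y : 'cV[R]_n) (lam : R)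
    (Om : 'M[R]_d) (KA Kb L : R) :
  0 < lam -> iid_rows P s -> isotropic P (s i0) ->
  frobenius (resolvent (gram X) lam) <= KA -> frobenius (ridge X y lam) <= Kb ->
  ('E_P[fun t => (frobenius (outer_dev X (s i0 t)) ^+ 4 +
     frobenius (uval y (s i0 t) *: zvec X (s i0 t) - cross X y) ^+ 4)%R] <= L%:E)%E ->
  has_mx_mean P (fun t => influence X y lam (s i0 t) *m (influence X y lam (s i0 t))^T) Om ->
  centred_rows P s (influence X y lam) Om (8 * KA ^+ 4 * (1 + Kb ^+ 4) * L) /\
  centred_matrices P s (outer_dev X) (1 + L).
Proof.
move=> lam0 iid iso hA hb hL hOm.
have KA0 : 0 <= KA by apply: le_trans hA; exact: frobenius_ge0.
have Kb0 : 0 <= Kb by apply: le_trans hb; exact: frobenius_ge0.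
pose O := g_sigma_algebraType (@open 'cV[R]_n).
have mid := @open_mx_measurable R n.
have mpsi a : measurable_fun (setT : set O) (fun x => influence X y lam x a 0).
  exact: (@mx_measurable_influence R _ O n d X y lam id mid a 0).
have mz a b : measurable_fun (setT : set O) (fun x => outer_dev X x a b).
  exact: (@mx_measurable_outer_dev R _ O n d X id mid a b).
pose cr x := uval y x *: zvec X x - cross X y.
have mcr a : measurable_fun (setT : set O) (fun x => cr x a 0).
  have := @mx_measurableB R _ O d 1 (fun x => uval y x *: zvec X x) (fun=> cross X y).
  apply; last exact: mx_measurable_cst.
  by apply: mx_measurableZ; [exact: measurable_uval|exact: mx_measurable_zvec].
have mfz : measurable_fun (setT : set O) (fun x => frobenius (outer_dev X x) ^+ 2).
  rewrite (_ : (fun x => _) = fun x => \sum_a \sum_b outer_dev X x a b ^+ 2).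
    by apply: measurable_sum => a; apply: measurable_sum => b; exact: measurable_funX.
  by apply/funext => x; rewrite frobenius_sq.
pose phi x := frobenius (outer_dev X x) ^+ 4 + frobenius (cr x) ^+ 4.
have mphi : measurable_fun (setT : set O) phi.
  apply: measurable_funD; last first.
    by apply: measurable_funX; exact: (@measurable_frobenius R d _ O cr mcr).
  rewrite (_ : (fun x => _) = fun x => (frobenius (outer_dev X x) ^+ 2) ^+ 2).
    exact: measurable_funX.
  by apply/funext => x; rewrite -exprM.
have phi0 x : 0 <= phi x by rewrite addr_ge0 // exprn_ge0 // frobenius_ge0.
have [Lphi0 phiL0] : L1 P (phi \o s i0) /\ mean P (phi \o s i0) <= L.
  exact: (L1_of_expectation (measurable_row i0 iid mphi) (fun t => phi0 (s i0 t)) hL).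
have Lphi i : L1 P (phi \o s i) /\ mean P (phi \o s i) <= L.
  have [h1 h2] := row_mean_eq i iid mphi Lphi0.
  by split; [exact: h1|exact: (eq_ind_r (fun z : R => z <= L) phiL0 h2)].
have psi_le x : frobenius (influence X y lam x) ^+ 4 <= 8 * KA ^+ 4 * (1 + Kb ^+ 4) * phi x.
  rewrite influenceE // -/(cr x).
  have z0 := frobenius_ge0 (outer_dev X x); have c0 := frobenius_ge0 (cr x).
  have h : frobenius (resolvent (gram X) lam *m (cr x - outer_dev X x *m ridge X y lam)) <=
      KA * (frobenius (cr x) + frobenius (outer_dev X x) * Kb).
    apply: le_trans (frobeniusM _ _) _; apply: ler_pM => //; try exact: frobenius_ge0.
    apply: le_trans (frobeniusB _ _) _; rewrite lerD2l.
    by apply: le_trans (frobeniusM _ _) _; rewrite ler_wpM2l.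
  apply: (le_trans (le_pow 4 (frobenius_ge0 _) h)); rewrite exprMn.
  have -> : 8 * KA ^+ 4 * (1 + Kb ^+ 4) * phi x = KA ^+ 4 * (8 * ((1 + Kb ^+ 4) * phi x)) by ring.
  apply: ler_wpM2l; first exact: exprn_ge0.
  apply: le_trans (pow4D_le _ _) _; apply: ler_wpM2l => //.
  rewrite exprMn /phi.
  have z4 : 0 <= frobenius (outer_dev X x) ^+ 4 by exact: exprn_ge0.
  have c4 : 0 <= Kb ^+ 4 * frobenius (cr x) ^+ 4 by rewrite mulr_ge0 // exprn_ge0.
  rewrite mulrDl mul1r mulrDr; move: z4 c4; lra.
have mean_psi := influence_mean X y lam0 iso; move/has_mx_meanP in mean_psi.
move/has_mx_meanP in hOm.
split.
  split=> //.
  - move=> i; have [Li Vi] := Lphi i.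
    have LR : L1 P (fun t => 8 * KA ^+ 4 * (1 + Kb ^+ 4) * phi (s i t)) by exact: L1Z.
    have LP : L1 P (fun t => frobenius (influence X y lam (s i t)) ^+ 4).
      apply: L1_le LR _ => [|t]; last by rewrite ger0_norm ?exprn_ge0 ?frobenius_ge0.
      apply: measurable_funX; apply: measurable_frobenius => a.
      exact: (measurable_row i iid (mpsi a)).
    split=> //; apply: le_trans (mean_le LP LR (fun t => psi_le _)) _.
    rewrite meanZ //; apply: ler_wpM2l => //.
    by apply: mulr_ge0; [apply: mulr_ge0; rewrite ?exprn_ge0|apply: addr_ge0; rewrite ?exprn_ge0].
  - move=> i a; have [h1 h2] := mean_psi a 0.
    by have [_ ->] := row_mean_eq i iid (mpsi a) h1; rewrite [LHS]h2 mxE.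
  - move=> i a b; have [h1 h2] := hOm a b.
    have E t : (influence X y lam (s i0 t) *m (influence X y lam (s i0 t))^T) a b =
       influence X y lam (s i0 t) a 0 * influence X y lam (s i0 t) b 0.
      by rewrite mxE big_ord1 [X in _ * X]mxE.
    pose pr x := influence X y lam x a 0 * influence X y lam x b 0.
    have mpr : measurable_fun (setT : set O) pr by exact: measurable_funM.
    have prE : pr \o s i0 = fun t =>
        (influence X y lam (s i0 t) *m (influence X y lam (s i0 t))^T) a b.
      by apply/funext => t; rewrite E.
    have Lpr : L1 P (pr \o s i0) by rewrite prE.
    have [_ h3] := row_mean_eq i iid mpr Lpr.
    exact: (etrans h3 (etrans (congr1 (mean P) prE) h2)).
split=> //.
- move=> i; have [Li Vi] := Lphi i.
  have LR : L1 P (fun t => 1 + phi (s i t)) by apply: L1D => //; exact: L1_cst.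
  have le t : frobenius (outer_dev X (s i t)) ^+ 2 <= 1 + phi (s i t).
    apply: le_trans (pow_le_fourth (frobenius_ge0 _) (isT : (2 <= 4)%N)) _.
    by rewrite lerD2l lerDl exprn_ge0 // frobenius_ge0.
  have Lz : L1 P (fun t => frobenius (outer_dev X (s i t)) ^+ 2).
    apply: L1_le LR _ => [|t]; first exact: (measurable_row i iid mfz).
    by rewrite ger0_norm ?sqr_ge0.
  split=> //; apply: le_trans (mean_le Lz LR le) _.
  by rewrite meanD ?mean_cst ?lerD2l //; exact: L1_cst.
- have /has_mx_meanP hz := outer_dev_mean X iso.
  move=> i a b; have [h1 h2] := hz a b.
  by have [_ ->] := row_mean_eq i iid (mz a b) h1; rewrite [LHS]h2 mxE.
Qed.

Lemma limn_einf_ge (R : realType) (u : nat -> \bar R) (l : \bar R) :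
  (\forall n \near \oo, (l <= u n)%E) -> (l <= limn_einf u)%E.
Proof.
move=> hu; have -> : limn_einf u = limf_einf u \oo by [].
rewrite limf_einfE; apply: le_trans (ereal_sup_ubound _); last first.
  by exists [set n | (l <= u n)%E].
by apply: le_ereal_inf_tmp => /= _ [n /= h <-].
Qed.

Lemma cvg_entry (R : realType) (p q : nat) (F : nat -> 'M[R]_(p, q)) (L : 'M[R]_(p, q))
    (i : 'I_p) (j : 'I_q) :
  F n @[n --> \oo] --> L -> F n i j @[n --> \oo] --> L i j.
Proof. by move=> hF; exact: (cvg_comp _ _ hF (@coord_continuous R p q i j L)). Qed.

Lemma near_frobenius_le (R : realType) (p q : nat) (F : nat -> 'M[R]_(p, q)) (L : 'M[R]_(p, q)) :
  F n @[n --> \oo] --> L ->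
  exists K, \forall n \near \oo, frobenius (F n) <= K.
Proof.
move=> hF; pose S := \sum_i \sum_j (`|L i j| + 1) ^+ 2.
have S0 : 0 <= S by apply: sumr_ge0 => i _; apply: sumr_ge0 => j _; exact: sqr_ge0.
exists (1 + S).
have h : \forall n \near \oo, forall ij : 'I_p * 'I_q, `|F n ij.1 ij.2| <= `|L ij.1 ij.2| + 1.
  apply: filter_forall => -[i j] /=.
  have hij := cvg_entry (i := i) (j := j) hF.
  have lt1 : `|L i j| < `|L i j| + 1 by rewrite ltrDl.
  exact: (@cvgr_norm_le _ _ _ _ _ (fun n => F n i j) (L i j) hij _ lt1).
apply: filterS h => n h.
have hn : frobenius (F n) ^+ 2 <= S.
  rewrite frobenius_sq; apply: ler_sum => i _; apply: ler_sum => j _.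
  rewrite -[F n i j ^+ 2]real_normK ?num_real //; apply: le_pow => //.
  exact: (h (i, j)).
have f0 := frobenius_ge0 (F n).
have := sqr_ge0 (frobenius (F n) - 1).
have -> : (frobenius (F n) - 1) ^+ 2 = frobenius (F n) ^+ 2 - 2 * frobenius (F n) + 1 by ring.
by lra.
Qed.

(** A nonzero entry forces a positive diagonal one, since 2 |E(v_a v_b)| <= E(v_a^2) + E(v_b^2)
    passes to the limit. This is the direction used by the random walk. *)
Lemma cov_diag_gt0 (R : realType) (disp : nat -> measure_display)
    (T : forall n, measurableType (disp n)) (P : forall n, probability (T n) R)
    (d : nat) (v : forall n, T n -> 'cV[R]_d) (Om : nat -> 'M[R]_d) (Omega : 'M[R]_d) :
  (forall n, (0 < n)%N -> has_mx_mean (P n) (fun t => v n t *m (v n t)^T) (Om n)) ->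
  Om n @[n --> \oo] --> Omega -> Omega != 0 ->
  exists a, 0 < Omega a a.
Proof.
move=> hOm cOm Om0.
have [a [b ab0]] : exists a b, Omega a b != 0.
  apply: contrapT => h; move/eqP: Om0; apply; apply/matrixP => a b; rewrite mxE.
  by apply/eqP; apply: contrapT => /negP ab; apply: h; exists a, b.
have key n : (0 < n)%N -> 2 * `|Om n a b| <= Om n a a + Om n b b.
  move=> n0; have /has_mx_meanP h := hOm n n0.
  have [[Lab <-] [Laa <-] [Lbb <-]] := And3 (h a b) (h a a) (h b b).
  apply: (@le_trans _ _ (2 * mean (P n) (fun t => `|(v n t *m (v n t)^T) a b|))).
    by rewrite ler_wpM2l // mean_norm.
  rewrite -meanD // -meanZ; last exact: L1_norm.
  apply: mean_le => [||t]; [exact: L1Z (L1_norm Lab)|exact: L1D|].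
  rewrite !mxE !big_ord1 !mxE normrM.
  rewrite -[_ * _ in X in _ <= X + _]expr2 -[_ * _ in X in _ <= _ + X]expr2.
  rewrite -[X in _ <= X + _]real_normK ?num_real // -[X in _ <= _ + X]real_normK ?num_real //.
  move: (`|_|) (`|_|) => x y; have := sqr_ge0 (x - y).
  have -> : (x - y) ^+ 2 = x ^+ 2 - 2 * (x * y) + y ^+ 2 by ring.
  by lra.
have lim : 2 * `|Omega a b| <= Omega a a + Omega b b.
  have c1 : 2 * `|Om n a b| @[n --> \oo] --> 2 * `|Omega a b|.
    by apply: cvgM; [exact: cvg_cst|apply: cvg_norm; exact: cvg_entry].
  have c2 : Om n a a + Om n b b @[n --> \oo] --> Omega a a + Omega b b.
    by apply: cvgD; exact: cvg_entry.
  apply: (ler_cvg_to c1 c2); exists 1%N => // n /= n1; exact: key.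
have n0 : 0 < `|Omega a b| by rewrite normr_gt0.
have [h|h] := ltP 0 (Omega a a); first by exists a.
by exists b; move: lim n0 h; lra.
Qed.
Lemma centred_rows_le (R : realType) (disp : measure_display)
    (T : measurableType disp) (P : probability T R) (n m d : nat)
    (s : 'I_m -> T -> 'cV[R]_n) (psi : 'cV[R]_n -> 'cV[R]_d) (Om : 'M[R]_d) (K K' : R) :
  K <= K' -> centred_rows P s psi Om K -> centred_rows P s psi Om K'.
Proof.
move=> KK' [h1 h2 h3 h4 h5]; split=> // i; have [h6 h7] := h3 i.
by split=> //; exact: le_trans KK'.
Qed.

Lemma centred_matrices_le (R : realType) (disp : measure_display)
    (T : measurableType disp) (P : probability T R) (n m p q : nat)
    (s : 'I_m -> T -> 'cV[R]_n) (zeta : 'cV[R]_n -> 'M[R]_(p, q)) (K K' : R) :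
  K <= K' -> centred_matrices P s zeta K -> centred_matrices P s zeta K'.
Proof.
move=> KK' [h1 h2 h3]; split=> // i; have [h6 h7] := h2 i.
by split=> //; exact: le_trans KK'.
Qed.

Theorem proposition3 (R : realType) (d : nat) :
  (* (a) *)
  (forall (n m B : nat) (hn : (0 < n)%N) (hm : (0 < m)%N) (hB : (0 < B)%N)
     (alpha delta : R) (X : 'M[R]_(n, d)) (y : 'cV[R]_n) (lam : R)
     (disp : measure_display) (T : measurableType disp) (P : probability T R)
     (s : 'I_m -> T -> 'cV[R]_n) (w : 'I_B -> T -> {ffun 'I_m -> nat}),
     0 < alpha < 1 -> 0 < delta < 1 -> 0 < lam ->
     iid_rows P s ->
     isotropic P (s (Ordinal hm)) ->
     boot_weights P s w ->
     let err (b : 'I_B) (t : T) := boot_error X y lam (s^~ t) (w b t) in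
     let eps (t : T) := mc_bound alpha delta (err^~ t) in
     forall kappa : T -> probability R R,
       cond_law P (sketch_sigma s) (err (Ordinal hB)) kappa ->
       let q (t : T) := quantile (kappa t) (1 - alpha) in
       forall Y : T -> R,
         cond_prob P (sketch_sigma s) [set t | ((q t)%:E <= eps t)%E] Y ->
         {ae P, forall t, 1 - delta <= Y t})
  /\
  (* (b) *)
  (forall (alpha delta : R) (m B : nat -> nat)
     (hm : forall n, (0 < m n)%N) (hB : forall n, (0 < B n)%N)
     (X : forall n, 'M[R]_(n, d)) (y : forall n, 'cV[R]_n) (lam : nat -> R)
     (disp : nat -> measure_display) (T : forall n, measurableType (disp n))
     (P : forall n, probability (T n) R)
     (s : forall n, 'I_(m n) -> T n -> 'cV[R]_n)
     (w : forall n, 'I_(B n) -> T n -> {ffun 'I_(m n) -> nat})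
     (laminf : R) (H : 'M[R]_d) (g : 'cV[R]_d) (c0 : R)
     (Om : nat -> 'M[R]_d) (Omega : 'M[R]_d),
     let s1 (n : nat) := s n (Ordinal (hm n)) in
     let z (n : nat) (t : T n) := zvec (X n) (s1 n t) in
     let u (n : nat) (t : T n) := uval (y n) (s1 n t) in
     let psi (n : nat) (t : T n) :=
       influence (X n) (y n) (lam n) (s1 n t) in
     0 < alpha < 1 -> 0 < delta < 1 ->
     (forall n, (0 < n)%N -> 0 < lam n) ->
     m n @[n --> \oo] --> \oo ->
     (forall n, (0 < n)%N -> boot_weights (P n) (s n) (w n)) ->
     (* (i) *)
     lam n @[n --> \oo] --> laminf -> 0 <= laminf ->
     gram (X n) @[n --> \oo] --> H ->
     cross (X n) (y n) @[n --> \oo] --> g ->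
     0 < c0 ->
     (\forall n \near \oo, c0 <= lambda_min (gram (X n) + (lam n)%:M)) ->
     (* (ii) *)
     (forall n, (0 < n)%N -> iid_rows (P n) (s n)) ->
     (forall n, (0 < n)%N -> isotropic (P n) (s1 n)) ->
     (ereal_sup [set 'E_(P n)[fun t =>
          (frobenius (z n t *m (z n t)^T - gram (X n)) ^+ 4
           + frobenius (u n t *: z n t - cross (X n) (y n)) ^+ 4)%R]
        | n in [set n | (0 < n)%N]] < +oo)%E ->
     (forall n, (0 < n)%N ->
        has_mx_mean (P n) (fun t => psi n t *m (psi n t)^T) (Om n)) ->
     Om n @[n --> \oo] --> Omega ->
     (* (iii) *)
     (1 <= \rank Omega)%N ->
     (forall n, (0 < n)%N -> mc_rank (B n) (1 - alpha) delta != None) ->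
     ((1 - alpha - delta)%:E <=
        limn_einf (fun n => P n
          [set t | ((frobenius (sketched_ridge (X n) (y n) (lam n) ((s n)^~ t)
                                - ridge (X n) (y n) (lam n)))%:E <=
                    mc_bound alpha delta
                      (fun b => boot_error (X n) (y n) (lam n) ((s n)^~ t)
                                  (w n b t)))%E]))%E).
Proof.
split.
  move=> n m B hn hm hB alpha delta X y lam disp T P s w al de lam0 iid _ bw.
  exact: bootstrap_bound_coverage.
move=> alpha delta m B hm hB X y lam disp T P s w laminf H g c0 Om Omega s1 z u psi.
move=> al de lam0 m_oo bw _ _ _ g_cvg c00 lmin iid iso sup_lt Om_mean Om_cvg rkOm _.
have /andP[al0 al1] := al.
have Om0 : Omega != 0 by apply: contraTneq rkOm => ->; rewrite mxrank0.
have [a Oa0] := cov_diag_gt0 Om_mean Om_cvg Om0.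
have [Kg hKg] := near_frobenius_le g_cvg.
have [KO hKO] := near_frobenius_le Om_cvg.
have [L hL] : exists L : R, forall n, (0 < n)%N ->
    ('E_(P n)[fun t => (frobenius (z n t *m (z n t)^T - gram (X n)) ^+ 4 +
       frobenius (u n t *: z n t - cross (X n) (y n)) ^+ 4)%R] <= L%:E)%E.
  move: sup_lt; set S := ereal_sup _ => S_lt.
  have hS n : (0 < n)%N -> ('E_(P n)[fun t => (frobenius (z n t *m (z n t)^T - gram (X n)) ^+ 4 +
       frobenius (u n t *: z n t - cross (X n) (y n)) ^+ 4)%R] <= S)%E.
    by move=> n0; apply: ereal_sup_ubound; exists n.
  move: S_lt hS; case: S => [r| |] // _ hS; first by exists r.
  by exists 0 => n n0; apply: le_trans (hS n n0) _; rewrite leNye.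
pose KA := d%:R / c0.
have KA0 : 0 <= KA by rewrite divr_ge0 // ltW.
pose Kb := KA * `|Kg|.
pose Kpsi := 8 * KA ^+ 4 * (1 + Kb ^+ 4) * L.
(* Absolute values make every summand nonnegative, so that [K] is at least 1 and dominates each
   constant separately. *)
pose K := 1 + `|Kpsi| + `|L| + KA + `|KO|.
have K1 : 1 <= K.
  have := normr_ge0 Kpsi; have := normr_ge0 L; have := normr_ge0 KO; rewrite /K; move: KA0.
  by clear; lra.
have c20 : 0 < Omega a a / 2 by rewrite divr_gt0.
apply/lee_addgt0Pr => e e0.
(* The first bound makes the loss [5 * kappa] at most [e]; the second ensures
   [alpha + 3 * kappa < 1]. *)
pose kappa := Num.min (e / 5) ((1 - alpha) / 4).
have ka0 : 0 < kappa by rewrite lt_min !divr_gt0 // subr_gt0.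
have kae : kappa <= e / 5 by rewrite ge_min lexx.
have kaa : kappa <= (1 - alpha) / 4 by rewrite ge_min lexx orbT.
have ak : alpha + 3 * kappa < 1 by move: kaa ka0 al1; clear; lra.
have [m0 cov] := finite_coverage d al de ka0 ak K1 c20.
rewrite -leeBlDr //; apply: limn_einf_ge.
have m_ge : \forall n \near \oo, (m0 <= m n)%N by move/cvgnyPge: m_oo; apply.
have Oa_ge : \forall n \near \oo, Omega a a / 2 < Om n a a.
  by apply: (cvgr_gt (Omega a a)); [exact: cvg_entry|move: Oa0; clear; lra].
have n_gt0 : \forall n \near \oo, (0 < n)%N by exists 1%N.
near=> n.
have n0 : (0 < n)%N by near: n.
have hA : frobenius (resolvent (gram (X n)) (lam n)) <= KA.
  by apply: (resolvent_frobenius_le a (lam0 n n0) c00); near: n.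
have hb : frobenius (ridge (X n) (y n) (lam n)) <= Kb.
  apply: le_trans (frobeniusM _ _) _; apply: ler_pM => //; try exact: frobenius_ge0.
  by apply: le_trans (ler_norm _); near: n.
have [cr cz] := influence_rows (i0 := Ordinal (hm n)) (lam0 n n0) (iid n n0) (iso n n0) hA hb
  (hL n n0) (Om_mean n n0).
have Kpsi_le : Kpsi <= K.
  have := ler_norm Kpsi; have := normr_ge0 L; have := normr_ge0 KO; rewrite /K; move: KA0.
  by clear; lra.
have KL : 1 + L <= K.
  have := ler_norm L; have := normr_ge0 Kpsi; have := normr_ge0 KO; rewrite /K; move: KA0.
  by clear; lra.
have KAK : KA <= K.
  have := normr_ge0 L; have := normr_ge0 Kpsi; have := normr_ge0 KO; rewrite /K; move: KA0.
  by clear; lra.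
have OmK : frobenius (Om n) <= K.
  apply: (@le_trans _ _ KO); first by near: n.
  have := ler_norm KO; have := normr_ge0 Kpsi; have := normr_ge0 L; rewrite /K; move: KA0.
  by clear; lra.
have mn : (m0 <= m n)%N by near: n.
have Oan : Omega a a / 2 <= Om n a a by apply: ltW; near: n.
have := cov _ _ (P n) n (m n) (B n) (X n) (y n) (lam n) (s n) (w n) (Om n) a mn (hm n)
  (lam0 n n0) (bw n n0) (centred_rows_le Kpsi_le cr) (centred_matrices_le KL cz)
  (le_trans hA KAK) OmK Oan.
move=> h; set E := [set t | _] in h *.
have : (0 <= P n E)%E by exact: measure_ge0.
case: (P n E) h => [r| |] //= h _; last by rewrite leey.
by rewrite -EFinB lee_fin; move: h kae; clear; lra.
Unshelve. all: by end_near.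
Qed.
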